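(* Let $(m_l)_{l\ge3}$ be integers with $|m_l|\le l$ and $\lim_{l\to\infty}m_l/l=q\in[-1,1]$. Then $$\lim_{l\to\infty}C(e^0_3,e^{m_l}_l)=-\frac{525}{32\pi}q^4(1-q^2).$$
   Context: $C$ is the sectional curvature of $\mathrm{SDiff}(\mathbb S^2)$ (right-invariant $L^2$ metric for the area form $\sin\theta\,d\theta\wedge d\phi$), defined for complex directions by $C(u,v)=\langle R(u,v)u,v\rangle/(\|u\|^2\|v\|^2-|\langle u,v\rangle|^2)$ with $R$ extended complex-linearly and the Hermitian $L^2$ product; $R(u,v)w=-\nabla_u\nabla_vw+\nabla_v\nabla_uw+\nabla_{[u,v]}w$, $\nabla_uv=\frac12([u,v]-B(u,v)-B(v,u))$, $\langle B(u,v),w\rangle=\langle u,[v,w]\rangle$. $e^m_l=\mathrm{sgrad}(Y^m_l/\sqrt{l(l+1)})$, $\mathrm{sgrad}f=\frac1{\sin\theta}(\partial_\phi f\partial_\theta-\partial_\theta f\partial_\phi)$, where $Y^m_l=\big[\frac{(l-m)!}{(l+m)!}\frac{2l+1}{4\pi}\big]^{1/2}e^{im\phi}P^m_l(\cos\theta)$, $P^m_l(z)=(1-z^2)^{m/2}\frac1{2^ll!}\frac{d^{l+m}}{dz^{l+m}}(z^2-1)^l$. In particular $e^0_3=\frac18\sqrt{21/\pi}(5\cos^2\theta-1)\partial_\phi$. *)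

(* Defs.v *)
From Stdlib Require Import Reals Lra ZArith List ClassicalEpsilon.
From Coquelicot Require Import Coquelicot.
Open Scope R_scope.

Definition dth (f : R -> R -> C) (th ph : R) : C :=
  (Derive (fun t => fst (f t ph)) th, Derive (fun t => snd (f t ph)) th).
Definition dph (f : R -> R -> C) (th ph : R) : C :=
  (Derive (fun t => fst (f th t)) ph, Derive (fun t => snd (f th t)) ph).

Definition CInt (g : R -> C) (a b : R) : C :=
  (RInt (fun t => fst (g t)) a b, RInt (fun t => snd (g t)) a b).

Definition pt3 := (R * R * R)%type.

Definition shift3 (p : pt3) (i : nat) (t : R) : pt3 :=
  match p with (x, y, z) =>
    match i with 0%nat => (x + t, y, z) | 1%nat => (x, y + t, z) | _ => (x, y, z + t) end
  end.

Definition pd3 (i : nat) (g : pt3 -> R) (p : pt3) : R :=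
  Derive (fun t => g (shift3 p i t)) 0.

Fixpoint D3 (ds : list nat) (g : pt3 -> R) : pt3 -> R :=
  match ds with nil => g | i :: ds' => pd3 i (D3 ds' g) end.

Definition cont3 (g : pt3 -> R) : Prop :=
  forall (p : pt3) (eps : R), 0 < eps -> exists delta, 0 < delta /\
    forall q : pt3,
      Rabs (fst (fst q) - fst (fst p)) < delta ->
      Rabs (snd (fst q) - snd (fst p)) < delta ->
      Rabs (snd q - snd p) < delta ->
      Rabs (g q - g p) < eps.

Definition smooth3R (g : pt3 -> R) : Prop :=
  forall ds : list nat, cont3 (D3 ds g) /\
    forall (i : nat) (p : pt3), ex_derive (fun t => D3 ds g (shift3 p i t)) 0.

Definition smooth3C (F : pt3 -> C) : Prop :=
  smooth3R (fun p => fst (F p)) /\ smooth3R (fun p => snd (F p)).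

Definition sph (th ph : R) : pt3 := (sin th * cos ph, sin th * sin ph, cos th).

(* Complex vector fields on S^2, in the coordinate frame               *)
(*   X = fst X * d/dtheta + snd X * d/dphi                              *)
Definition vf := R -> R -> (C * C)%type.

Definition vzero : vf := fun _ _ => (RtoC 0, RtoC 0).
Definition vadd (X Y : vf) : vf :=
  fun th ph => (Cplus (fst (X th ph)) (fst (Y th ph)), Cplus (snd (X th ph)) (snd (Y th ph))).
Definition vscal (c : C) (X : vf) : vf :=
  fun th ph => (Cmult c (fst (X th ph)), Cmult c (snd (X th ph))).
Definition vopp (X : vf) : vf := vscal (RtoC (-1)) X.
Definition vsub (X Y : vf) : vf := vadd X (vopp Y).
Definition vconj (X : vf) : vf :=
  fun th ph => (Cconj (fst (X th ph)), Cconj (snd (X th ph))).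

Definition compth (X : vf) : R -> R -> C := fun th ph => fst (X th ph).
Definition compph (X : vf) : R -> R -> C := fun th ph => snd (X th ph).

Definition bracket (X Y : vf) : vf := fun th ph =>
  let dir (f : R -> R -> C) (Z : vf) :=
      Cplus (Cmult (fst (Z th ph)) (dth f th ph)) (Cmult (snd (Z th ph)) (dph f th ph)) in
  (Cminus (dir (compth Y) X) (dir (compth X) Y),
   Cminus (dir (compph Y) X) (dir (compph X) Y)).

Definition sgrad (f : R -> R -> C) : vf := fun th ph =>
  (Cmult (RtoC (/ sin th)) (dph f th ph),
   Cmult (RtoC (- / sin th)) (dth f th ph)).

(* complexified Lie algebra of SDiff(S^2): divergence-free smooth fields
   = Hamiltonian fields sgrad f, f smooth complex function on S^2 *)
Definition sdiff_alg (X : vf) : Prop :=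
  exists F : pt3 -> C, smooth3C F /\
    forall th ph, X th ph = sgrad (fun t p => F (sph t p)) th ph.

(* complex-bilinear L^2 pairing for the round metric d th^2 + sin^2 th d ph^2
   and area form sin th d th d ph *)
Definition pairb (X Y : vf) : C :=
  CInt (fun th =>
    CInt (fun ph =>
      Cmult (Cplus (Cmult (fst (X th ph)) (fst (Y th ph)))
                   (Cmult (RtoC (sin th ^ 2)) (Cmult (snd (X th ph)) (snd (Y th ph)))))
            (RtoC (sin th))) 0 (2 * PI)) 0 PI.

Definition herm (X Y : vf) : C := pairb X (vconj Y).

(* B(u,v): the element of the Lie algebra with <B(u,v),w> = <u,[v,w]> for all w
   (complex-bilinear extension of the real definition) *)
Definition Bop (X Y : vf) : vf :=
  epsilon (inhabits vzero)
    (fun Z => sdiff_alg Z /\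
       forall W, sdiff_alg W -> pairb Z W = pairb X (bracket Y W)).

Definition nabla (X Y : vf) : vf :=
  vscal (RtoC (1/2)) (vsub (vsub (bracket X Y) (Bop X Y)) (Bop Y X)).

Definition Rcurv (X Y W : vf) : vf :=
  vadd (vadd (vopp (nabla X (nabla Y W))) (nabla Y (nabla X W))) (nabla (bracket X Y) W).

Definition sec (X Y : vf) : C :=
  Cdiv (herm (Rcurv X Y X) Y)
       (Cminus (Cmult (herm X X) (herm Y Y)) (RtoC (Cmod (herm X Y) ^ 2))).

Definition Plm (l : nat) (m : Z) (z : R) : R :=
  powerRZ (sqrt (1 - z ^ 2)) m * / (2 ^ l * INR (fact l)) *
  Derive_n (fun x => (x ^ 2 - 1) ^ l) (Z.to_nat (Z.of_nat l + m)) z.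

Definition Ylm (l : nat) (m : Z) (th ph : R) : C :=
  Cmult (RtoC (sqrt (INR (fact (Z.to_nat (Z.of_nat l - m))) /
                     INR (fact (Z.to_nat (Z.of_nat l + m))) *
                     ((2 * INR l + 1) / (4 * PI))) * Plm l m (cos th)))
        (cos (IZR m * ph), sin (IZR m * ph)).

Definition e_lm (l : nat) (m : Z) : vf :=
  sgrad (fun th ph => Cdiv (Ylm l m th ph) (RtoC (sqrt (INR l * (INR l + 1))))).

(* Main.v *)
Require Import Defs.
From Stdlib Require Import Reals Lra Lia ZArith List ClassicalEpsilon.
From Coquelicot Require Import Coquelicot.
Import ListNotations.
Open Scope R_scope.

(* Every field here is the Hamiltonian field of a stream function.  In terms of streams,
   with Lam = - Laplacian, B(f, g) = Lam^-1 {Lam f, g}.  The field u = e^0_3 is w d/dphi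
   with w = r (5 cos^2 theta - 1), so {f_u, g} = i m w g on the Fourier mode e^(i m phi),
   and for Lam g = lam g
     nabla_u g = (i m / 2) (1 + (lam - 12) Lam^-1) (w g),
     nabla_g u = (i m / 2) (-1 + (lam - 12) Lam^-1) (w g),     nabla_u u = 0.
   By the three-term recurrence of the Legendre functions w only couples the degrees
   l - 2, l and l + 2, hence C(u, e^m_l) is an explicit rational function of l and m^2.
   The parts of order l coming from l + 2 and l - 2 cancel, and what is left is continuous
   in (1/l, (m/l)^2) at (0, q^2).
   B is only known through its pairings, so each B is identified by checking the pairing
   identity against an arbitrary field W = sgrad h: integrating in phi first reduces it to
   an identity between the Fourier coefficients of h. *)

(** * Smooth functions in spherical coordinates *)

(** [Bop] is a choice, so a candidate for B counts only once it is known to come from a smooth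
    function on R^3. This dictates the streams: finite combinations of Legendre functions times e^(i
    m phi). With M = |m|, each is (x + i y)^M or (x - i y)^M times a polynomial in z, an explicit
    smooth extension of a function singular in coordinates. The family is stable under
    multiplication by w, and Lam^-1 is division of the coefficient of degree l by l (l + 1), so the
    Poisson equation is solved by inspection in degrees at least 1. The poles, where 1 / sin theta
    blows up, are handled by comparing fields on the open chart only and by clearing the
    denominators in each integral. Curvature is unchanged when either argument is rescaled, so the
    normalisations of the harmonics stay unknown nonzero scalars; the only norm evaluated is that of
    u, with squared value 64 pi r^2 / 21. With Y = q^2 the remaining limit is -50 Y^2 (1 - Y), and
    -50 * 21 / 64 = -525 / 32. *)

Lemma pt3_ext (x y z x' y' z' : R) : x = x' -> y = y' -> z = z' -> (x, y, z) = (x', y', z') :> pt3.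
Proof. now intros -> -> ->. Qed.

Lemma D3_app (ds es : list nat) (g : pt3 -> R) : D3 ds (D3 es g) = D3 (ds ++ es) g.
Proof. induction ds as [|i ds IH]; simpl; [reflexivity|]. now rewrite IH. Qed.

Lemma smooth3R_pd3 (i : nat) (g : pt3 -> R) : smooth3R g -> smooth3R (pd3 i g).
Proof.
  intros H ds. change (pd3 i g) with (D3 [i] g). rewrite D3_app. apply H.
Qed.

(** [smooth3R] grants derivatives at parameter 0 only; moving the base point along the axis
    transports them to every parameter. *)
Lemma smooth3R_shift (g : pt3 -> R) (i : nat) (p : pt3) (s : R) :
  smooth3R g -> is_derive (fun t => g (shift3 p i t)) s (pd3 i g (shift3 p i s)).
Proof.
  intros H. destruct (H nil) as [_ Hd]. specialize (Hd i (shift3 p i s)). simpl in Hd.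
  apply Derive_correct in Hd. fold (pd3 i g (shift3 p i s)) in Hd.
  apply is_derive_ext with (fun t => (fun r => g (shift3 (shift3 p i s) i r)) (t - s)).
  - intros t. f_equal. destruct p as [[x y] z]. destruct i as [|[|i]]; simpl; apply pt3_ext; ring.
  - replace (pd3 i g (shift3 p i s)) with (scal 1 (pd3 i g (shift3 p i s)))
      by (unfold scal; simpl; unfold mult; simpl; ring).
    apply (is_derive_comp (fun r => g (shift3 (shift3 p i s) i r)) (fun t => t - s)).
    + replace (s - s) with 0 by ring. exact Hd.
    + auto_derive; [trivial | ring].
Qed.

Lemma smooth3R_line (g : pt3 -> R) (i : nat) (p : pt3) (s : R) : smooth3R g ->
  exists c, Rmin 0 s <= c <= Rmax 0 s /\
    g (shift3 p i s) - g p = pd3 i g (shift3 p i c) * s.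
Proof.
  intros H.
  destruct (MVT_gen (fun t => g (shift3 p i t)) 0 s (fun t => pd3 i g (shift3 p i t)))
    as [c [Hc E]].
  - intros x _. now apply smooth3R_shift.
  - intros x _. apply continuity_pt_filterlim.
    apply (ex_derive_continuous (fun t => g (shift3 p i t))).
    eexists. now apply smooth3R_shift.
  - exists c. split; [exact Hc|].
    replace (shift3 p i 0) with p in E by
      (destruct p as [[x y] z]; destruct i as [|[|i]]; simpl; apply pt3_ext; ring).
    simpl in E. rewrite E. ring.
Qed.

(** Continuous partial derivatives give Fréchet differentiability: the increment is split into three
    moves parallel to the axes, and the mean value theorem turns each into a partial derivative at a
    nearby point. *)
Lemma smooth3R_differentiable (g : pt3 -> R) (x y z : R) : smooth3R g ->
  forall eps, 0 < eps -> exists delta, 0 < delta /\ forall a b c,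
    Rabs a < delta -> Rabs b < delta -> Rabs c < delta ->
    Rabs (g (x + a, y + b, z + c) - g (x, y, z)
          - (pd3 0 g (x, y, z) * a + pd3 1 g (x, y, z) * b + pd3 2 g (x, y, z) * c))
    <= eps * (Rabs a + Rabs b + Rabs c).
Proof.
  intros H eps He.
  destruct (proj1 (smooth3R_pd3 0 g H nil) (x, y, z) eps He) as [d0 [D0 C0]].
  destruct (proj1 (smooth3R_pd3 1 g H nil) (x, y, z) eps He) as [d1 [D1 C1]].
  destruct (proj1 (smooth3R_pd3 2 g H nil) (x, y, z) eps He) as [d2 [D2 C2]].
  simpl in C0, C1, C2.
  exists (Rmin d0 (Rmin d1 d2)).
  split; [repeat apply Rmin_glb_lt; assumption|].
  intros a b c Ha Hb Hc.
  assert (L0 := Rmin_l d0 (Rmin d1 d2)). assert (L1 := Rmin_r d0 (Rmin d1 d2)).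
  assert (L2 := Rmin_l d1 d2). assert (L3 := Rmin_r d1 d2).
  assert (Hbet : forall s u, Rmin 0 s <= u <= Rmax 0 s -> Rabs u <= Rabs s).
  { intros s u. unfold Rmin, Rmax, Rabs.
    destruct (Rle_dec 0 s); destruct (Rcase_abs u); destruct (Rcase_abs s); lra. }
  destruct (smooth3R_line g 0 (x, y + b, z + c) a H) as [u [Hu Eu]].
  destruct (smooth3R_line g 1 (x, y, z + c) b H) as [v [Hv Ev]].
  destruct (smooth3R_line g 2 (x, y, z) c H) as [w [Hw Ew]].
  apply Hbet in Hu. apply Hbet in Hv. apply Hbet in Hw. simpl in Eu, Ev, Ew.
  assert (Z : Rabs (x - x) < d0 /\ Rabs (x - x) < d1 /\ Rabs (x - x) < d2 /\
              Rabs (y - y) < d1 /\ Rabs (y - y) < d2).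
  { replace (x - x) with 0 by ring. replace (y - y) with 0 by ring.
    rewrite Rabs_R0. tauto. }
  assert (A : forall p s, p + s - p = s) by (intros; ring).
  specialize (C0 (x + u, y + b, z + c)). specialize (C1 (x, y + v, z + c)).
  specialize (C2 (x, y, z + w)). simpl in C0, C1, C2. 
  rewrite (A x), (A y), (A z) in C0. rewrite (A y), (A z) in C1. rewrite (A z) in C2.
  destruct Z as [Z0 [Z1 [Z2 [Z3 Z4]]]].
  assert (C0' := C0 (ltac:(lra) : Rabs u < d0) (ltac:(lra) : Rabs b < d0) (ltac:(lra) : Rabs c < d0)).
  assert (C1' := C1 Z1 (ltac:(lra) : Rabs v < d1) (ltac:(lra) : Rabs c < d1)).
  assert (C2' := C2 Z2 Z4 (ltac:(lra) : Rabs w < d2)).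
  clear C0 C1 C2.
  replace (g (x + a, y + b, z + c) - g (x, y, z)
          - (pd3 0 g (x, y, z) * a + pd3 1 g (x, y, z) * b + pd3 2 g (x, y, z) * c))
    with ((pd3 0 g (x + u, y + b, z + c) - pd3 0 g (x, y, z)) * a
          + (pd3 1 g (x, y + v, z + c) - pd3 1 g (x, y, z)) * b
          + (pd3 2 g (x, y, z + w) - pd3 2 g (x, y, z)) * c)
    by (rewrite !Rmult_minus_distr_r, <- Eu, <- Ev, <- Ew; ring).
  eapply Rle_trans; [apply Rabs_triang|]. rewrite Rmult_plus_distr_l.
  apply Rplus_le_compat.
  - eapply Rle_trans; [apply Rabs_triang|]. rewrite Rmult_plus_distr_l.
    apply Rplus_le_compat; rewrite Rabs_mult; apply Rmult_le_compat_r;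
      solve [apply Rabs_pos | apply Rlt_le; assumption].
  - rewrite Rabs_mult; apply Rmult_le_compat_r; [apply Rabs_pos | apply Rlt_le; assumption].
Qed.

Lemma smooth3R_chain (g : pt3 -> R) (X Y Z : R -> R) (t x' y' z' : R) : smooth3R g ->
  is_derive X t x' -> is_derive Y t y' -> is_derive Z t z' ->
  is_derive (fun s => g (X s, Y s, Z s)) t
    (pd3 0 g (X t, Y t, Z t) * x' + pd3 1 g (X t, Y t, Z t) * y'
     + pd3 2 g (X t, Y t, Z t) * z').
Proof.
  intros H HX HY HZ.
  set (a0 := pd3 0 g (X t, Y t, Z t)). set (a1 := pd3 1 g (X t, Y t, Z t)).
  set (a2 := pd3 2 g (X t, Y t, Z t)).
  (* Split off the linear part, whose derivative is immediate; the remainder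
     is o(|dX| + |dY| + |dZ|) and each of dX, dY, dZ is O(h). *)
  assert (Hlin : is_derive (fun s => a0 * X s + a1 * Y s + a2 * Z s) t
                   (a0 * x' + a1 * y' + a2 * z')).
  { apply (is_derive_plus (fun s => a0 * X s + a1 * Y s) (fun s => a2 * Z s)).
    apply (is_derive_plus (fun s => a0 * X s) (fun s => a1 * Y s)).
    all: now apply is_derive_scal. }
  assert (Hrem : is_derive (fun s => g (X s, Y s, Z s) - (a0 * X s + a1 * Y s + a2 * Z s)) t 0).
  { apply is_derive_Reals. intros eps He.
    set (K := Rabs x' + Rabs y' + Rabs z' + 3).
    assert (HK : 0 < K) by (unfold K; generalize (Rabs_pos x') (Rabs_pos y') (Rabs_pos z'); lra).
    destruct (smooth3R_differentiable g (X t) (Y t) (Z t) H (eps / (2 * K))) as [d [Hd HD]].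
    { apply Rdiv_lt_0_compat; lra. }
    assert (Hl : forall (f : R -> R) u', is_derive f t u' ->
      exists e, 0 < e /\ forall h, h <> 0 -> Rabs h < e ->
        Rabs (f (t + h) - f t) <= (Rabs u' + 1) * Rabs h /\ Rabs (f (t + h) - f t) < d).
    { intros f u' HU. apply is_derive_Reals in HU. destruct (HU 1 Rlt_0_1) as [e1 He1].
      assert (Hp := Rabs_pos u').
      exists (Rmin e1 (d / (Rabs u' + 1))). split.
      - apply Rmin_glb_lt; [apply cond_pos | apply Rdiv_lt_0_compat; lra].
      - intros h Hh Hhe. assert (M1 := Rmin_l e1 (d / (Rabs u' + 1))).
        assert (M2 := Rmin_r e1 (d / (Rabs u' + 1))).
        specialize (He1 h Hh ltac:(lra)).
        assert (B : Rabs (f (t + h) - f t) <= (Rabs u' + 1) * Rabs h).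
        { replace (f (t + h) - f t) with (((f (t + h) - f t) / h - u' + u') * h) by (field; exact Hh).
          rewrite Rabs_mult. apply Rmult_le_compat_r; [apply Rabs_pos|].
          eapply Rle_trans; [apply Rabs_triang|]. lra. }
        split; [exact B|]. eapply Rle_lt_trans; [exact B|].
        apply Rlt_le_trans with ((Rabs u' + 1) * (d / (Rabs u' + 1))).
        + apply Rmult_lt_compat_l; lra.
        + right. field. lra. }
    destruct (Hl X x' HX) as [e1 [P1 Q1]]. destruct (Hl Y y' HY) as [e2 [P2 Q2]].
    destruct (Hl Z z' HZ) as [e3 [P3 Q3]].
    assert (Pm : 0 < Rmin e1 (Rmin e2 e3)) by (repeat apply Rmin_glb_lt; assumption).
    exists (mkposreal _ Pm). simpl. intros h Hh Hhe.
    assert (L0 := Rmin_l e1 (Rmin e2 e3)). assert (L1 := Rmin_r e1 (Rmin e2 e3)).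
    assert (L2 := Rmin_l e2 e3). assert (L3 := Rmin_r e2 e3).
    destruct (Q1 h Hh ltac:(lra)) as [A1 B1]. destruct (Q2 h Hh ltac:(lra)) as [A2 B2].
    destruct (Q3 h Hh ltac:(lra)) as [A3 B3].
    specialize (HD _ _ _ B1 B2 B3).
    replace (X t + (X (t + h) - X t)) with (X (t + h)) in HD by ring.
    replace (Y t + (Y (t + h) - Y t)) with (Y (t + h)) in HD by ring.
    replace (Z t + (Z (t + h) - Z t)) with (Z (t + h)) in HD by ring.
    fold a0 a1 a2 in HD. rewrite Rminus_0_r. unfold Rdiv at 1. rewrite Rabs_mult, Rabs_inv.
    assert (Hah : 0 < Rabs h) by now apply Rabs_pos_lt.
    apply Rmult_lt_reg_r with (Rabs h); [exact Hah|].
    rewrite Rmult_assoc, Rinv_l, Rmult_1_r by lra.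
    match type of HD with Rabs ?B <= _ =>
      match goal with |- Rabs ?A < _ => replace A with B by ring end end.
    eapply Rle_lt_trans; [exact HD|].
    apply Rle_lt_trans with (eps / (2 * K) * (K * Rabs h)).
    - apply Rmult_le_compat_l; [apply Rlt_le, Rdiv_lt_0_compat; lra|]. unfold K. lra.
    - replace (eps / (2 * K) * (K * Rabs h)) with (eps * Rabs h / 2) by (field; lra).
      assert (0 < eps * Rabs h) by (apply Rmult_lt_0_compat; lra). lra. }
  apply is_derive_ext with
    (fun s => (g (X s, Y s, Z s) - (a0 * X s + a1 * Y s + a2 * Z s))
              + (a0 * X s + a1 * Y s + a2 * Z s)).
  { intros s. simpl. ring. }
  replace (a0 * x' + a1 * y' + a2 * z') with (0 + (a0 * x' + a1 * y' + a2 * z')) by ring.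
  apply (is_derive_plus (K := R_AbsRing) (V := R_NormedModule)); assumption.
Qed.

(** A syntactic class containing the pull-backs of smooth functions and the exponentials they are
    integrated against. It is stable under both partial derivatives, and joint continuity and
    periodicity in phi follow by induction. 1 / sin theta is kept out because of the poles;
    [chart_fun_ext] stands in for functional extensionality. *)
Inductive chart_fun : (R -> R -> R) -> Prop :=
| chart_fun_sph g : smooth3R g -> chart_fun (fun th ph => g (sph th ph))
| chart_fun_const c : chart_fun (fun _ _ => c)
| chart_fun_costh : chart_fun (fun th _ => cos th)
| chart_fun_sinth : chart_fun (fun th _ => sin th)
| chart_fun_cosph (m : Z) : chart_fun (fun _ ph => cos (IZR m * ph))
| chart_fun_sinph (m : Z) : chart_fun (fun _ ph => sin (IZR m * ph))
| chart_fun_plus f g : chart_fun f -> chart_fun g -> chart_fun (fun th ph => f th ph + g th ph)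
| chart_fun_mult f g : chart_fun f -> chart_fun g -> chart_fun (fun th ph => f th ph * g th ph)
| chart_fun_ext f g : chart_fun f -> (forall th ph, g th ph = f th ph) -> chart_fun g.

Lemma chart_fun_continuity (f : R -> R -> R) : chart_fun f -> forall th ph, continuity_2d_pt f th ph.
Proof.
  induction 1; intros th ph.
  - intros eps. destruct (proj1 (H nil) (sph th ph) eps (cond_pos eps)) as [d [Hd HD]].
    simpl in HD.
    assert (Hc : forall (f : R -> R -> R), continuity_2d_pt f th ph ->
      locally_2d (fun u v => Rabs (f u v - f th ph) < d) th ph).
    { intros f Hf. apply (Hf (mkposreal d Hd)). }
    assert (H1 := Hc (fun u v => sin u * cos v)). assert (H2 := Hc (fun u v => sin u * sin v)).
    assert (H3 := Hc (fun u v => cos u)).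
    apply locally_2d_impl with (2 := H1 ltac:(apply continuity_2d_pt_mult;
      [apply (continuity_1d_2d_pt_comp sin (fun u _ => u));
        [apply continuity_sin | apply continuity_2d_pt_id1]
      |apply (continuity_1d_2d_pt_comp cos (fun _ v => v));
        [apply continuity_cos | apply continuity_2d_pt_id2]])).
    apply locally_2d_impl with (2 := H2 ltac:(apply continuity_2d_pt_mult;
      [apply (continuity_1d_2d_pt_comp sin (fun u _ => u));
        [apply continuity_sin | apply continuity_2d_pt_id1]
      |apply (continuity_1d_2d_pt_comp sin (fun _ v => v));
        [apply continuity_sin | apply continuity_2d_pt_id2]])).
    apply locally_2d_impl with (2 := H3 ltac:(
      apply (continuity_1d_2d_pt_comp cos (fun u _ => u));
        [apply continuity_cos | apply continuity_2d_pt_id1])).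
    apply locally_2d_forall. intros u v A B C. now apply HD.
  - apply continuity_2d_pt_const.
  - apply (continuity_1d_2d_pt_comp cos (fun u _ => u));
      [apply continuity_cos | apply continuity_2d_pt_id1].
  - apply (continuity_1d_2d_pt_comp sin (fun u _ => u));
      [apply continuity_sin | apply continuity_2d_pt_id1].
  - apply (continuity_1d_2d_pt_comp cos (fun _ v => IZR m * v)); [apply continuity_cos|].
    apply continuity_2d_pt_mult; [apply continuity_2d_pt_const | apply continuity_2d_pt_id2].
  - apply (continuity_1d_2d_pt_comp sin (fun _ v => IZR m * v)); [apply continuity_sin|].
    apply continuity_2d_pt_mult; [apply continuity_2d_pt_const | apply continuity_2d_pt_id2].
  - now apply continuity_2d_pt_plus.
  - now apply continuity_2d_pt_mult.
  - apply continuity_2d_pt_ext with f; auto.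
Qed.

Lemma chart_fun_periodic (f : R -> R -> R) : chart_fun f -> forall th, f th (2 * PI) = f th 0.
Proof.
  assert (P : forall m : Z, cos (IZR m * (2 * PI)) = 1 /\ sin (IZR m * (2 * PI)) = 0).
  { intros m.
    assert (N : forall n : nat, cos (INR n * (2 * PI)) = 1 /\ sin (INR n * (2 * PI)) = 0).
    { intros n. replace (INR n * (2 * PI)) with (0 + 2 * INR n * PI) by ring.
      rewrite cos_period, sin_period, cos_0, sin_0. tauto. }
    destruct (Z_le_gt_dec 0 m) as [Hm|Hm].
    - rewrite <- (Z2Nat.id m Hm), <- INR_IZR_INZ. apply N.
    - replace (IZR m * (2 * PI)) with (- (INR (Z.to_nat (- m)) * (2 * PI))).
      + rewrite cos_neg, sin_neg. destruct (N (Z.to_nat (- m))) as [-> ->]. lra.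
      + rewrite INR_IZR_INZ, Z2Nat.id, opp_IZR by lia. ring. }
  induction 1; intros th; auto.
  - unfold sph. rewrite cos_2PI, sin_2PI, cos_0, sin_0. reflexivity.
  - destruct (P m) as [-> _]. now rewrite Rmult_0_r, cos_0.
  - destruct (P m) as [_ ->]. now rewrite Rmult_0_r, sin_0.
  - now rewrite IHchart_fun1, IHchart_fun2.
  - now rewrite IHchart_fun1, IHchart_fun2.
  - now rewrite !H0.
Qed.

Lemma chart_fun_cos1 : chart_fun (fun _ ph => cos ph).
Proof. apply (chart_fun_ext _ _ (chart_fun_cosph 1)). intros. now rewrite Rmult_1_l. Qed.
Lemma chart_fun_sin1 : chart_fun (fun _ ph => sin ph).
Proof. apply (chart_fun_ext _ _ (chart_fun_sinph 1)). intros. now rewrite Rmult_1_l. Qed.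

Ltac chart_fun_tac := repeat first
  [ assumption
  | apply chart_fun_const | apply chart_fun_costh | apply chart_fun_sinth | apply chart_fun_cos1 | apply chart_fun_sin1
  | apply chart_fun_cosph | apply chart_fun_sinph | apply chart_fun_mult | apply chart_fun_plus
  | (apply chart_fun_sph; repeat apply smooth3R_pd3; assumption) ].

Lemma chart_fun_opp f : chart_fun f -> chart_fun (fun th ph => - f th ph).
Proof.
  intros H. apply chart_fun_ext with (fun th ph => -1 * f th ph); [chart_fun_tac|intros; ring].
Qed.

Lemma chart_fun_minus f g : chart_fun f -> chart_fun g -> chart_fun (fun th ph => f th ph - g th ph).
Proof.
  intros H K. apply chart_fun_ext with (fun th ph => f th ph + -1 * g th ph); [chart_fun_tac|intros; ring].
Qed.

Lemma chart_fun_dth (f : R -> R -> R) : chart_fun f ->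
  exists f', chart_fun f' /\ forall th ph, is_derive (fun t => f t ph) th (f' th ph).
Proof.
  induction 1.
  - exists (fun th ph => pd3 0 g (sph th ph) * (cos th * cos ph)
      + pd3 1 g (sph th ph) * (cos th * sin ph) + pd3 2 g (sph th ph) * (-1 * sin th)).
    split; [chart_fun_tac|]. intros th ph. unfold sph.
    apply (smooth3R_chain g (fun t => sin t * cos ph) (fun t => sin t * sin ph) cos);
      [assumption|auto_derive; trivial; ring|auto_derive; trivial; ring|auto_derive; trivial; ring].
  - exists (fun _ _ => 0). split; [chart_fun_tac|]. intros. auto_derive; trivial.
  - exists (fun th ph => -1 * sin th). split; [chart_fun_tac|]. intros. auto_derive; trivial; ring.
  - exists (fun th ph => cos th). split; [chart_fun_tac|]. intros. auto_derive; trivial; ring.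
  - exists (fun th ph => 0). split; [chart_fun_tac|]. intros. auto_derive; trivial; ring.
  - exists (fun th ph => 0). split; [chart_fun_tac|]. intros. auto_derive; trivial; ring.
  - destruct IHchart_fun1 as [f' [A B]]. destruct IHchart_fun2 as [g' [C D]].
    exists (fun th ph => f' th ph + g' th ph). split; [chart_fun_tac|]. intros th ph.
    apply (is_derive_plus (fun t => f t ph) (fun t => g t ph)); auto.
  - destruct IHchart_fun1 as [f' [A B]]. destruct IHchart_fun2 as [g' [C D]].
    exists (fun th ph => f' th ph * g th ph + f th ph * g' th ph). split; [chart_fun_tac|]. intros th ph.
    apply (is_derive_mult (fun t => f t ph) (fun t => g t ph)); auto. exact Rmult_comm.
  - destruct IHchart_fun as [f' [A B]]. exists f'. split; [assumption|]. intros th ph.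
    apply is_derive_ext with (fun t => f t ph); auto.
Qed.

Lemma chart_fun_dph (f : R -> R -> R) : chart_fun f ->
  exists f', chart_fun f' /\ forall th ph, is_derive (fun t => f th t) ph (f' th ph).
Proof.
  induction 1.
  - exists (fun th ph => pd3 0 g (sph th ph) * (-1 * sin th * sin ph)
      + pd3 1 g (sph th ph) * (sin th * cos ph) + pd3 2 g (sph th ph) * 0).
    split; [chart_fun_tac|]. intros th ph. unfold sph.
    apply (smooth3R_chain g (fun t => sin th * cos t) (fun t => sin th * sin t) (fun t => cos th));
      [assumption|auto_derive; trivial; ring|auto_derive; trivial; ring|auto_derive; trivial; ring].
  - exists (fun _ _ => 0). split; [chart_fun_tac|]. intros. auto_derive; trivial.
  - exists (fun _ _ => 0). split; [chart_fun_tac|]. intros. auto_derive; trivial.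
  - exists (fun _ _ => 0). split; [chart_fun_tac|]. intros. auto_derive; trivial.
  - exists (fun th ph => IZR (- m) * sin (IZR m * ph)). split; [chart_fun_tac|].
    intros. rewrite opp_IZR. auto_derive; trivial; ring.
  - exists (fun th ph => IZR m * cos (IZR m * ph)). split; [chart_fun_tac|]. intros. auto_derive; trivial; ring.
  - destruct IHchart_fun1 as [f' [A B]]. destruct IHchart_fun2 as [g' [C D]].
    exists (fun th ph => f' th ph + g' th ph). split; [chart_fun_tac|]. intros th ph.
    apply (is_derive_plus (fun t => f th t) (fun t => g th t)); auto.
  - destruct IHchart_fun1 as [f' [A B]]. destruct IHchart_fun2 as [g' [C D]].
    exists (fun th ph => f' th ph * g th ph + f th ph * g' th ph). split; [chart_fun_tac|]. intros th ph.
    apply (is_derive_mult (fun t => f th t) (fun t => g th t)); auto. exact Rmult_comm.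
  - destruct IHchart_fun as [f' [A B]]. exists f'. split; [assumption|]. intros th ph.
    apply is_derive_ext with (fun t => f th t); auto.
Qed.

Lemma chart_fun_continuous_ph (f : R -> R -> R) : chart_fun f -> forall th ph, continuous (f th) ph.
Proof.
  intros H th ph. destruct (chart_fun_dph f H) as [f' [_ D]].
  apply (ex_derive_continuous (f th)). eexists. apply D.
Qed.

Lemma chart_fun_ex_RInt (f : R -> R -> R) : chart_fun f -> forall th a b, ex_RInt (f th) a b.
Proof. intros H th a b. apply (ex_RInt_continuous (V := R_CompleteNormedModule)). intros. now apply chart_fun_continuous_ph. Qed.

(** Differentiation under the integral sign asks for joint continuity of the derivative, which
    membership of [f'] in the class supplies. *)
Lemma chart_fun_RInt_dth (f f' : R -> R -> R) : chart_fun f -> chart_fun f' ->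
  (forall th ph, is_derive (fun t => f t ph) th (f' th ph)) ->
  forall a b th, is_derive (fun t => RInt (f t) a b) th (RInt (f' th) a b).
Proof.
  intros H H' D a b th.
  rewrite (RInt_ext (f' th) (fun t => Derive (fun u => f u t) th)).
  2: { intros x _. symmetry. apply is_derive_unique, D. }
  apply (is_derive_RInt_param f a b th).
  - apply filter_forall. intros x t _. eexists. apply D.
  - intros t _. apply continuity_2d_pt_ext with f'.
    + intros x y. symmetry. apply is_derive_unique, D.
    + now apply chart_fun_continuity.
  - apply filter_forall. intros y. now apply chart_fun_ex_RInt.
Qed.

(** * Complex-valued derivatives and integrals *)

Ltac C_components := apply injective_projections; simpl.

(** Componentwise like [dth] and [dph], but a relation: [Derive] is total, so its value alone does
    not certify differentiability. *)
Definition is_Cderive (f : R -> C) (t : R) (d : C) : Prop :=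
  is_derive (fun s => fst (f s)) t (fst d) /\ is_derive (fun s => snd (f s)) t (snd d).

Lemma is_Cderive_eq (f : R -> C) t d d' : is_Cderive f t d -> d = d' -> is_Cderive f t d'.
Proof. now intros H <-. Qed.

Lemma is_Cderive_mult (f g : R -> C) t f' g' : is_Cderive f t f' -> is_Cderive g t g' ->
  is_Cderive (fun s => Cmult (f s) (g s)) t (Cplus (Cmult f' (g t)) (Cmult (f t) g')).
Proof.
  intros [A B] [C D]. split; simpl.
  - replace (fst f' * fst (g t) - snd f' * snd (g t) + (fst (f t) * fst g' - snd (f t) * snd g'))
      with ((fst f' * fst (g t) + fst (f t) * fst g') - (snd f' * snd (g t) + snd (f t) * snd g')) by ring.
    apply (is_derive_minus (fun s => fst (f s) * fst (g s)) (fun s => snd (f s) * snd (g s))).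
    + apply (is_derive_mult (fun s => fst (f s)) (fun s => fst (g s))); auto. exact Rmult_comm.
    + apply (is_derive_mult (fun s => snd (f s)) (fun s => snd (g s))); auto. exact Rmult_comm.
  - replace (fst f' * snd (g t) + snd f' * fst (g t) + (fst (f t) * snd g' + snd (f t) * fst g'))
      with ((fst f' * snd (g t) + fst (f t) * snd g') + (snd f' * fst (g t) + snd (f t) * fst g')) by ring.
    apply (is_derive_plus (fun s => fst (f s) * snd (g s)) (fun s => snd (f s) * fst (g s))).
    + apply (is_derive_mult (fun s => fst (f s)) (fun s => snd (g s))); auto. exact Rmult_comm.
    + apply (is_derive_mult (fun s => snd (f s)) (fun s => fst (g s))); auto. exact Rmult_comm.
Qed.

Lemma is_Cderive_plus (f g : R -> C) t f' g' : is_Cderive f t f' -> is_Cderive g t g' ->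
  is_Cderive (fun s => Cplus (f s) (g s)) t (Cplus f' g').
Proof.
  intros [A B] [C D]. split; simpl.
  - now apply (is_derive_plus (fun s => fst (f s)) (fun s => fst (g s))).
  - now apply (is_derive_plus (fun s => snd (f s)) (fun s => snd (g s))).
Qed.

Lemma is_Cderive_const c t : is_Cderive (fun _ => c) t (RtoC 0).
Proof. split; simpl; auto_derive; trivial. Qed.

Lemma is_Cderive_RtoC (f : R -> R) t d : is_derive f t d -> is_Cderive (fun s => RtoC (f s)) t (RtoC d).
Proof. intros H. split; simpl; [exact H|]. auto_derive; trivial. Qed.

Lemma is_Cderive_scal c (f : R -> C) t d : is_Cderive f t d -> is_Cderive (fun s => Cmult c (f s)) t (Cmult c d).
Proof.
  intros H. eapply is_Cderive_eq; [apply is_Cderive_mult; [apply is_Cderive_const | exact H]|]. C_components; ring.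
Qed.

Lemma is_Cderive_ext_loc (f g : R -> C) t d :
  locally t (fun s => f s = g s) -> is_Cderive f t d -> is_Cderive g t d.
Proof.
  intros E [A B]. split; eapply is_derive_ext_loc; try eassumption; simpl;
  (eapply filter_imp; [|exact E]); simpl; intros s ->; reflexivity.
Qed.

Lemma is_Cderive_ext (f g : R -> C) t d : (forall s, f s = g s) -> is_Cderive f t d -> is_Cderive g t d.
Proof. intros E. apply is_Cderive_ext_loc. now apply filter_forall. Qed.

Lemma is_Cderive_dth (f : R -> R -> C) th ph d : is_Cderive (fun t => f t ph) th d -> dth f th ph = d.
Proof. intros [A B]. C_components; now apply is_derive_unique. Qed.

Lemma is_Cderive_dph (f : R -> R -> C) th ph d : is_Cderive (f th) ph d -> dph f th ph = d.
Proof. intros [A B]. C_components; now apply is_derive_unique. Qed.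

Definition is_CInt (f : R -> C) (a b : R) (v : C) : Prop :=
  is_RInt (fun t => fst (f t)) a b (fst v) /\ is_RInt (fun t => snd (f t)) a b (snd v).

Lemma is_CInt_unique f a b v : is_CInt f a b v -> CInt f a b = v.
Proof. intros [A B]. C_components; now apply is_RInt_unique. Qed.

Lemma is_CInt_eq f a b v v' : is_CInt f a b v -> v = v' -> is_CInt f a b v'.
Proof. now intros H <-. Qed.

Lemma is_CInt_ext f g a b v : a <= b -> (forall x, a < x < b -> f x = g x) ->
  is_CInt f a b v -> is_CInt g a b v.
Proof.
  intros L E [A B]. split; eapply is_RInt_ext; try eassumption;
  rewrite Rmin_left, Rmax_right by assumption; simpl; intros x Hx; now rewrite E.
Qed.

Lemma CInt_ext f g a b : a <= b -> (forall x, a < x < b -> f x = g x) -> CInt f a b = CInt g a b.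
Proof.
  intros L E. C_components; apply RInt_ext; rewrite Rmin_left, Rmax_right by assumption;
  intros x Hx; now rewrite E.
Qed.

Lemma is_CInt_plus f g a b v w : is_CInt f a b v -> is_CInt g a b w ->
  is_CInt (fun t => Cplus (f t) (g t)) a b (Cplus v w).
Proof.
  intros [A B] [C D]. split; simpl.
  - now apply (is_RInt_plus (fun t => fst (f t)) (fun t => fst (g t))).
  - now apply (is_RInt_plus (fun t => snd (f t)) (fun t => snd (g t))).
Qed.

Lemma is_CInt_scal c f a b v : is_CInt f a b v -> is_CInt (fun t => Cmult c (f t)) a b (Cmult c v).
Proof.
  intros [A B]. split; simpl.
  - apply (is_RInt_minus (fun t => fst c * fst (f t)) (fun t => snd c * snd (f t)));
    [apply (is_RInt_scal _ _ _ (fst c) _ A)|apply (is_RInt_scal _ _ _ (snd c) _ B)].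
  - apply (is_RInt_plus (fun t => fst c * snd (f t)) (fun t => snd c * fst (f t)));
    [apply (is_RInt_scal _ _ _ (fst c) _ B)|apply (is_RInt_scal _ _ _ (snd c) _ A)].
Qed.

Lemma is_CInt_const c a b : is_CInt (fun _ => c) a b (Cmult (RtoC (b - a)) c).
Proof.
  split; simpl.
  - replace ((b - a) * fst c - 0 * snd c) with (scal (b - a) (fst c))
      by (unfold scal; simpl; unfold mult; simpl; ring). apply (is_RInt_const (V := R_NormedModule)).
  - replace ((b - a) * snd c + 0 * fst c) with (scal (b - a) (snd c))
      by (unfold scal; simpl; unfold mult; simpl; ring). apply (is_RInt_const (V := R_NormedModule)).
Qed.

Definition continuousC (f : R -> C) (x : R) : Prop :=
  continuous (fun t => fst (f t)) x /\ continuous (fun t => snd (f t)) x.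

Lemma is_Cderive_continuousC f x d : is_Cderive f x d -> continuousC f x.
Proof.
  intros [A B]. split.
  - apply (ex_derive_continuous (fun t => fst (f t))). eexists; exact A.
  - apply (ex_derive_continuous (fun t => snd (f t))). eexists; exact B.
Qed.

Lemma continuousC_mult f g x : continuousC f x -> continuousC g x -> continuousC (fun t => Cmult (f t) (g t)) x.
Proof.
  intros [A B] [C D]. split; simpl.
  - apply (continuous_minus (fun t => fst (f t) * fst (g t)) (fun t => snd (f t) * snd (g t)));
    apply (continuous_mult (K := R_AbsRing)); assumption.
  - apply (continuous_plus (fun t => fst (f t) * snd (g t)) (fun t => snd (f t) * fst (g t)));
    apply (continuous_mult (K := R_AbsRing)); assumption.
Qed.

Lemma continuousC_plus f g x : continuousC f x -> continuousC g x -> continuousC (fun t => Cplus (f t) (g t)) x.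
Proof.
  intros [A B] [C D]. split; simpl.
  - now apply (continuous_plus (fun t => fst (f t)) (fun t => fst (g t))).
  - now apply (continuous_plus (fun t => snd (f t)) (fun t => snd (g t))).
Qed.

Lemma continuousC_RtoC (f : R -> R) x : continuous f x -> continuousC (fun t => RtoC (f t)) x.
Proof. intros H. split; simpl; [exact H | apply continuous_const]. Qed.

Lemma continuousC_const c x : continuousC (fun _ => c) x.
Proof. split; apply continuous_const. Qed.

Lemma is_CInt_continuousC f a b : (forall x, continuousC f x) -> is_CInt f a b (CInt f a b).
Proof.
  intros H. split; simpl; apply (RInt_correct (V := R_CompleteNormedModule));
  apply (ex_RInt_continuous (V := R_CompleteNormedModule)); intros x _; apply H.
Qed.

Lemma is_CInt_derive F f a b : (forall x, is_Cderive F x (f x)) -> (forall x, continuousC f x) ->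
  is_CInt f a b (Cminus (F b) (F a)).
Proof.
  intros D H. split; simpl.
  - apply (is_RInt_derive (fun t => fst (F t)) (fun t => fst (f t))); intros x _; [apply D|apply H].
  - apply (is_RInt_derive (fun t => snd (F t)) (fun t => snd (f t))); intros x _; [apply D|apply H].
Qed.

Definition chart_funC (f : R -> R -> C) : Prop :=
  chart_fun (fun th ph => fst (f th ph)) /\ chart_fun (fun th ph => snd (f th ph)).

Lemma chart_funC_mult f g : chart_funC f -> chart_funC g -> chart_funC (fun th ph => Cmult (f th ph) (g th ph)).
Proof.
  intros [A B] [C D]. split; simpl.
  - apply (chart_fun_minus (fun th ph => fst (f th ph) * fst (g th ph))
                    (fun th ph => snd (f th ph) * snd (g th ph))); chart_fun_tac.
  - chart_fun_tac.
Qed.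

Lemma chart_funC_plus f g : chart_funC f -> chart_funC g -> chart_funC (fun th ph => Cplus (f th ph) (g th ph)).
Proof. intros [A B] [C D]. split; simpl; chart_fun_tac. Qed.

Lemma chart_funC_RtoC f : chart_fun f -> chart_funC (fun th ph => RtoC (f th ph)).
Proof. intros H. split; simpl; chart_fun_tac. Qed.

Lemma chart_funC_conj f : chart_funC f -> chart_funC (fun th ph => Cconj (f th ph)).
Proof. intros [A B]. split; simpl; [chart_fun_tac|now apply chart_fun_opp]. Qed.

Lemma chart_funC_dth f : chart_funC f -> exists f', chart_funC f' /\ forall th ph, is_Cderive (fun t => f t ph) th (f' th ph).
Proof.
  intros [A B]. destruct (chart_fun_dth _ A) as [a [A1 A2]]. destruct (chart_fun_dth _ B) as [b [B1 B2]].
  exists (fun th ph => (a th ph, b th ph)). split; [now split|].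
  intros th ph. split; simpl; auto.
Qed.

Lemma chart_funC_dph f : chart_funC f -> exists f', chart_funC f' /\ forall th ph, is_Cderive (f th) ph (f' th ph).
Proof.
  intros [A B]. destruct (chart_fun_dph _ A) as [a [A1 A2]]. destruct (chart_fun_dph _ B) as [b [B1 B2]].
  exists (fun th ph => (a th ph, b th ph)). split; [now split|].
  intros th ph. split; simpl; auto.
Qed.

Lemma chart_funC_is_CInt f : chart_funC f -> forall th a b, is_CInt (f th) a b (CInt (f th) a b).
Proof.
  intros [A B] th a b. apply is_CInt_continuousC. intros x. split.
  - now apply (chart_fun_continuous_ph (fun th ph => fst (f th ph))).
  - now apply (chart_fun_continuous_ph (fun th ph => snd (f th ph))).
Qed.

Lemma chart_funC_CInt_dth f f' : chart_funC f -> chart_funC f' ->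
  (forall th ph, is_Cderive (fun t => f t ph) th (f' th ph)) ->
  forall a b th, is_Cderive (fun t => CInt (f t) a b) th (CInt (f' th) a b).
Proof.
  intros [A B] [A' B'] D a b th. split; simpl.
  - apply (chart_fun_RInt_dth (fun th ph => fst (f th ph)) (fun th ph => fst (f' th ph))); trivial.
    intros. apply D.
  - apply (chart_fun_RInt_dth (fun th ph => snd (f th ph)) (fun th ph => snd (f' th ph))); trivial.
    intros. apply D.
Qed.

Lemma chart_funC_periodic f : chart_funC f -> forall th, f th (2 * PI) = f th 0.
Proof.
  intros [A B] th. C_components.
  - exact (chart_fun_periodic _ A th).
  - exact (chart_fun_periodic _ B th).
Qed.

(** * Fields on the chart and uniqueness of B *)

Lemma PI2_ge0 : 0 <= 2 * PI.
Proof. generalize PI_RGT_0; lra. Qed.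

Lemma PI_ge0 : 0 <= PI.
Proof. generalize PI_RGT_0; lra. Qed.

Definition chart (th ph : R) : Prop := 0 < th < PI /\ 0 < ph < 2 * PI.

(* Brackets are local and pairings only see the open chart, so fields are compared there
   only: where sin th < 0 the field e_lm l m with m odd is not the one induced by a
   function on the sphere. *)
Definition chart_eq (X Y : vf) : Prop := forall th ph, chart th ph -> X th ph = Y th ph.

Lemma chart_eq_refl X : chart_eq X X.
Proof. now intros th ph _. Qed.

Lemma chart_eq_trans X Y Z : chart_eq X Y -> chart_eq Y Z -> chart_eq X Z.
Proof. intros A B th ph H. now rewrite A, B. Qed.

Lemma vconj_chart_eq X X' : chart_eq X X' -> chart_eq (vconj X) (vconj X').
Proof. intros A th ph H. unfold vconj. now rewrite A. Qed.

Lemma locally_Ioo a b x : a < x < b -> locally x (fun t => a < t < b).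
Proof. intros [H1 H2]. apply filter_and; [now apply (open_gt a) | now apply (open_lt b)]. Qed.

Lemma dth_ext (f g : R -> R -> C) : (forall th ph, chart th ph -> f th ph = g th ph) ->
  forall th ph, chart th ph -> dth f th ph = dth g th ph.
Proof.
  intros E th ph [H1 H2]. C_components; apply Derive_ext_loc; simpl;
  (eapply filter_imp; [|exact (locally_Ioo _ _ _ H1)]); intros t Ht; simpl;
  now rewrite (E t ph (conj Ht H2)).
Qed.

Lemma dph_ext (f g : R -> R -> C) : (forall th ph, chart th ph -> f th ph = g th ph) ->
  forall th ph, chart th ph -> dph f th ph = dph g th ph.
Proof.
  intros E th ph [H1 H2]. C_components; apply Derive_ext_loc; simpl;
  (eapply filter_imp; [|exact (locally_Ioo _ _ _ H2)]); intros t Ht; simpl;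
  now rewrite (E th t (conj H1 Ht)).
Qed.

Lemma sgrad_ext (f g : R -> R -> C) : (forall th ph, chart th ph -> f th ph = g th ph) ->
  chart_eq (sgrad f) (sgrad g).
Proof. intros E th ph H. unfold sgrad. now rewrite (dph_ext f g E), (dth_ext f g E). Qed.

Lemma bracket_chart_eq X X' Y Y' : chart_eq X X' -> chart_eq Y Y' -> chart_eq (bracket X Y) (bracket X' Y').
Proof.
  intros A B th ph H. unfold bracket.
  rewrite (dth_ext (compth X) (compth X')), (dph_ext (compth X) (compth X')),
    (dth_ext (compph X) (compph X')), (dph_ext (compph X) (compph X')),
    (dth_ext (compth Y) (compth Y')), (dph_ext (compth Y) (compth Y')),
    (dth_ext (compph Y) (compph Y')), (dph_ext (compph Y) (compph Y')); trivial;
  try (intros t p K; unfold compth, compph; now rewrite ?A, ?B).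
  now rewrite A, B.
Qed.

Definition pair_density (X Y : vf) (th ph : R) : C :=
  Cmult (Cplus (Cmult (fst (X th ph)) (fst (Y th ph)))
               (Cmult (RtoC (sin th ^ 2)) (Cmult (snd (X th ph)) (snd (Y th ph)))))
        (RtoC (sin th)).

Lemma pairb_chart_eq X X' Y Y' : chart_eq X X' -> chart_eq Y Y' -> pairb X Y = pairb X' Y'.
Proof.
  intros A B. unfold pairb. apply CInt_ext; [exact PI_ge0|]. intros th Ht.
  apply CInt_ext; [exact PI2_ge0|]. intros ph Hp.
  now rewrite (A th ph (conj Ht Hp)), (B th ph (conj Ht Hp)).
Qed.

(** The inner integral is only asked for when 0 < theta < pi, so [K] may be computed with divisions
    by sin theta. *)
Lemma pairb_val X Y (K : R -> C) v :
  (forall th, 0 < th < PI -> is_CInt (pair_density X Y th) 0 (2 * PI) (K th)) ->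
  is_CInt K 0 PI v -> pairb X Y = v.
Proof.
  intros H HK. unfold pairb.
  rewrite (CInt_ext _ K); [now apply is_CInt_unique|exact PI_ge0|].
  intros th Ht. apply is_CInt_unique. exact (H th Ht).
Qed.

Lemma chart_funC_CInt_continuousC f a b th : chart_funC f -> continuousC (fun t => CInt (f t) a b) th.
Proof.
  intros H. destruct (chart_funC_dth f H) as [f' [H' D]].
  eapply is_Cderive_continuousC. now apply chart_funC_CInt_dth with (f' := f').
Qed.

(** [J] extends the density regularly across the poles, where the components of the fields carry 1 /
    sin theta; its regularity provides integrability. *)
Lemma pairb_chart_funC X Y J : chart_funC J -> (forall th ph, chart th ph -> pair_density X Y th ph = J th ph) ->
  is_CInt (fun th => CInt (J th) 0 (2 * PI)) 0 PI (pairb X Y).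
Proof.
  intros HJ E.
  rewrite (pairb_val X Y (fun th => CInt (J th) 0 (2 * PI))
             (CInt (fun th => CInt (J th) 0 (2 * PI)) 0 PI)).
  - apply is_CInt_continuousC. intros x. now apply chart_funC_CInt_continuousC.
  - intros th Ht. apply is_CInt_ext with (J th).
    + exact PI2_ge0.
    + intros ph Hp. symmetry. apply E. now split.
    + now apply chart_funC_is_CInt.
  - apply is_CInt_continuousC. intros x. now apply chart_funC_CInt_continuousC.
Qed.

(* On the chart a Hamiltonian field sgrad h has bounded components in the
   orthonormal frame, (p, - dh/dtheta), because dh/dphi = sin theta * p. *)
Lemma sdiff_alg_spec W : sdiff_alg W -> exists h p hth hph,
  chart_funC h /\ chart_funC p /\ chart_funC hth /\ chart_funC hph /\
  (forall th ph, is_Cderive (fun t => h t ph) th (hth th ph)) /\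
  (forall th ph, is_Cderive (h th) ph (hph th ph)) /\
  (forall th ph, hph th ph = Cmult (RtoC (sin th)) (p th ph)) /\
  (forall th ph, W th ph = (Cmult (RtoC (/ sin th)) (hph th ph),
                            Cmult (RtoC (- / sin th)) (hth th ph))).
Proof.
  intros [F [[F1 F2] E]].
  assert (HP : forall g, smooth3R g -> exists p, chart_fun p /\
    forall th ph, is_derive (fun t => g (sph th t)) ph (sin th * p th ph)).
  { intros g Hg. exists (fun th ph => pd3 0 g (sph th ph) * (-1 * sin ph)
                                + pd3 1 g (sph th ph) * cos ph).
    split; [chart_fun_tac|]. intros th ph.
    replace (sin th * _) with (pd3 0 g (sph th ph) * (-1 * sin th * sin ph)
      + pd3 1 g (sph th ph) * (sin th * cos ph) + pd3 2 g (sph th ph) * 0) by ring.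
    apply (smooth3R_chain g (fun t => sin th * cos t) (fun t => sin th * sin t) (fun t => cos th));
      [assumption|auto_derive; trivial; ring|auto_derive; trivial; ring|auto_derive; trivial; ring]. }
  destruct (HP _ F1) as [p1 [P1 Q1]]. destruct (HP _ F2) as [p2 [P2 Q2]].
  assert (HF : chart_funC (fun th ph => F (sph th ph))).
  { split; [apply (chart_fun_sph _ F1)|apply (chart_fun_sph _ F2)]. }
  destruct (chart_funC_dth _ HF) as [hth [A B]].
  exists (fun th ph => F (sph th ph)), (fun th ph => (p1 th ph, p2 th ph)), hth,
    (fun th ph => Cmult (RtoC (sin th)) (p1 th ph, p2 th ph)).
  assert (HD : forall th ph, is_Cderive (fun t => F (sph th t)) ph
    (Cmult (RtoC (sin th)) (p1 th ph, p2 th ph))).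
  { intros th ph. split; simpl.
    - replace (sin th * p1 th ph - 0 * p2 th ph) with (sin th * p1 th ph) by ring. apply Q1.
    - replace (sin th * p2 th ph + 0 * p1 th ph) with (sin th * p2 th ph) by ring. apply Q2. }
  split; [exact HF|]. split; [split; assumption|]. split; [exact A|]. split.
  { apply chart_funC_mult; [apply (chart_funC_RtoC (fun th _ => sin th)); chart_fun_tac|split; assumption]. }
  split; [exact B|]. split; [exact HD|]. split; [reflexivity|].
  intros th ph. rewrite E. unfold sgrad.
  rewrite (is_Cderive_dph _ _ _ _ (HD th ph)), (is_Cderive_dth _ _ _ _ (B th ph)). reflexivity.
Qed.

Lemma smooth3R_lin (a b : R) (f g : pt3 -> R) : smooth3R f -> smooth3R g ->
  smooth3R (fun p => a * f p + b * g p).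
Proof.
  intros F G.
  assert (E : forall ds p, D3 ds (fun p => a * f p + b * g p) p = a * D3 ds f p + b * D3 ds g p).
  { induction ds as [|i ds IH]; intros p; simpl; [reflexivity|]. unfold pd3 at 1.
    rewrite (Derive_ext _ _ _ (fun t => IH _)).
    rewrite Derive_plus, !Derive_scal; [reflexivity| |].
    - apply ex_derive_scal. apply (F ds).
    - apply ex_derive_scal. apply (G ds). }
  intros ds. split.
  - intros p eps He.
    set (K := Rabs a + Rabs b + 1).
    assert (HK : 0 < K) by (unfold K; generalize (Rabs_pos a) (Rabs_pos b); lra).
    assert (He' : 0 < eps / K) by now apply Rdiv_lt_0_compat.
    destruct (proj1 (F ds) p _ He') as [d1 [P1 Q1]]. destruct (proj1 (G ds) p _ He') as [d2 [P2 Q2]].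
    exists (Rmin d1 d2). split; [now apply Rmin_glb_lt|]. intros q A B C. rewrite !E.
    assert (M1 := Rmin_l d1 d2). assert (M2 := Rmin_r d1 d2).
    specialize (Q1 q (Rlt_le_trans _ _ _ A M1) (Rlt_le_trans _ _ _ B M1) (Rlt_le_trans _ _ _ C M1)).
    specialize (Q2 q (Rlt_le_trans _ _ _ A M2) (Rlt_le_trans _ _ _ B M2) (Rlt_le_trans _ _ _ C M2)).
    replace (_ - _) with (a * (D3 ds f q - D3 ds f p) + b * (D3 ds g q - D3 ds g p)) by ring.
    eapply Rle_lt_trans; [apply Rabs_triang|]. rewrite !Rabs_mult.
    apply Rle_lt_trans with ((Rabs a + Rabs b) * (eps / K)).
    + rewrite Rmult_plus_distr_r. apply Rplus_le_compat; apply Rmult_le_compat_l;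
      solve [apply Rabs_pos|lra].
    + apply Rlt_le_trans with (K * (eps / K)); [apply Rmult_lt_compat_r; [assumption|unfold K; lra]|].
      right. field. lra.
  - intros i p. apply ex_derive_ext with (fun t => a * D3 ds f (shift3 p i t) + b * D3 ds g (shift3 p i t)).
    + intros t. symmetry. apply E.
    + apply (ex_derive_plus (fun t => a * D3 ds f (shift3 p i t)) (fun t => b * D3 ds g (shift3 p i t)));
      apply ex_derive_scal; [apply (F ds)|apply (G ds)].
Qed.

Lemma smooth3R_ext f g : smooth3R f -> (forall p, g p = f p) -> smooth3R g.
Proof.
  intros F H.
  assert (E : forall ds p, D3 ds g p = D3 ds f p).
  { induction ds as [|i ds IH]; intros p; simpl; [apply H|]. unfold pd3.
    apply Derive_ext. intros t. apply IH. }
  intros ds. split.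
  - intros p eps He. destruct (proj1 (F ds) p eps He) as [d [P Q]]. exists d. split; [assumption|].
    intros. rewrite !E. auto.
  - intros i p. apply ex_derive_ext with (fun t => D3 ds f (shift3 p i t)).
    + intros. now rewrite E.
    + apply (F ds).
Qed.

Lemma smooth_ex_derive F : smooth3R F -> forall th ph,
  ex_derive (fun t => F (sph t ph)) th /\ ex_derive (fun t => F (sph th t)) ph.
Proof.
  intros H th ph. assert (K := chart_fun_sph F H).
  destruct (chart_fun_dth _ K) as [a [_ A]]. destruct (chart_fun_dph _ K) as [b [_ B]].
  split; eexists; [apply A|apply B].
Qed.

Lemma sdiff_alg_conj_sub Z Z0 : sdiff_alg Z -> sdiff_alg Z0 -> sdiff_alg (vconj (vsub Z Z0)).
Proof.
  intros [F [[F1 F2] E]] [G [[G1 G2] E']].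
  exists (fun p => Cconj (Cminus (F p) (G p))). split.
  - split; simpl.
    + apply smooth3R_ext with (fun p => 1 * fst (F p) + -1 * fst (G p)); [|intros; ring].
      now apply smooth3R_lin.
    + apply smooth3R_ext with (fun p => -1 * snd (F p) + 1 * snd (G p)); [|intros; ring].
      now apply smooth3R_lin.
  - intros th ph. unfold vconj, vsub, vadd, vopp, vscal. rewrite E, E'. unfold sgrad, dth, dph.
    destruct (smooth_ex_derive _ F1 th ph). destruct (smooth_ex_derive _ F2 th ph).
    destruct (smooth_ex_derive _ G1 th ph). destruct (smooth_ex_derive _ G2 th ph).
    simpl. unfold Cconj, Cmult, Cplus; simpl.
    rewrite !Derive_opp, !(Derive_plus (fun t => _ ) (fun t => - _)), !Derive_opp;
      try assumption; try (now apply @ex_derive_opp).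
    apply injective_projections; apply injective_projections; simpl; ring.
Qed.

(** A positive value at x would persist on a small interval [u, v] inside (a, b) and make its
    integral positive, while the two remaining pieces contribute nonnegative amounts. *)
Lemma RInt_zero_nonneg (g : R -> R) a b : (forall x, continuous g x) ->
  (forall x, a < x < b -> 0 <= g x) -> RInt g a b = 0 -> forall x, a < x < b -> g x = 0.
Proof.
  intros Hc Hp H0 x Hx. destruct (Hp x Hx) as [Hlt|Heq]; [|now symmetry].
  exfalso.
  assert (L : locally x (fun t => 0 < g t)).
  { apply (Hc x (fun y => 0 < y)). now apply (open_gt 0). }
  assert (L' := filter_and _ _ L (locally_Ioo _ _ _ Hx)).
  destruct L' as [d Hd].
  assert (Hball : forall t, Rabs (t - x) < d -> 0 < g t /\ a < t < b).
  { intros t Ht. apply Hd. exact Ht. }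
  assert (Dp := cond_pos d).
  set (u := x - d / 2). set (v := x + d / 2).
  assert (Hu : a < u). { apply (Hball u). unfold u. rewrite Rabs_left; lra. }
  assert (Hv : v < b). { apply (Hball v). unfold v. rewrite Rabs_right; lra. }
  assert (Huv : u < v) by (unfold u, v; lra).
  assert (ex : forall c e, ex_RInt g c e).
  { intros. apply (ex_RInt_continuous (V := R_CompleteNormedModule)). intros; apply Hc. }
  assert (I1 := RInt_Chasles g a u b (ex _ _) (ex _ _)).
  assert (I2 := RInt_Chasles g u v b (ex _ _) (ex _ _)).
  assert (J1 : 0 <= RInt g a u) by (apply RInt_ge_0; [lra|apply ex|intros t Ht; apply Hp; unfold u, v in *; lra]).
  assert (J2 : 0 <= RInt g v b) by (apply RInt_ge_0; [lra|apply ex|intros t Ht; apply Hp; unfold u, v in *; lra]).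
  assert (J3 : 0 < RInt g u v).
  { apply RInt_gt_0; [assumption| |intros; apply Hc]. intros t Ht. apply Hball.
    unfold u, v in Ht. apply Rabs_def1; lra. }
  unfold plus in I1, I2; simpl in I1, I2. lra.
Qed.

Lemma chart_fun_zero_nonneg f : chart_fun f -> (forall th ph, chart th ph -> 0 <= f th ph) ->
  RInt (fun th => RInt (f th) 0 (2 * PI)) 0 PI = 0 ->
  forall th ph, chart th ph -> f th ph = 0.
Proof.
  intros H Hp H0 th ph [Ht Hph].
  apply (RInt_zero_nonneg (f th) 0 (2 * PI)); trivial.
  - intros x. now apply chart_fun_continuous_ph.
  - intros x Hx. apply Hp. now split.
  - apply (RInt_zero_nonneg (fun th => RInt (f th) 0 (2 * PI)) 0 PI); trivial.
    + intros x. destruct (chart_fun_dth f H) as [f' [H' D]].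
      apply (ex_derive_continuous (fun th => RInt (f th) 0 (2 * PI))).
      eexists. now apply chart_fun_RInt_dth with (f' := f').
    + intros x Hx. apply RInt_ge_0; [exact PI2_ge0|now apply chart_fun_ex_RInt|].
      intros y Hy. apply Hp. now split.
Qed.

Lemma sin_neq0 th : 0 < th < PI -> sin th <> 0.
Proof. intros [A B]. apply Rgt_not_eq, sin_gt_0; assumption. Qed.

Lemma Cmod2_zero (a b : C) s : 0 < s ->
  s * (fst a ^ 2 + snd a ^ 2 + (fst b ^ 2 + snd b ^ 2)) = 0 -> a = RtoC 0 /\ b = RtoC 0.
Proof.
  intros Hs H. apply Rmult_integral in H. destruct H as [H|H]; [lra|].
  assert (fst a ^ 2 = 0 /\ snd a ^ 2 = 0 /\ fst b ^ 2 = 0 /\ snd b ^ 2 = 0) as [A [B [C D]]].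
  { generalize (pow2_ge_0 (fst a)) (pow2_ge_0 (snd a)) (pow2_ge_0 (fst b)) (pow2_ge_0 (snd b)). lra. }
  assert (Q : forall x, x ^ 2 = 0 -> x = 0) by (intros; nra).
  split; C_components; now apply Q.
Qed.

(* Uniqueness in the definition of B: test the difference Z - Z0 of two
   candidates against its own conjugate. *)
Lemma sdiff_alg_unique Z Z0 : sdiff_alg Z -> sdiff_alg Z0 ->
  (forall W, sdiff_alg W -> pairb Z W = pairb Z0 W) -> chart_eq Z Z0.
Proof.
  intros HZ HZ0 H.
  assert (HW := sdiff_alg_conj_sub Z Z0 HZ HZ0).
  assert (HE := H _ HW). set (W := vconj (vsub Z Z0)) in *.
  destruct (sdiff_alg_spec Z HZ) as [h [p [t [f [_ [Hp [Ht [_ [_ [_ [Ef EZ]]]]]]]]]]].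
  destruct (sdiff_alg_spec Z0 HZ0) as [h0 [p0 [t0 [f0 [_ [Hp0 [Ht0 [_ [_ [_ [Ef0 EZ0]]]]]]]]]]].
  set (dp := fun th ph => Cminus (p th ph) (p0 th ph)).
  set (dt := fun th ph => Cminus (t th ph) (t0 th ph)).
  assert (EQ : forall th ph, 0 < th < PI -> Z th ph = (p th ph, Cmult (RtoC (- / sin th)) (t th ph))).
  { intros th ph Hth. rewrite EZ, Ef. assert (S := sin_neq0 th Hth). f_equal.
    C_components; field; exact S. }
  assert (EQ0 : forall th ph, 0 < th < PI -> Z0 th ph = (p0 th ph, Cmult (RtoC (- / sin th)) (t0 th ph))).
  { intros th ph Hth. rewrite EZ0, Ef0. assert (S := sin_neq0 th Hth). f_equal.
    C_components; field; exact S. }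
  assert (Hdp : chart_funC dp).
  { destruct Hp, Hp0. split; simpl; now apply chart_fun_minus. }
  assert (Hdt : chart_funC dt).
  { destruct Ht, Ht0. split; simpl; now apply chart_fun_minus. }
  (* In the orthonormal frame the components of Z are p and - t, those of W are the conjugates of
     [dp] and [- dt]; the signs cancel, and [J] is the density freed of 1 / sin theta. *)
  set (J := fun q r (th ph : R) => Cmult (RtoC (sin th))
         (Cplus (Cmult (q th ph) (Cconj (dp th ph))) (Cmult (r th ph) (Cconj (dt th ph)))) : C).
  assert (HJ : forall q r, chart_funC q -> chart_funC r -> chart_funC (J q r)).
  { intros q r Hq Hr. apply chart_funC_mult; [apply (chart_funC_RtoC (fun th _ => sin th)); chart_fun_tac|].
    apply chart_funC_plus; (apply chart_funC_mult; [assumption|now apply chart_funC_conj]). }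
  assert (I1 := pairb_chart_funC Z W (J p t) (HJ _ _ Hp Ht)).
  assert (I2 := pairb_chart_funC Z0 W (J p0 t0) (HJ _ _ Hp0 Ht0)).
  rewrite <- HE in I2.
  assert (C1 : is_CInt (fun th => CInt (J p t th) 0 (2 * PI)) 0 PI (pairb Z W)).
  { apply I1. intros th ph [Hth _]. unfold pair_density, W, vconj, vsub, vadd, vopp, vscal, J, dp, dt.
    rewrite EQ, EQ0 by assumption. assert (S := sin_neq0 th Hth). C_components; field; exact S. }
  assert (C2 : is_CInt (fun th => CInt (J p0 t0 th) 0 (2 * PI)) 0 PI (pairb Z W)).
  { apply I2. intros th ph [Hth _]. unfold pair_density, W, vconj, vsub, vadd, vopp, vscal, J, dp, dt.
    rewrite EQ, EQ0 by assumption. assert (S := sin_neq0 th Hth). C_components; field; exact S. }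
  clear I1 I2.
  (* The squared length of Z - Z0 times the area density, that is, the real part of the difference
     of the two densities, whose integrals agree. *)
  set (g := fun th ph => sin th * (fst (dp th ph) ^ 2 + snd (dp th ph) ^ 2
                                   + (fst (dt th ph) ^ 2 + snd (dt th ph) ^ 2))).
  assert (Hg : chart_fun g).
  { destruct Hdp, Hdt.
    apply chart_fun_ext with (fun th ph => sin th * (fst (dp th ph) * fst (dp th ph) + snd (dp th ph) * snd (dp th ph)
      + (fst (dt th ph) * fst (dt th ph) + snd (dt th ph) * snd (dt th ph)))); [chart_fun_tac|].
    intros. unfold g. ring. }
  assert (G0 : RInt (fun th => RInt (g th) 0 (2 * PI)) 0 PI = 0).
  { destruct C1 as [C1 _]. destruct C2 as [C2 _].
    assert (C3 := is_RInt_minus _ _ _ _ _ _ C1 C2).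
    refine (eq_trans _ (Rminus_diag_eq (fst (pairb Z W)) (fst (pairb Z W)) eq_refl)).
    apply is_RInt_unique.
    eapply is_RInt_ext; [|exact C3]. intros th _. simpl.
    rewrite <- (RInt_minus (V := R_CompleteNormedModule)).
    - apply RInt_ext. intros ph _. unfold minus, plus, opp, J, g, dp, dt; simpl. ring.
    - apply (chart_fun_ex_RInt (fun th ph => fst (J p t th ph))). now apply HJ.
    - apply (chart_fun_ex_RInt (fun th ph => fst (J p0 t0 th ph))). now apply HJ. }
  intros th ph Hr. assert (Hr' := Hr). destruct Hr' as [Hth _].
  assert (Gz := chart_fun_zero_nonneg g Hg).
  assert (Hs : 0 < sin th) by (apply sin_gt_0; tauto).
  apply Cmod2_zero with (2 := Gz ltac:(
    intros a b [Ha _]; unfold g; apply Rmult_le_pos;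
    [apply Rlt_le, sin_gt_0; tauto
    |repeat apply Rplus_le_le_0_compat; apply pow2_ge_0]) G0 th ph Hr) in Hs.
  destruct Hs as [D1 D2]. rewrite EQ, EQ0 by assumption.
  assert (X1 : p th ph = p0 th ph).
  { replace (p th ph) with (Cplus (dp th ph) (p0 th ph)) by (unfold dp; C_components; ring).
    rewrite D1. C_components; ring. }
  assert (X2 : t th ph = t0 th ph).
  { replace (t th ph) with (Cplus (dt th ph) (t0 th ph)) by (unfold dt; C_components; ring).
    rewrite D2. C_components; ring. }
  now rewrite X1, X2.
Qed.

(** [Z0] serves twice: as the existence witness it makes the choice in [Bop] meet its specification,
    and by uniqueness the chosen field agrees with it on the chart. *)
Lemma Bop_chart_eq X Y Z0 : sdiff_alg Z0 ->
  (forall W, sdiff_alg W -> pairb Z0 W = pairb X (bracket Y W)) -> chart_eq (Bop X Y) Z0.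
Proof.
  intros H0 H.
  destruct (epsilon_spec (inhabits vzero) (fun Z => sdiff_alg Z /\
       forall W, sdiff_alg W -> pairb Z W = pairb X (bracket Y W))) as [A B].
  - exists Z0. now split.
  - fold (Bop X Y) in A, B. apply sdiff_alg_unique; trivial.
    intros W HW. now rewrite B, H.
Qed.

(** * Pairings of Fourier modes with a Hamiltonian field *)

Lemma is_Cderive_Rmult (f : R -> R) (K : R -> C) t f' K' : is_derive f t f' -> is_Cderive K t K' ->
  is_Cderive (fun s => Cmult (RtoC (f s)) (K s)) t
    (Cplus (Cmult (RtoC f') (K t)) (Cmult (RtoC (f t)) K')).
Proof. intros H. now apply (is_Cderive_mult (fun s => RtoC (f s)) K), is_Cderive_RtoC. Qed.

Definition expi (m : Z) (ph : R) : C := (cos (IZR m * ph), sin (IZR m * ph)).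
Definition im (m : Z) : C := (0, IZR m).

Lemma expi_chart_funC m : chart_funC (fun _ ph => expi m ph).
Proof. split; simpl; chart_fun_tac. Qed.

Lemma expi_is_Cderive m ph : is_Cderive (expi m) ph (Cmult (im m) (expi m ph)).
Proof. split; simpl; auto_derive; trivial; ring. Qed.

(* The field sgrad (kap e^(i m ph) a), with a1 the derivative of a. *)
Definition mode_field (m : Z) (kap : C) (a a1 : R -> R) : vf := fun th ph =>
  (Cmult (Cmult kap (im m)) (Cmult (RtoC (a th / sin th)) (expi m ph)),
   Cmult kap (Cmult (RtoC (- a1 th / sin th)) (expi m ph))).

(* a is C^2 and b is the image of a under minus the Laplacian on the Fourier mode
   e^(i m ph); the last two clauses are the vanishing at the poles when m <> 0. *)
Record eigen_profile (m : Z) (a a1 a2 b : R -> R) : Prop := {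
  eigen_profile_d1 : forall th, is_derive a th (a1 th);
  eigen_profile_d2 : forall th, is_derive a1 th (a2 th);
  eigen_profile_c2 : forall th, continuous a2 th;
  eigen_profile_cb : forall th, continuous b th;
  eigen_profile_eq : forall th, 0 < th < PI ->
    cos th * a1 th + sin th * a2 th + sin th * b th = IZR m ^ 2 * a th / sin th;
  eigen_profile_0 : IZR m * a 0 = 0;
  eigen_profile_PI : IZR m * a PI = 0 }.

(** The pairing is bilinear, without conjugation, so a field of order m meets [h] through the
    unnormalised Fourier coefficient of index -m. *)
Definition fourier (m : Z) (h : R -> R -> C) (th : R) : C :=
  CInt (fun ph => Cmult (expi m ph) (h th ph)) 0 (2 * PI).

Lemma fourier_chart_funC m h : chart_funC h -> chart_funC (fun th ph => Cmult (expi m ph) (h th ph)).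
Proof. intros H. apply chart_funC_mult; [apply expi_chart_funC|exact H]. Qed.

Lemma fourier_is_CInt m h th : chart_funC h ->
  is_CInt (fun ph => Cmult (expi m ph) (h th ph)) 0 (2 * PI) (fourier m h th).
Proof. intros H. apply (chart_funC_is_CInt (fun th ph => Cmult (expi m ph) (h th ph))). now apply fourier_chart_funC. Qed.

Lemma fourier_is_Cderive m h h' : chart_funC h -> chart_funC h' -> (forall th ph, is_Cderive (fun t => h t ph) th (h' th ph)) ->
  forall th, is_Cderive (fourier m h) th (fourier m h' th).
Proof.
  intros H H' D th.
  apply (chart_funC_CInt_dth (fun th ph => Cmult (expi m ph) (h th ph))
                      (fun th ph => Cmult (expi m ph) (h' th ph))).
  - now apply fourier_chart_funC.
  - now apply fourier_chart_funC.
  - intros t ph. apply is_Cderive_scal, D.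
Qed.

Lemma fourier_continuousC m h th : chart_funC h -> continuousC (fourier m h) th.
Proof.
  intros H. destruct (chart_funC_dth h H) as [h' [H' D]].
  eapply is_Cderive_continuousC. now apply fourier_is_Cderive with (h' := h').
Qed.

(** Integration by parts in phi; the boundary terms cancel by periodicity. *)
Lemma fourier_dph m h h' : chart_funC h -> chart_funC h' -> (forall th ph, is_Cderive (h th) ph (h' th ph)) ->
  forall th, fourier m h' th = Cmult (Copp (im m)) (fourier m h th).
Proof.
  intros H H' D th.
  assert (I : is_CInt (fun ph => Cplus (Cmult (Cmult (im m) (expi m ph)) (h th ph))
                               (Cmult (expi m ph) (h' th ph))) 0 (2 * PI)
    (Cminus (Cmult (expi m (2 * PI)) (h th (2 * PI))) (Cmult (expi m 0) (h th 0)))).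
  { apply (is_CInt_derive (fun ph => Cmult (expi m ph) (h th ph))).
    - intros ph. apply is_Cderive_mult; [apply expi_is_Cderive|apply D].
    - intros ph. destruct (chart_funC_dph _ H') as [h'' [_ D'']]. apply continuousC_plus; apply continuousC_mult.
      + apply continuousC_mult; [apply continuousC_const|eapply is_Cderive_continuousC, expi_is_Cderive].
      + eapply is_Cderive_continuousC, D.
      + eapply is_Cderive_continuousC, expi_is_Cderive.
      + eapply is_Cderive_continuousC, D''. }
  assert (P := chart_funC_periodic _ (fourier_chart_funC m h H) th). simpl in P.
  assert (J := is_CInt_plus _ _ _ _ _ _ I (is_CInt_scal (Copp (im m)) _ _ _ _ (fourier_is_CInt m h th H))).
  unfold fourier at 1. apply is_CInt_unique.
  eapply is_CInt_eq; [eapply is_CInt_ext; [exact PI2_ge0| |exact J]|].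
  - intros ph _. simpl. ring.
  - rewrite P. ring.
Qed.

(** An arbitrary field of the algebra with the derivatives of its stream up to order two, since a
    bracket differentiates the field once more. *)
Record test_field (W : vf) (h hth hph hthth hthph hphph : R -> R -> C) : Prop := {
  tf_h : chart_funC h; tf_th : chart_funC hth; tf_ph : chart_funC hph;
  tf_thth : chart_funC hthth; tf_thph : chart_funC hthph; tf_phph : chart_funC hphph;
  tf_dth : forall th ph, is_Cderive (fun t => h t ph) th (hth th ph);
  tf_dph : forall th ph, is_Cderive (h th) ph (hph th ph);
  tf_dthth : forall th ph, is_Cderive (fun t => hth t ph) th (hthth th ph);
  tf_dthph : forall th ph, is_Cderive (hth th) ph (hthph th ph);
  tf_dphph : forall th ph, is_Cderive (hph th) ph (hphph th ph);
  tf_W : forall th ph, W th ph = (Cmult (RtoC (/ sin th)) (hph th ph),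
                                  Cmult (RtoC (- / sin th)) (hth th ph)) }.

Lemma sdiff_alg_test_field W : sdiff_alg W ->
  exists h hth hph hthth hthph hphph, test_field W h hth hph hthth hthph hphph.
Proof.
  intros HW. destruct (sdiff_alg_spec W HW) as [h [p [t [f [H1 [_ [H2 [H3 [H4 [H5 [_ H6]]]]]]]]]]].
  destruct (chart_funC_dth t H2) as [tt [A1 A2]]. destruct (chart_funC_dph t H2) as [tp [B1 B2]].
  destruct (chart_funC_dph f H3) as [fp [C1 C2]].
  exists h, t, f, tt, tp, fp. constructor; assumption.
Qed.

(** The weak form of Lam c = b on one Fourier mode. The primitive is sin c1 K, zero at both poles
    because of sin; [eigen_profile_eq] turns (sin c1)' into m^2 c / sin - sin b. *)
Lemma green m c c1 c2 b (K K1 G : R -> C) : eigen_profile m c c1 c2 b ->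
  (forall th, is_Cderive K th (K1 th)) -> (forall th, continuousC K1 th) ->
  (forall th, 0 < th < PI -> G th = Cplus (Cmult (RtoC (IZR m ^ 2 * c th / sin th)) (K th))
                                         (Cmult (RtoC (sin th * c1 th)) (K1 th))) ->
  is_CInt G 0 PI (CInt (fun th => Cmult (RtoC (sin th * b th)) (K th)) 0 PI).
Proof.
  intros [D1 D2 C2 Cb Eq _ _] DK CK EG.
  assert (dsin : forall th, is_derive sin th (cos th)) by (intros; auto_derive; trivial; ring).
  assert (I : is_CInt (fun th => Cplus (Cmult (RtoC (cos th * c1 th + sin th * c2 th)) (K th))
                         (Cmult (RtoC (sin th * c1 th)) (K1 th))) 0 PI
    (Cminus (Cmult (RtoC (sin PI * c1 PI)) (K PI)) (Cmult (RtoC (sin 0 * c1 0)) (K 0)))).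
  { apply (is_CInt_derive (fun th => Cmult (RtoC (sin th * c1 th)) (K th))).
    - intros th. apply (is_Cderive_Rmult (fun t => sin t * c1 t) K); [|apply DK].
      apply (is_derive_mult sin c1); [apply dsin|apply D2|exact Rmult_comm].
    - intros th.
      assert (Cc1 : continuous c1 th) by (apply (ex_derive_continuous c1); eexists; apply D2).
      assert (Cs : continuous sin th) by (apply (ex_derive_continuous sin); eexists; apply dsin).
      assert (Cc : continuous cos th) by (apply (ex_derive_continuous cos); auto_derive; trivial).
      apply continuousC_plus; apply continuousC_mult.
      + apply continuousC_RtoC. apply (continuous_plus (fun th => cos th * c1 th) (fun th => sin th * c2 th));
        apply (continuous_mult (K := R_AbsRing)); auto.
      + eapply is_Cderive_continuousC, DK.
      + apply continuousC_RtoC. now apply (continuous_mult (K := R_AbsRing)).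
      + apply CK. }
  assert (J : is_CInt (fun th => Cmult (RtoC (sin th * b th)) (K th)) 0 PI
                (CInt (fun th => Cmult (RtoC (sin th * b th)) (K th)) 0 PI)).
  { apply is_CInt_continuousC. intros th. apply continuousC_mult; [apply continuousC_RtoC|eapply is_Cderive_continuousC, DK].
    apply (continuous_mult (K := R_AbsRing)); auto.
    apply (ex_derive_continuous sin); eexists; apply dsin. }
  eapply is_CInt_eq; [eapply is_CInt_ext; [exact PI_ge0| |exact (is_CInt_plus _ _ _ _ _ _ I J)]|].
  - intros th Hth. rewrite EG by assumption. simpl. rewrite <- Eq by assumption.
    C_components; ring.
  - rewrite sin_PI, sin_0. C_components; ring.
Qed.

(** The pairing of sgrad f with sgrad h is the integral of (Lam f) h, so it sees a mode field only
    through [b]; this is what allows B to be read off from its pairings. *)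
Lemma pairb_mode_field m kap c c1 c2 b W h hth hph hthth hthph hphph :
  test_field W h hth hph hthth hthph hphph -> eigen_profile m c c1 c2 b ->
  pairb (mode_field m kap c c1) W
  = Cmult kap (CInt (fun th => Cmult (RtoC (sin th * b th)) (fourier m h th)) 0 PI).
Proof.
  intros T P.
  apply (pairb_val _ _ (fun th => Cmult kap
    (Cplus (Cmult (RtoC (IZR m ^ 2 * c th / sin th)) (fourier m h th))
           (Cmult (RtoC (sin th * c1 th)) (fourier m hth th))))).
  - intros th Hth. assert (S := sin_neq0 th Hth).
    assert (I := is_CInt_plus _ _ _ _ _ _
      (is_CInt_scal (Cmult (Cmult kap (im m)) (RtoC (c th / sin th))) _ _ _ _ (fourier_is_CInt m hph th (tf_ph _ _ _ _ _ _ _ T)))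
      (is_CInt_scal (Cmult kap (RtoC (sin th * c1 th))) _ _ _ _ (fourier_is_CInt m hth th (tf_th _ _ _ _ _ _ _ T)))).
    rewrite (fourier_dph m h hph) in I by apply T.
    eapply is_CInt_eq; [eapply is_CInt_ext; [exact PI2_ge0| |exact I]|].
    + intros ph _. unfold pair_density, mode_field. rewrite (tf_W _ _ _ _ _ _ _ T). C_components; field; exact S.
    + unfold im. C_components; field; exact S.
  - apply is_CInt_scal. apply (green m c c1 c2 b (fourier m h) (fourier m hth)); trivial.
    + intros th. apply fourier_is_Cderive; apply T.
    + intros th. apply fourier_continuousC, T.
Qed.

(* With k the normalising constant, zonal_field k is e^0_3 and zonal_stream k its stream
   function; zonal_speed' is the derivative of zonal_speed. *)
Definition zonal_speed (k th : R) : R := k * (5 * cos th ^ 2 - 1).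
Definition zonal_speed' (k th : R) : R := - (10 * k * cos th * sin th).
Definition zonal_stream (k th : R) : R := k * (5 / 3 * cos th ^ 3 - cos th).
Definition zonal_field (k : R) : vf := fun th _ => (RtoC 0, RtoC (zonal_speed k th)).

Lemma zonal_speed_derive k th : is_derive (zonal_speed k) th (zonal_speed' k th).
Proof. unfold zonal_speed, zonal_speed'. auto_derive; trivial. simpl. ring. Qed.

Lemma zonal_stream_derive k th : is_derive (zonal_stream k) th (- (sin th * zonal_speed k th)).
Proof. unfold zonal_speed, zonal_stream. auto_derive; trivial. simpl. field. Qed.

(** The stream is a zonal harmonic of degree 3, with Lam eigenvalue 3 * 4; the right side is Lam
    applied to it, its theta-derivative being - sin w. *)
Lemma zonal_stream_eigen k th : 12 * zonal_stream k th = zonal_speed' k th * sin th + 2 * zonal_speed k th * cos th.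
Proof.
  unfold zonal_stream, zonal_speed', zonal_speed.
  replace (- (10 * k * cos th * sin th) * sin th) with (- (10 * k * cos th * (sin th)²))
    by (unfold Rsqr; ring).
  rewrite sin2. unfold Rsqr. field.
Qed.

Lemma dph_const (c : R -> C) th ph : dph (fun th _ => c th) th ph = RtoC 0.
Proof. apply is_Cderive_dph. apply is_Cderive_const. Qed.

Lemma bracket_zonal_field k X th ph dx dy :
  is_Cderive (fun t => fst (X th t)) ph dx -> is_Cderive (fun t => snd (X th t)) ph dy ->
  bracket (zonal_field k) X th ph = (Cmult (RtoC (zonal_speed k th)) dx,
    Cminus (Cmult (RtoC (zonal_speed k th)) dy) (Cmult (fst (X th ph)) (RtoC (zonal_speed' k th)))).
Proof.
  intros A B. unfold bracket.
  rewrite (is_Cderive_dph (compth X) th ph dx A), (is_Cderive_dph (compph X) th ph dy B).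
  change (compth (zonal_field k)) with (fun (_ _ : R) => RtoC 0).
  change (compph (zonal_field k)) with (fun (th _ : R) => RtoC (zonal_speed k th)).
  rewrite (dph_const (fun _ => RtoC 0)), (dph_const (fun th => RtoC (zonal_speed k th))).
  rewrite (is_Cderive_dth (fun _ _ => RtoC 0) th ph (RtoC 0) (is_Cderive_const _ _)).
  rewrite (is_Cderive_dth (fun th _ => RtoC (zonal_speed k th)) th ph (RtoC (zonal_speed' k th)) (is_Cderive_RtoC _ _ _ (zonal_speed_derive k th))).
  unfold zonal_field. simpl. f_equal; ring.
Qed.

Lemma bracket_anti X Y th ph : bracket X Y th ph = vopp (bracket Y X) th ph.
Proof. unfold bracket, vopp, vscal. simpl. f_equal; C_components; ring. Qed.

Lemma bracket_zonal_test_field k W h hth hph hthth hthph hphph th ph :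
  test_field W h hth hph hthth hthph hphph ->
  bracket (zonal_field k) W th ph = (Cmult (RtoC (zonal_speed k th / sin th)) (hphph th ph),
    Copp (Cplus (Cmult (RtoC (zonal_speed k th / sin th)) (hthph th ph))
          (Cmult (RtoC (zonal_speed' k th / sin th)) (hph th ph)))).
Proof.
  intros T.
  rewrite (bracket_zonal_field k W th ph (Cmult (RtoC (/ sin th)) (hphph th ph))
                               (Cmult (RtoC (- / sin th)) (hthph th ph))).
  - rewrite (tf_W _ _ _ _ _ _ _ T). unfold Rdiv. f_equal; C_components; ring.
  - apply is_Cderive_ext with (fun t => Cmult (RtoC (/ sin th)) (hph th t)).
    + intros t. now rewrite (tf_W _ _ _ _ _ _ _ T).
    + apply is_Cderive_scal, T.
  - apply is_Cderive_ext with (fun t => Cmult (RtoC (- / sin th)) (hth th t)).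
    + intros t. now rewrite (tf_W _ _ _ _ _ _ _ T).
    + apply is_Cderive_scal, T.
Qed.

(** [u, W] is the Hamiltonian field of w dh/dphi, so [green] is applied to w times the Fourier
    coefficient of h; the phi-derivative contributes - i m. *)
Lemma pairb_mode_bracket_zonal k m kap a a1 a2 b W h hth hph hthth hthph hphph :
  test_field W h hth hph hthth hthph hphph -> eigen_profile m a a1 a2 b ->
  pairb (mode_field m kap a a1) (bracket (zonal_field k) W)
  = Cmult (Copp (Cmult kap (im m)))
      (CInt (fun th => Cmult (RtoC (sin th * (zonal_speed k th * b th))) (fourier m h th)) 0 PI).
Proof.
  intros T P.
  apply (pairb_val _ _ (fun th => Cmult (Copp (Cmult kap (im m)))
    (Cplus (Cmult (RtoC (IZR m ^ 2 * a th / sin th)) (Cmult (RtoC (zonal_speed k th)) (fourier m h th)))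
           (Cmult (RtoC (sin th * a1 th))
                  (Cplus (Cmult (RtoC (zonal_speed' k th)) (fourier m h th)) (Cmult (RtoC (zonal_speed k th)) (fourier m hth th))))))).
  - intros th Hth. assert (S := sin_neq0 th Hth).
    assert (I := is_CInt_plus _ _ _ _ _ _ (is_CInt_plus _ _ _ _ _ _
      (is_CInt_scal (Cmult (Cmult kap (im m)) (RtoC (zonal_speed k th * a th / sin th))) _ _ _ _ (fourier_is_CInt m hphph th (tf_phph _ _ _ _ _ _ _ T)))
      (is_CInt_scal (Cmult kap (RtoC (sin th * a1 th * zonal_speed k th))) _ _ _ _ (fourier_is_CInt m hthph th (tf_thph _ _ _ _ _ _ _ T))))
      (is_CInt_scal (Cmult kap (RtoC (sin th * a1 th * zonal_speed' k th))) _ _ _ _ (fourier_is_CInt m hph th (tf_ph _ _ _ _ _ _ _ T)))).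
    rewrite (fourier_dph m hph hphph), (fourier_dph m h hph), (fourier_dph m hth hthph) in I by apply T.
    eapply is_CInt_eq; [eapply is_CInt_ext; [exact PI2_ge0| |exact I]|].
    + intros ph _. unfold pair_density, mode_field. rewrite (bracket_zonal_test_field _ _ _ _ _ _ _ _ _ _ T).
      C_components; field; exact S.
    + unfold im. C_components; field; exact S.
  - apply is_CInt_scal.
    assert (G := green m a a1 a2 b (fun th => Cmult (RtoC (zonal_speed k th)) (fourier m h th))
     (fun th => Cplus (Cmult (RtoC (zonal_speed' k th)) (fourier m h th)) (Cmult (RtoC (zonal_speed k th)) (fourier m hth th)))).
    eapply is_CInt_eq; [apply G; [exact P| | |]|].
    + intros th. apply (is_Cderive_Rmult (zonal_speed k) (fourier m h)); [apply zonal_speed_derive|apply fourier_is_Cderive; apply T].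
    + intros th. apply continuousC_plus; apply continuousC_mult.
      * apply continuousC_RtoC, (ex_derive_continuous (zonal_speed' k)). unfold zonal_speed'. auto_derive; trivial.
      * apply fourier_continuousC, (tf_h _ _ _ _ _ _ _ T).
      * apply continuousC_RtoC, (ex_derive_continuous (zonal_speed k)). eexists. apply zonal_speed_derive.
      * apply fourier_continuousC, (tf_th _ _ _ _ _ _ _ T).
    + reflexivity.
    + apply CInt_ext; [exact PI_ge0|]. intros th _. C_components; ring.
Qed.

(** Only the phi-component is computed, the one that a zonal field pairs with. *)
Lemma bracket_mode_test_field m kap a a1 a2 b W h hth hph hthth hthph hphph th ph :
  test_field W h hth hph hthth hthph hphph -> eigen_profile m a a1 a2 b -> 0 < th < PI ->
  snd (bracket (mode_field m kap a a1) W th ph) =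
  Cplus (Cplus (Cmult (Cmult (Cmult kap (im m)) (RtoC (a th / sin th ^ 2)))
                  (Cmult (expi m ph) (Cminus (Cmult (RtoC (cos th / sin th)) (hth th ph)) (hthth th ph))))
     (Cmult (Cmult kap (RtoC (a1 th / sin th ^ 2))) (Cmult (expi m ph) (hthph th ph))))
   (Cplus (Cmult (Cmult kap (RtoC (a2 th / sin th ^ 2 - a1 th * cos th / sin th ^ 3)))
                 (Cmult (expi m ph) (hph th ph)))
    (Cmult (Copp (Cmult (Cmult kap (im m)) (RtoC (a1 th / sin th ^ 2)))) (Cmult (expi m ph) (hth th ph)))).
Proof.
  intros T P Hth. assert (S := sin_neq0 th Hth). unfold bracket.
  assert (D1 : dth (compph W) th ph = Cplus (Cmult (RtoC (cos th / sin th ^ 2)) (hth th ph))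
                        (Cmult (RtoC (- / sin th)) (hthth th ph))).
  { apply is_Cderive_dth. apply is_Cderive_ext with (fun t => Cmult (RtoC (- / sin t)) (hth t ph)).
    - intros t. unfold compph. now rewrite (tf_W _ _ _ _ _ _ _ T).
    - apply (is_Cderive_Rmult (fun t => - / sin t) (fun t => hth t ph)); [|apply (tf_dthth _ _ _ _ _ _ _ T)]. auto_derive; [exact S|]. field. exact S. }
  assert (D2 : dph (compph W) th ph = Cmult (RtoC (- / sin th)) (hthph th ph)).
  { apply is_Cderive_dph. apply is_Cderive_ext with (fun t => Cmult (RtoC (- / sin th)) (hth th t)).
    - intros t. unfold compph. now rewrite (tf_W _ _ _ _ _ _ _ T).
    - apply is_Cderive_scal, T. }
  assert (D3 : dth (compph (mode_field m kap a a1)) th ph =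
     Cmult kap (Cmult (RtoC (- a2 th / sin th + a1 th * cos th / sin th ^ 2)) (expi m ph))).
  { apply is_Cderive_dth. apply is_Cderive_scal. eapply is_Cderive_eq.
    - apply (is_Cderive_Rmult (fun t => - a1 t / sin t)); [|apply is_Cderive_const].
      apply (is_derive_div (fun t => - a1 t) sin th (- a2 th) (cos th)); [| |exact S].
      + apply (is_derive_opp a1), P.
      + auto_derive; trivial; ring.
    - C_components; field; exact S. }
  assert (D4 : dph (compph (mode_field m kap a a1)) th ph =
     Cmult kap (Cmult (RtoC (- a1 th / sin th)) (Cmult (im m) (expi m ph)))).
  { apply is_Cderive_dph. apply is_Cderive_scal, is_Cderive_scal, expi_is_Cderive. }
  simpl snd. rewrite D1, D2, D3, D4, (tf_W _ _ _ _ _ _ _ T). unfold mode_field.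
  set (E := expi m ph). C_components; field; exact S.
Qed.

(** Here Lam falls on the stream of u, and its eigenvalue produces the factor 12. *)
Lemma pairb_zonal_bracket_mode k m kap a a1 a2 b W h hth hph hthth hthph hphph :
  test_field W h hth hph hthth hthph hphph -> eigen_profile m a a1 a2 b ->
  pairb (zonal_field k) (bracket (mode_field m kap a a1) W)
  = Cmult (Cmult kap (im m))
      (CInt (fun th => Cmult (RtoC (sin th * (12 * zonal_speed k th * a th))) (fourier m h th)) 0 PI).
Proof.
  intros T P.
  set (H := fourier m h). set (H1 := fourier m hth). set (H2 := fourier m hthth).
  assert (DH : forall th, is_Cderive H th (H1 th)) by (intros; apply fourier_is_Cderive; apply T).
  assert (DH1 : forall th, is_Cderive H1 th (H2 th)) by (intros; apply fourier_is_Cderive; apply T).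
  assert (CH2 : forall th, continuousC H2 th) by (intros; apply fourier_continuousC, T).
  (* [E] is the derivative of a H and [E1] that of [E]: after averaging in phi, the bracket depends
     on a and H only through their product. *)
  set (E := fun th => Cplus (Cmult (RtoC (a1 th)) (H th)) (Cmult (RtoC (a th)) (H1 th))).
  set (E1 := fun th => Cplus (Cplus (Cmult (RtoC (a2 th)) (H th)) (Cmult (RtoC (a1 th)) (H1 th)))
                        (Cplus (Cmult (RtoC (a1 th)) (H1 th)) (Cmult (RtoC (a th)) (H2 th)))).
  assert (Da : forall th, is_Cderive (fun t => RtoC (a t)) th (RtoC (a1 th))) by (intros; apply is_Cderive_RtoC, P).
  assert (Da1 : forall th, is_Cderive (fun t => RtoC (a1 t)) th (RtoC (a2 th))) by (intros; apply is_Cderive_RtoC, P).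
  assert (DE : forall th, is_Cderive E th (E1 th)).
  { intros th. apply is_Cderive_plus; [apply (is_Cderive_Rmult a1 H)|apply (is_Cderive_Rmult a H1)]; trivial; apply P. }
  assert (CE1 : forall th, continuousC E1 th).
  { intros th. assert (K0 := is_Cderive_continuousC _ _ _ (DH th)). assert (K1 := is_Cderive_continuousC _ _ _ (DH1 th)).
    assert (L0 := is_Cderive_continuousC _ _ _ (Da th)). assert (L1 := is_Cderive_continuousC _ _ _ (Da1 th)).
    assert (L2 := continuousC_RtoC a2 th (eigen_profile_c2 _ _ _ _ _ P th)).
    apply continuousC_plus; apply continuousC_plus; apply continuousC_mult; first [exact L2|exact L1|exact L0|idtac];
    first [exact K0|exact K1|exact (CH2 th)]. }
  apply (pairb_val _ _ (fun th => Cmult (Cmult kap (im m)) (Cmult (RtoC (zonal_speed k th))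
    (Cminus (Cmult (RtoC (cos th)) (E th)) (Cmult (RtoC (sin th)) (E1 th)))))).
  - intros th Hth. assert (S := sin_neq0 th Hth).
    set (q := RtoC (zonal_speed k th * sin th ^ 3)).
    assert (I1 := is_CInt_plus _ _ _ _ _ _
      (is_CInt_scal (Cmult q (Cmult (Cmult kap (im m)) (RtoC (a th / sin th ^ 2 * (cos th / sin th))))) _ _ _ _ (fourier_is_CInt m hth th (tf_th _ _ _ _ _ _ _ T)))
      (is_CInt_scal (Copp (Cmult q (Cmult (Cmult kap (im m)) (RtoC (a th / sin th ^ 2))))) _ _ _ _ (fourier_is_CInt m hthth th (tf_thth _ _ _ _ _ _ _ T)))).
    assert (I2 := is_CInt_plus _ _ _ _ _ _
      (is_CInt_scal (Cmult q (Cmult kap (RtoC (a1 th / sin th ^ 2)))) _ _ _ _ (fourier_is_CInt m hthph th (tf_thph _ _ _ _ _ _ _ T)))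
      (is_CInt_scal (Cmult q (Cmult kap (RtoC (a2 th / sin th ^ 2 - a1 th * cos th / sin th ^ 3)))) _ _ _ _ (fourier_is_CInt m hph th (tf_ph _ _ _ _ _ _ _ T)))).
    assert (I3 := is_CInt_scal (Copp (Cmult q (Cmult (Cmult kap (im m)) (RtoC (a1 th / sin th ^ 2))))) _ _ _ _ (fourier_is_CInt m hth th (tf_th _ _ _ _ _ _ _ T))).
    rewrite (fourier_dph m hth hthph), (fourier_dph m h hph) in I2 by apply T.
    assert (I := is_CInt_plus _ _ _ _ _ _ (is_CInt_plus _ _ _ _ _ _ I1 I2) I3). clear I1 I2 I3.
    eapply is_CInt_eq; [eapply is_CInt_ext; [exact PI2_ge0| |exact I]|].
    + intros ph _. unfold pair_density.
      rewrite (bracket_mode_test_field m kap a a1 a2 b W h hth hph hthth hthph hphph th ph T P Hth).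
      unfold q, zonal_field. set (e := expi m ph). C_components; field; exact S.
    + unfold q, E, E1. fold H H1 H2. unfold im. C_components; field; exact S.
  (* The factor m goes inside the integral, because what vanishes at the poles is m a and not a
     itself. *)
  - replace (Cmult (Cmult kap (im m)) (CInt (fun th => Cmult (RtoC (sin th * (12 * zonal_speed k th * a th))) (H th)) 0 PI))
    with (Cmult (Cmult kap (0, 1)) (Cmult (RtoC (IZR m)) (CInt (fun th => Cmult (RtoC (sin th * (12 * zonal_speed k th * a th))) (H th)) 0 PI)))
      by (unfold im; C_components; ring).
    (* Integrate by parts twice: the boundary terms vanish because of sin th,
       respectively because m a vanishes at the poles. *)
    assert (I : is_CInt (fun th => Cminus (Cmult (RtoC (IZR m)) (Cmult (RtoC (zonal_speed k th))
       (Cminus (Cmult (RtoC (cos th)) (E th)) (Cmult (RtoC (sin th)) (E1 th)))))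
         (Cmult (RtoC (IZR m)) (Cmult (RtoC (sin th * (12 * zonal_speed k th * a th))) (H th)))) 0 PI (RtoC 0)).
    { set (G := fun th => Cplus (Cmult (RtoC (- IZR m * (zonal_speed k th * sin th))) (E th))
                            (Cmult (RtoC (IZR m * (12 * zonal_stream k th))) (Cmult (RtoC (a th)) (H th)))).
      eapply is_CInt_eq; [apply (is_CInt_derive G)|].
      - intros th. eapply is_Cderive_eq.
        + apply is_Cderive_plus; [apply (is_Cderive_Rmult (fun t => - IZR m * (zonal_speed k t * sin t)) E)
            |apply (is_Cderive_Rmult (fun t => IZR m * (12 * zonal_stream k t)) (fun t => Cmult (RtoC (a t)) (H t)))].
          * apply is_derive_scal.
            apply (is_derive_mult (zonal_speed k) sin); [apply zonal_speed_derive|auto_derive; trivial|exact Rmult_comm].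
          * apply DE.
          * apply is_derive_scal, is_derive_scal, zonal_stream_derive.
          * apply (is_Cderive_Rmult a H); [apply P|apply DH].
        + rewrite zonal_stream_eigen. unfold plus, mult; simpl. fold (E th). unfold E. C_components; ring.
      - intros th.
        assert (Cw : continuous (zonal_speed k) th) by (apply (ex_derive_continuous (zonal_speed k)); eexists; apply zonal_speed_derive).
        assert (Cc : continuous cos th) by (apply (ex_derive_continuous cos); auto_derive; trivial).
        assert (Cs : continuous sin th) by (apply (ex_derive_continuous sin); auto_derive; trivial).
        assert (Ca : continuous a th) by (apply (ex_derive_continuous a); eexists; apply P).
        assert (CE : continuousC E th) by (eapply is_Cderive_continuousC, DE).
        assert (CH : continuousC H th) by (eapply is_Cderive_continuousC, DH).
        assert (Cneg : forall f, continuousC f th -> continuousC (fun t => Copp (f t)) th).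
        { intros f [X Y]. split; simpl; [now apply (continuous_opp (fun t => fst (f t)))
                                        |now apply (continuous_opp (fun t => snd (f t)))]. }
        unfold Cminus. assert (Cmul : forall f g : R -> R, continuous f th -> continuous g th ->
          continuous (fun t => f t * g t) th) by (intros; now apply (continuous_mult (K := R_AbsRing))).
        apply continuousC_plus; [|apply Cneg]; (apply continuousC_mult; [apply continuousC_const|]); apply continuousC_mult.
        + now apply continuousC_RtoC.
        + apply continuousC_plus; [|apply Cneg]; apply continuousC_mult; try apply continuousC_RtoC; trivial.
        + apply continuousC_RtoC, Cmul; [assumption|]. apply Cmul; [|assumption].
          apply Cmul; [apply continuous_const|assumption].
        + exact CH.
      - unfold G. rewrite sin_PI, sin_0.
        assert (P0 := eigen_profile_0 _ _ _ _ _ P). assert (PP := eigen_profile_PI _ _ _ _ _ P).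
        assert (X : forall x, Cmult (RtoC (IZR m * (12 * zonal_stream k x))) (Cmult (RtoC (a x)) (H x))
                     = Cmult (RtoC (12 * zonal_stream k x)) (Cmult (RtoC (IZR m * a x)) (H x))) by (intros; C_components; ring).
        rewrite !X, P0, PP. C_components; ring. }
    assert (J : is_CInt (fun th => Cmult (RtoC (sin th * (12 * zonal_speed k th * a th))) (H th)) 0 PI
       (CInt (fun th => Cmult (RtoC (sin th * (12 * zonal_speed k th * a th))) (H th)) 0 PI)).
    { apply is_CInt_continuousC. intros th. apply continuousC_mult; [apply continuousC_RtoC|eapply is_Cderive_continuousC, DH].
      apply (ex_derive_continuous (fun th => sin th * (12 * zonal_speed k th * a th))).
      assert (ex_derive a th) by (eexists; apply P).
      assert (ex_derive (zonal_speed k) th) by (eexists; apply zonal_speed_derive).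
      auto_derive; tauto. }
    eapply is_CInt_eq; [eapply is_CInt_ext; [exact PI_ge0| |
      exact (is_CInt_scal (Cmult kap (0, 1)) _ _ _ _ (is_CInt_plus _ _ _ _ _ _ I (is_CInt_scal (RtoC (IZR m)) _ _ _ _ J)))]|].
    + intros th _. unfold im. simpl. C_components; ring.
    + C_components; ring.
Qed.

(** * B and the connection on Fourier modes *)

Lemma mode_field_ext m kap kap' a a1 a' a1' : kap = kap' -> (forall th, a th = a' th) ->
  (forall th, a1 th = a1' th) -> chart_eq (mode_field m kap a a1) (mode_field m kap' a' a1').
Proof. intros -> E E1 th ph _. unfold mode_field. now rewrite E, E1. Qed.

Lemma sgrad_mode_field m kap a a1 : (forall th, is_derive a th (a1 th)) -> forall th ph,
  sgrad (fun th ph => Cmult kap (Cmult (RtoC (a th)) (expi m ph))) th ph = mode_field m kap a a1 th ph.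
Proof.
  intros D th ph. unfold sgrad, mode_field.
  rewrite (is_Cderive_dph _ _ _ _ (is_Cderive_scal kap _ _ _ (is_Cderive_scal (RtoC (a th)) _ _ _ (expi_is_Cderive m ph)))).
  rewrite (is_Cderive_dth (fun th ph => Cmult kap (Cmult (RtoC (a th)) (expi m ph))) th ph
    (Cmult kap (Cmult (RtoC (a1 th)) (expi m ph)))).
  - unfold Rdiv, im. set (e := expi m ph). f_equal; C_components; ring.
  - apply is_Cderive_scal. eapply is_Cderive_eq.
    + apply (is_Cderive_Rmult a (fun _ => expi m ph)); [apply D|apply is_Cderive_const].
    + C_components; ring.
Qed.

Definition sdiff_on_chart (X : vf) : Prop := exists Z, sdiff_alg Z /\ chart_eq Z X.

(** * The zero field *)

Lemma smooth3R_const c : smooth3R (fun _ => c).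
Proof.
  assert (E : forall ds p, D3 ds (fun _ => c) p = match ds with nil => c | _ => 0 end).
  { induction ds as [|i ds IH]; intros p; simpl; [reflexivity|]. unfold pd3.
    rewrite (Derive_ext _ _ _ (fun t => IH _)). apply Derive_const. }
  intros ds. split.
  - intros p eps He. exists 1. split; [lra|]. intros. rewrite !E.
    rewrite Rminus_diag_eq, Rabs_R0 by reflexivity. exact He.
  - intros i p. eapply ex_derive_ext; [intros t; symmetry; apply E|]. apply ex_derive_const.
Qed.

Lemma sdiff_alg_zero : sdiff_alg vzero.
Proof.
  exists (fun _ => RtoC 0). split.
  - split; apply smooth3R_const.
  - intros th ph. unfold sgrad.
    rewrite (dph_const (fun _ => RtoC 0)).
    rewrite (is_Cderive_dth (fun _ _ => RtoC 0) th ph (RtoC 0) (is_Cderive_const _ _)).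
    unfold vzero. f_equal; ring.
Qed.

Lemma pairb_zero_l X Y : chart_eq X vzero -> pairb X Y = RtoC 0.
Proof.
  intros E. apply (pairb_val _ _ (fun _ => RtoC 0)).
  - intros th Hth. eapply is_CInt_eq; [eapply is_CInt_ext; [exact PI2_ge0| |exact (is_CInt_const (RtoC 0) _ _)]|ring].
    intros ph Hph. unfold pair_density. rewrite (E th ph (conj Hth Hph)). unfold vzero; simpl. ring.
  - eapply is_CInt_eq; [apply is_CInt_const|ring].
Qed.

Lemma pairb_zero_r X Y : chart_eq Y vzero -> pairb X Y = RtoC 0.
Proof.
  intros E. apply (pairb_val _ _ (fun _ => RtoC 0)).
  - intros th Hth. eapply is_CInt_eq; [eapply is_CInt_ext; [exact PI2_ge0| |exact (is_CInt_const (RtoC 0) _ _)]|ring].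
    intros ph Hph. unfold pair_density. rewrite (E th ph (conj Hth Hph)). unfold vzero; simpl. ring.
  - eapply is_CInt_eq; [apply is_CInt_const|ring].
Qed.

Lemma bracket_zero_l X Y : chart_eq X vzero -> chart_eq (bracket X Y) vzero.
Proof.
  intros E. eapply chart_eq_trans; [apply (bracket_chart_eq X vzero Y Y E (chart_eq_refl Y))|].
  intros th ph _. unfold bracket.
  change (compth vzero) with (fun _ _ : R => RtoC 0). change (compph vzero) with (fun _ _ : R => RtoC 0).
  rewrite (dph_const (fun _ => RtoC 0)).
  rewrite (is_Cderive_dth (fun _ _ => RtoC 0) th ph (RtoC 0) (is_Cderive_const _ _)).
  unfold vzero; simpl. f_equal; ring.
Qed.

Lemma bracket_zero_r X Y : chart_eq Y vzero -> chart_eq (bracket X Y) vzero.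
Proof.
  intros E th ph H. rewrite bracket_anti. unfold vopp, vscal.
  rewrite (bracket_zero_l Y X E th ph H). unfold vzero; simpl. f_equal; ring.
Qed.

Lemma Bop_zero_l X Y : chart_eq X vzero -> chart_eq (Bop X Y) vzero.
Proof.
  intros E. apply Bop_chart_eq; [apply sdiff_alg_zero|]. intros W _.
  now rewrite (pairb_zero_l X), (pairb_zero_l vzero) by (apply chart_eq_refl || assumption).
Qed.

Lemma Bop_zero_r X Y : chart_eq Y vzero -> chart_eq (Bop X Y) vzero.
Proof.
  intros E. apply Bop_chart_eq; [apply sdiff_alg_zero|]. intros W _.
  rewrite (pairb_zero_l vzero) by apply chart_eq_refl. symmetry.
  now apply pairb_zero_r, bracket_zero_l.
Qed.

Lemma nabla_zero_r X Y : chart_eq Y vzero -> chart_eq (nabla X Y) vzero.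
Proof.
  intros E th ph H. unfold nabla, vsub, vadd, vopp, vscal.
  rewrite (Bop_zero_r X Y E th ph H), (Bop_zero_l Y X E th ph H), (bracket_zero_r X Y E th ph H).
  unfold vzero; simpl. f_equal; ring.
Qed.

(** Both pairings are integrals against the same Fourier coefficient of the stream of W, so they
    agree for every W once Lam g = 12 w a. *)
Lemma Bop_zonal_mode k m kap a a1 a2 b g g1 g2 X Y :
  chart_eq X (zonal_field k) -> chart_eq Y (mode_field m kap a a1) -> eigen_profile m a a1 a2 b ->
  eigen_profile m g g1 g2 (fun th => 12 * zonal_speed k th * a th) -> sdiff_on_chart (mode_field m (Cmult kap (im m)) g g1) ->
  chart_eq (Bop X Y) (mode_field m (Cmult kap (im m)) g g1).
Proof.
  intros EX EY P Pg [Z [HZ EZ]]. eapply chart_eq_trans; [|exact EZ]. apply Bop_chart_eq; [exact HZ|].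
  intros W HW. destruct (sdiff_alg_test_field W HW) as [h [h1 [h2 [h3 [h4 [h5 T]]]]]].
  rewrite (pairb_chart_eq _ _ _ _ EZ (chart_eq_refl W)).
  rewrite (pairb_chart_eq _ _ _ _ EX (bracket_chart_eq _ _ _ _ EY (chart_eq_refl W))).
  rewrite (pairb_mode_field _ _ _ _ _ _ _ _ _ _ _ _ _ T Pg).
  now rewrite (pairb_zonal_bracket_mode _ _ _ _ _ _ _ _ _ _ _ _ _ _ T P).
Qed.

Lemma Bop_mode_zonal k m kap a a1 a2 b g g1 g2 X Y :
  chart_eq X (zonal_field k) -> chart_eq Y (mode_field m kap a a1) -> eigen_profile m a a1 a2 b ->
  eigen_profile m g g1 g2 (fun th => zonal_speed k th * b th) -> sdiff_on_chart (mode_field m (Copp (Cmult kap (im m))) g g1) ->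
  chart_eq (Bop Y X) (mode_field m (Copp (Cmult kap (im m))) g g1).
Proof.
  intros EX EY P Pg [Z [HZ EZ]]. eapply chart_eq_trans; [|exact EZ]. apply Bop_chart_eq; [exact HZ|].
  intros W HW. destruct (sdiff_alg_test_field W HW) as [h [h1 [h2 [h3 [h4 [h5 T]]]]]].
  rewrite (pairb_chart_eq _ _ _ _ EZ (chart_eq_refl W)).
  rewrite (pairb_chart_eq _ _ _ _ EY (bracket_chart_eq _ _ _ _ EX (chart_eq_refl W))).
  rewrite (pairb_mode_field _ _ _ _ _ _ _ _ _ _ _ _ _ T Pg).
  now rewrite (pairb_mode_bracket_zonal _ _ _ _ _ _ _ _ _ _ _ _ _ _ T P).
Qed.

Lemma expi_0 ph : expi 0 ph = RtoC 1.
Proof. unfold expi. rewrite Rmult_0_l, cos_0, sin_0. reflexivity. Qed.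

(** [u, W] is the Hamiltonian field of a phi-derivative, while pairing with u retains only
    phi-averages; these are zero by [fourier_dph] at order 0. *)
Lemma Bop_zonal_zonal k X Y : chart_eq X (zonal_field k) -> chart_eq Y (zonal_field k) -> chart_eq (Bop X Y) vzero.
Proof.
  intros EX EY. apply Bop_chart_eq; [apply sdiff_alg_zero|].
  intros W HW. destruct (sdiff_alg_test_field W HW) as [h [h1 [h2 [h3 [h4 [h5 T]]]]]].
  rewrite (pairb_zero_l vzero) by apply chart_eq_refl. symmetry.
  rewrite (pairb_chart_eq _ _ _ _ EX (bracket_chart_eq _ _ _ _ EY (chart_eq_refl W))).
  apply (pairb_val _ _ (fun _ => RtoC 0)).
  - intros th Hth. assert (S := sin_neq0 th Hth).
    assert (I := is_CInt_plus _ _ _ _ _ _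
      (is_CInt_scal (RtoC (- zonal_speed k th ^ 2 * sin th ^ 2)) _ _ _ _ (fourier_is_CInt 0 h4 th (tf_thph _ _ _ _ _ _ _ T)))
      (is_CInt_scal (RtoC (- (zonal_speed k th * zonal_speed' k th) * sin th ^ 2)) _ _ _ _ (fourier_is_CInt 0 h2 th (tf_ph _ _ _ _ _ _ _ T)))).
    rewrite (fourier_dph 0 h1 h4), (fourier_dph 0 h h2) in I by apply T.
    eapply is_CInt_eq; [eapply is_CInt_ext; [exact PI2_ge0| |exact I]|].
    + intros ph _. unfold pair_density, zonal_field at 1. rewrite (bracket_zonal_test_field _ _ _ _ _ _ _ _ _ _ T), expi_0.
      unfold zonal_field. C_components; field; exact S.
    + unfold im. C_components; ring.
  - eapply is_CInt_eq; [apply is_CInt_const|ring].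
Qed.

Lemma nabla_zonal_zonal k X : chart_eq X (zonal_field k) -> chart_eq (nabla X X) vzero.
Proof.
  intros E th ph H. unfold nabla, vsub, vadd, vopp, vscal.
  rewrite (Bop_zonal_zonal k X X E E th ph H).
  assert (B : bracket X X th ph = vzero th ph).
  { unfold bracket, vzero. f_equal; C_components; ring. }
  rewrite B. unfold vzero; simpl. f_equal; ring.
Qed.

Lemma bracket_zonal_mode k m kap a a1 X Y : chart_eq X (zonal_field k) -> chart_eq Y (mode_field m kap a a1) ->
  chart_eq (bracket X Y) (mode_field m (Cmult kap (im m)) (fun th => zonal_speed k th * a th)
                       (fun th => zonal_speed' k th * a th + zonal_speed k th * a1 th)).
Proof.
  intros EX EY. eapply chart_eq_trans; [apply (bracket_chart_eq _ _ _ _ EX EY)|].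
  intros th ph [Hth _]. assert (S := sin_neq0 th Hth).
  rewrite (bracket_zonal_field k (mode_field m kap a a1) th ph
     (Cmult (Cmult kap (im m)) (Cmult (RtoC (a th / sin th)) (Cmult (im m) (expi m ph))))
     (Cmult kap (Cmult (RtoC (- a1 th / sin th)) (Cmult (im m) (expi m ph))))).
  - unfold mode_field. simpl. set (e := expi m ph). f_equal; C_components; field; exact S.
  - apply is_Cderive_scal, is_Cderive_scal, expi_is_Cderive.
  - apply is_Cderive_scal, is_Cderive_scal, expi_is_Cderive.
Qed.

Definition half_im (m : Z) (kap : C) : C := Cmult kap (0, IZR m / 2).

Section Nabla.
Variables (k : R) (m : Z) (kap : C) (a a1 a2 b g g1 g2 g' g1' g2' : R -> R) (X Y : vf).
Hypotheses (EX : chart_eq X (zonal_field k)) (EY : chart_eq Y (mode_field m kap a a1)) (P : eigen_profile m a a1 a2 b)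
  (Pg : eigen_profile m g g1 g2 (fun th => 12 * zonal_speed k th * a th))
  (Pg' : eigen_profile m g' g1' g2' (fun th => zonal_speed k th * b th))
  (Sg : sdiff_on_chart (mode_field m (Cmult kap (im m)) g g1)) (Sg' : sdiff_on_chart (mode_field m (Copp (Cmult kap (im m))) g' g1')).

(** Up to the factor i m, the profiles of [X, Y], B(X, Y) and B(Y, X) are w a, [g] and the opposite
    of [g']. *)
Lemma nabla_zonal_mode : chart_eq (nabla X Y) (mode_field m (half_im m kap)
    (fun th => zonal_speed k th * a th - g th + g' th)
    (fun th => (zonal_speed' k th * a th + zonal_speed k th * a1 th) - g1 th + g1' th)).
Proof.
  intros th ph H. unfold nabla, vsub, vadd, vopp, vscal.
  rewrite (Bop_zonal_mode k m kap a a1 a2 b g g1 g2 X Y EX EY P Pg Sg th ph H).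
  rewrite (Bop_mode_zonal k m kap a a1 a2 b g' g1' g2' X Y EX EY P Pg' Sg' th ph H).
  rewrite (bracket_zonal_mode k m kap a a1 X Y EX EY th ph H).
  destruct H as [Hth _]. assert (S := sin_neq0 th Hth).
  unfold mode_field, half_im, im. set (e := expi m ph). simpl. f_equal; C_components; field; exact S.
Qed.

Lemma nabla_mode_zonal : chart_eq (nabla Y X) (mode_field m (half_im m kap)
    (fun th => - (zonal_speed k th * a th) - g th + g' th)
    (fun th => - (zonal_speed' k th * a th + zonal_speed k th * a1 th) - g1 th + g1' th)).
Proof.
  intros th ph H. unfold nabla, vsub, vadd, vopp, vscal.
  rewrite (Bop_zonal_mode k m kap a a1 a2 b g g1 g2 X Y EX EY P Pg Sg th ph H).
  rewrite (Bop_mode_zonal k m kap a a1 a2 b g' g1' g2' X Y EX EY P Pg' Sg' th ph H).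
  rewrite bracket_anti. unfold vopp, vscal.
  rewrite (bracket_zonal_mode k m kap a a1 X Y EX EY th ph H).
  destruct H as [Hth _]. assert (S := sin_neq0 th Hth).
  unfold mode_field, half_im, im. set (e := expi m ph). simpl. f_equal; C_components; field; exact S.
Qed.

End Nabla.

(** * Associated Legendre functions *)

(** Polynomials in x, y, z as syntax: formal differentiation stays in the type, so smoothness to all
    orders reduces to continuity of polynomials. *)
Inductive pol : Type :=
| PC (r : R) | PX (i : nat) | PA (p q : pol) | PM (p q : pol).

Definition coord (i : nat) (v : pt3) : R :=
  match v with (x, y, z) => match i with 0%nat => x | 1%nat => y | _ => z end end.

Fixpoint pol_eval (p : pol) (v : pt3) : R :=
  match p with
  | PC r => r
  | PX i => coord i v
  | PA p q => pol_eval p v + pol_eval q v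
  | PM p q => pol_eval p v * pol_eval q v
  end.

Fixpoint pol_diff (i : nat) (p : pol) : pol :=
  match p with
  | PC _ => PC 0
  | PX j => match i, j with
            | 0%nat, 0%nat | 1%nat, 1%nat | S (S _), S (S _) => PC 1
            | _, _ => PC 0 end
  | PA p q => PA (pol_diff i p) (pol_diff i q)
  | PM p q => PA (PM (pol_diff i p) q) (PM p (pol_diff i q))
  end.

Lemma pol_eval_derive p i v s :
  is_derive (fun t => pol_eval p (shift3 v i t)) s (pol_eval (pol_diff i p) (shift3 v i s)).
Proof.
  induction p as [r|j|p IHp q IHq|p IHp q IHq]; simpl.
  - apply (is_derive_const (V := R_NormedModule)).
  - destruct v as [[x y] z]. destruct i as [|[|i]]; destruct j as [|[|j]]; simpl;
    auto_derive; trivial; ring.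
  - now apply (is_derive_plus (fun t => pol_eval p (shift3 v i t)) (fun t => pol_eval q (shift3 v i t))).
  - apply (is_derive_mult (fun t => pol_eval p (shift3 v i t)) (fun t => pol_eval q (shift3 v i t)));
    trivial. exact Rmult_comm.
Qed.

Lemma pol_eval_continuous p (v : R * R * R) : continuous (fun v : R * R * R => pol_eval p v) v.
Proof.
  induction p as [r|j|p IHp q IHq|p IHp q IHq]; simpl.
  - apply continuous_const.
  - destruct j as [|[|j]]; simpl.
    + apply continuous_ext with (fun v : R * R * R => fst (fst v)); [now intros [[x y] z]|].
      apply (continuous_comp fst fst); destruct v as [[x y] z]; apply continuous_fst.
    + apply continuous_ext with (fun v : R * R * R => snd (fst v)); [now intros [[x y] z]|].
      apply (continuous_comp fst snd); destruct v as [[x y] z]; [apply continuous_fst|apply continuous_snd].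
    + apply continuous_ext with (fun v : R * R * R => snd v); [now intros [[x y] z]|].
      destruct v as [[x y] z]; apply continuous_snd.
  - now apply (continuous_plus (fun v : R * R * R => pol_eval p v) (fun v => pol_eval q v)).
  - now apply (continuous_mult (K := R_AbsRing) (fun v : R * R * R => pol_eval p v) (fun v => pol_eval q v)).
Qed.

Lemma pol_eval_smooth p : smooth3R (pol_eval p).
Proof.
  intros ds.
  assert (E : exists p', forall v, D3 ds (pol_eval p) v = pol_eval p' v).
  { induction ds as [|i ds [p' IH]]; simpl; [now exists p|].
    exists (pol_diff i p'). intros v. unfold pd3. rewrite (Derive_ext _ _ _ (fun t => IH _)).
    etransitivity; [apply is_derive_unique, (pol_eval_derive p' i v 0)|]. f_equal.
    destruct v as [[x y] z]; destruct i as [|[|i]]; simpl; apply pt3_ext; ring. }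
  destruct E as [p' E]. split.
  - intros v eps He.
    destruct (pol_eval_continuous p' v (fun y => Rabs (y - pol_eval p' v) < eps)) as [d Hd].
    { exists (mkposreal eps He). intros y Hy. exact Hy. }
    exists d. split; [apply cond_pos|]. intros q A B C. rewrite !E. apply Hd.
    split; [split|]; assumption.
  - intros i v. apply ex_derive_ext with (fun t => pol_eval p' (shift3 v i t)).
    + intros t. now rewrite E.
    + eexists. apply pol_eval_derive.
Qed.

(** Polynomials in z alone, whose values on the sphere depend on cos theta only. *)
Fixpoint zonly (p : pol) : Prop :=
  match p with
  | PC _ => True
  | PX i => (2 <= i)%nat
  | PA p q | PM p q => zonly p /\ zonly q
  end.

Lemma zonly_pol_eval p x y z : zonly p -> pol_eval p (x, y, z) = pol_eval p (0, 0, z).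
Proof.
  induction p as [r|j|p IHp q IHq|p IHp q IHq]; simpl; intros H; trivial.
  - destruct j as [|[|j]]; simpl; trivial; lia.
  - destruct H. now rewrite IHp, IHq.
  - destruct H. now rewrite IHp, IHq.
Qed.

Lemma zonly_pol_diff i p : zonly p -> zonly (pol_diff i p).
Proof.
  induction p as [r|j|p IHp q IHq|p IHp q IHq]; simpl; intros H; trivial.
  - destruct i as [|[|i]]; destruct j as [|[|j]]; simpl; trivial.
  - tauto.
  - tauto.
Qed.

Fixpoint ppow (p : pol) (n : nat) : pol :=
  match n with O => PC 1 | S n => PM p (ppow p n) end.

Lemma ppow_pol_eval p n v : pol_eval (ppow p n) v = pol_eval p v ^ n.
Proof. induction n as [|n IH]; simpl; [reflexivity|now rewrite IH]. Qed.

Lemma zonly_ppow p n : zonly p -> zonly (ppow p n).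
Proof. intros H. induction n; simpl; tauto. Qed.

(** * Derivatives of (x^2 - 1)^l and their recurrences *)

Definition rodrigues_base (l : nat) : pol :=
  PM (PC (/ (2 ^ l * INR (fact l)))) (ppow (PA (PM (PX 2) (PX 2)) (PC (-1))) l).

Definition rodrigues_pol (l n : nat) : pol := Nat.iter n (pol_diff 2) (rodrigues_base l).

Lemma rodrigues_pol_zonly l n : zonly (rodrigues_pol l n).
Proof.
  unfold rodrigues_pol. induction n as [|n IH]; simpl; [|now apply zonly_pol_diff].
  split; [trivial|]. apply zonly_ppow. simpl. repeat split; lia.
Qed.

(* The n-th derivative of (x^2 - 1)^l / (2^l l!). *)
Definition rodrigues (l n : nat) (x : R) : R := pol_eval (rodrigues_pol l n) (0, 0, x).

Lemma rodrigues_derive l n x : is_derive (rodrigues l n) x (rodrigues l (S n) x).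
Proof.
  assert (H := pol_eval_derive (rodrigues_pol l n) 2 (0, 0, 0) x). simpl in H.
  rewrite Rplus_0_l in H. eapply is_derive_ext; [|exact H].
  intros t. simpl. now rewrite Rplus_0_l.
Qed.

Lemma fact_pow_neq0 l : 2 ^ l * INR (fact l) <> 0.
Proof. apply Rmult_integral_contrapositive_currified; [apply pow_nonzero; lra|apply INR_fact_neq_0]. Qed.

Lemma rodrigues_0 l x : rodrigues l 0 x = (x ^ 2 - 1) ^ l / (2 ^ l * INR (fact l)).
Proof.
  unfold rodrigues, rodrigues_pol. simpl Nat.iter. unfold rodrigues_base. simpl pol_eval. rewrite ppow_pol_eval. simpl pol_eval.
  replace (x * x + -1) with (x ^ 2 - 1) by ring. unfold Rdiv. ring.
Qed.

(** The chain rule. With [rodrigues_S0] it is the source of the recurrences below, obtained by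
    differentiating repeatedly. *)
Lemma rodrigues_1 l x : rodrigues (S l) 1 x = x * rodrigues l 0 x.
Proof.
  rewrite <- (is_derive_unique _ _ _ (rodrigues_derive (S l) 0 x)).
  rewrite (Derive_ext _ _ _ (rodrigues_0 (S l))), rodrigues_0.
  apply is_derive_unique.
  assert (D : 2 ^ S l * INR (fact (S l)) = 2 * INR (S l) * (2 ^ l * INR (fact l))).
  { change (fact (S l)) with (S l * fact l)%nat. rewrite mult_INR.
    change (2 ^ S l) with (2 * 2 ^ l). ring. }
  rewrite D. assert (B := fact_pow_neq0 l). assert (A := not_0_INR (S l) ltac:(lia)).
  set (d := 2 ^ l * INR (fact l)) in *.
  auto_derive; [trivial|]. fold (INR (S l)). set (e := INR (S l)) in *.
  replace (x * (x * 1) + - (1)) with (x ^ 2 - 1) by ring. simpl pred. field. tauto.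
Qed.

Lemma derive_eq (f g : R -> R) (f' g' : R) x : (forall y, f y = g y) ->
  is_derive f x f' -> is_derive g x g' -> f' = g'.
Proof.
  intros E F G. rewrite <- (is_derive_unique _ _ _ F), <- (is_derive_unique _ _ _ G).
  now apply Derive_ext.
Qed.

Lemma x_rodrigues_derive l n x : is_derive (fun y => y * rodrigues l n y) x (rodrigues l n x + x * rodrigues l (S n) x).
Proof.
  replace (rodrigues l n x + x * rodrigues l (S n) x) with (1 * rodrigues l n x + x * rodrigues l (S n) x) by ring.
  apply (is_derive_mult (fun y => y) (rodrigues l n)); [apply (is_derive_id (K := R_AbsRing))|apply rodrigues_derive|exact Rmult_comm].
Qed.

(** Leibniz rule for the n-th derivative of [rodrigues_1]; at n = 0 the truncated [pred n] carries
    the factor 0. *)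
Lemma rodrigues_up l n x : rodrigues (S l) (S n) x = x * rodrigues l n x + INR n * rodrigues l (pred n) x.
Proof.
  revert x. induction n as [|n IH]; intros x; [rewrite rodrigues_1; simpl; ring|].
  apply (derive_eq _ _ _ _ x IH); [apply rodrigues_derive|].
  replace (x * rodrigues l (S n) x + INR (S n) * rodrigues l (pred (S n)) x)
    with ((rodrigues l n x + x * rodrigues l (S n) x) + INR n * rodrigues l (S (pred n)) x).
  - apply (is_derive_plus (fun y => y * rodrigues l n y) (fun y => INR n * rodrigues l (pred n) y)).
    + apply x_rodrigues_derive.
    + apply is_derive_scal, rodrigues_derive.
  - rewrite S_INR. destruct n; simpl; ring.
Qed.

Lemma rodrigues_S0 l x : 2 * INR (S l) * rodrigues (S l) 0 x = (x ^ 2 - 1) * rodrigues l 0 x.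
Proof.
  rewrite !rodrigues_0. change (fact (S l)) with (S l * fact l)%nat. rewrite mult_INR.
  assert (A := not_0_INR (S l) ltac:(lia)). assert (B := INR_fact_neq_0 l).
  assert (C := pow_nonzero 2 l ltac:(lra)).
  change (2 ^ S l) with (2 * 2 ^ l). change ((x ^ 2 - 1) ^ S l) with ((x ^ 2 - 1) * (x ^ 2 - 1) ^ l).
  field. tauto.
Qed.

(** At n = 0 this is f = x^2 f - (x^2 - 1) f; the rest follows by differentiation. *)
Lemma rodrigues_down l n x : rodrigues l n x = x * rodrigues (S l) (S n) x - (2 * INR (S l) - INR n) * rodrigues (S l) n x.
Proof.
  revert x. induction n as [|n IH]; intros x.
  - rewrite rodrigues_1, Rminus_0_r, rodrigues_S0. ring.
  - apply (derive_eq _ _ _ _ x IH); [apply rodrigues_derive|].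
    replace (x * rodrigues (S l) (S (S n)) x - (2 * INR (S l) - INR (S n)) * rodrigues (S l) (S n) x)
      with ((rodrigues (S l) (S n) x + x * rodrigues (S l) (S (S n)) x) - (2 * INR (S l) - INR n) * rodrigues (S l) (S n) x)
      by (rewrite (S_INR n); ring).
    apply (is_derive_minus (fun y => y * rodrigues (S l) (S n) y) (fun y => (2 * INR (S l) - INR n) * rodrigues (S l) n y)).
    + apply x_rodrigues_derive.
    + apply is_derive_scal, rodrigues_derive.
Qed.

(** With n = k + M all three terms have order M, and this is the three-term recurrence of the
    associated Legendre functions in the degree. *)
Lemma rodrigues_rec k n x : (2 * INR (S k) - INR (S n) + 1) * rodrigues (S (S k)) (S (S n)) x
  = (2 * INR (S k) + 1) * x * rodrigues (S k) (S n) x - INR (S n) * rodrigues k n x.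
Proof.
  rewrite (rodrigues_up (S k) (S n)), (rodrigues_down k n). simpl pred. rewrite (S_INR n). ring.
Qed.

(** The n-th derivative of (x^2 - 1) y' = 2 l x y, which y = (x^2 - 1)^l satisfies. Its shift
    [rodrigues_ode] is Legendre's equation at n = l. *)
Lemma rodrigues_ode_aux l n x : (x ^ 2 - 1) * rodrigues l (S n) x + 2 * (INR n - INR l) * (x * rodrigues l n x)
  - INR n * (2 * INR l - INR n + 1) * rodrigues l (pred n) x = 0.
Proof.
  revert x. induction n as [|n IH]; intros x.
  - destruct l as [|l].
    + assert (E : rodrigues 0 1 x = 0).
      { apply (derive_eq (rodrigues 0 0) (fun _ => 1) _ _ x).
        - intros y. rewrite rodrigues_0. simpl. field.
        - apply rodrigues_derive.
        - apply (is_derive_const (V := R_NormedModule)). }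
      rewrite E. simpl. ring.
    + rewrite rodrigues_1. simpl INR at 1 3.
      replace (_ - _) with (x * ((x ^ 2 - 1) * rodrigues l 0 x - 2 * INR (S l) * rodrigues (S l) 0 x)) by ring.
      rewrite rodrigues_S0. ring.
  - assert (D : is_derive (fun x => (x ^ 2 - 1) * rodrigues l (S n) x + 2 * (INR n - INR l) * (x * rodrigues l n x)
      - INR n * (2 * INR l - INR n + 1) * rodrigues l (pred n) x) x
      ((2 * x * rodrigues l (S n) x + (x ^ 2 - 1) * rodrigues l (S (S n)) x)
        + 2 * (INR n - INR l) * (rodrigues l n x + x * rodrigues l (S n) x)
       - INR n * (2 * INR l - INR n + 1) * rodrigues l (S (pred n)) x)).
    { apply (is_derive_minus (fun x => (x ^ 2 - 1) * rodrigues l (S n) x + 2 * (INR n - INR l) * (x * rodrigues l n x))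
        (fun x => INR n * (2 * INR l - INR n + 1) * rodrigues l (pred n) x)).
      - apply (is_derive_plus (fun x => (x ^ 2 - 1) * rodrigues l (S n) x) (fun x => 2 * (INR n - INR l) * (x * rodrigues l n x))).
        + apply (is_derive_mult (fun x => x ^ 2 - 1) (rodrigues l (S n))); [|apply rodrigues_derive|exact Rmult_comm].
          auto_derive; trivial. ring.
        + apply is_derive_scal, x_rodrigues_derive.
      - apply is_derive_scal, rodrigues_derive. }
    assert (Z := derive_eq _ (fun _ => 0) _ 0 x IH D (is_derive_const (V := R_NormedModule) 0 x)).
    rewrite <- Z. simpl pred. rewrite (S_INR n). destruct n as [|n]; [simpl; ring|].
    simpl pred. ring.
Qed.

Lemma rodrigues_ode l n x : (x ^ 2 - 1) * rodrigues l (S (S n)) x + 2 * (INR n + 1 - INR l) * (x * rodrigues l (S n) x)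
  - (INR n + 1) * (2 * INR l - INR n) * rodrigues l n x = 0.
Proof. rewrite <- (rodrigues_ode_aux l (S n) x). simpl pred. rewrite (S_INR n). ring. Qed.

Lemma rodrigues_top l x : rodrigues l (2 * l) x = INR (fact (2 * l)) / (2 ^ l * INR (fact l))
  /\ rodrigues l (S (2 * l)) x = 0.
Proof.
  assert (T : forall x, rodrigues l (2 * l) x = INR (fact (2 * l)) / (2 ^ l * INR (fact l))).
  { induction l as [|l IH]; intros y.
    - simpl Nat.mul. rewrite rodrigues_0. simpl. field.
    - replace (2 * S l)%nat with (S (S (2 * l))) by lia.
      rewrite rodrigues_up. simpl pred. rewrite IH.
      assert (Z : rodrigues l (S (2 * l)) y = 0).
      { apply (derive_eq _ _ _ _ y IH); [apply rodrigues_derive|apply (is_derive_const (V := R_NormedModule))]. }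
      rewrite Z.
      change (fact (S (S (2 * l)))) with (S (S (2 * l)) * (S (2 * l) * fact (2 * l)))%nat.
      change (fact (S l)) with (S l * fact l)%nat.
      rewrite !mult_INR. change (2 ^ S l) with (2 * 2 ^ l).
      assert (A := not_0_INR (S l) ltac:(lia)). assert (B := INR_fact_neq_0 l).
      assert (C := pow_nonzero 2 l ltac:(lra)).
      rewrite !S_INR, mult_INR in *. simpl (INR 2). field. tauto. }
  split; [apply T|].
  apply (derive_eq _ _ _ _ x T); [apply rodrigues_derive|apply (is_derive_const (V := R_NormedModule))].
Qed.

(** Relates the orders -M and M in degree M + j, whose derivatives have indices j and 2 M + j. Both
    families obey the three-term recurrence, with coefficients that the factorials absorb, hence an
    induction on j with two base cases. *)
Lemma rodrigues_reflect M j x : INR (fact (2 * M + j)) * rodrigues (M + j) j x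
  = INR (fact j) * ((x ^ 2 - 1) ^ M * rodrigues (M + j) (2 * M + j) x).
Proof.
  assert (B0 : INR (fact (2 * M + 0)) * rodrigues (M + 0) 0 x
     = INR (fact 0) * ((x ^ 2 - 1) ^ M * rodrigues (M + 0) (2 * M + 0) x)).
  { rewrite !Nat.add_0_r, rodrigues_0. destruct (rodrigues_top M x) as [-> _].
    assert (B := fact_pow_neq0 M). simpl (fact 0). simpl (INR 1). field.
    split; [apply INR_fact_neq_0|apply pow_nonzero; lra]. }
  assert (B1 : INR (fact (2 * M + 1)) * rodrigues (M + 1) 1 x
     = INR (fact 1) * ((x ^ 2 - 1) ^ M * rodrigues (M + 1) (2 * M + 1) x)).
  { destruct M as [|M'].
    - simpl (2 * 0 + 1)%nat. simpl. ring.
    - set (M := S M') in *. rewrite Nat.add_0_r in B0. rewrite !Nat.add_1_r, rodrigues_1.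
      (* The term of degree M' has index 2 M' + 1, one beyond the top derivative, and drops out. *)
      assert (E := rodrigues_rec M' (S (2 * M')) x). destruct (rodrigues_top M' x) as [_ Z]. rewrite Z in E.
      replace (S (S (S (2 * M')))) with (S (2 * M))%nat in E by lia.
      replace (S (S (2 * M'))) with (2 * M)%nat in E by lia.
      fold M in E. rewrite mult_INR in E. simpl (INR 2) in E.
      assert (E' : rodrigues (S M) (S (2 * M)) x = (2 * INR M + 1) * x * rodrigues M (2 * M) x) by lra.
      rewrite E'. rewrite Nat.add_0_r in B0.
      change (fact (S (2 * M))) with (S (2 * M) * fact (2 * M))%nat.
      rewrite mult_INR, S_INR, mult_INR. simpl (INR 2). simpl (fact 1). simpl (fact 0) in B0.
      simpl (INR 1) in *. rewrite Rmult_1_l in *.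
      transitivity ((2 * INR M + 1) * x * (INR (fact (2 * M)) * rodrigues M 0 x)); [ring|].
      rewrite B0. ring. }
  revert j. assert (H : forall j, (INR (fact (2 * M + j)) * rodrigues (M + j) j x
      = INR (fact j) * ((x ^ 2 - 1) ^ M * rodrigues (M + j) (2 * M + j) x)) /\
    (INR (fact (2 * M + S j)) * rodrigues (M + S j) (S j) x
      = INR (fact (S j)) * ((x ^ 2 - 1) ^ M * rodrigues (M + S j) (2 * M + S j) x))).
  { induction j as [|i [H1 H2]]; [now split|]. split; [exact H2|].
    assert (E1 := rodrigues_rec (M + i) i x). assert (E2 := rodrigues_rec (M + i) (2 * M + i) x).
    rewrite <- !Nat.add_succ_r in E1, E2.
    set (F := (x ^ 2 - 1) ^ M) in *.
    assert (N1 : 2 * INR (M + S i) - INR (S i) + 1 = 2 * INR M + INR i + 2)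
      by (rewrite plus_INR, S_INR; ring).
    assert (N2 : 2 * INR (M + S i) - INR (2 * M + S i) + 1 = INR i + 2)
      by (rewrite !plus_INR, mult_INR, S_INR; simpl; ring).
    rewrite N1 in E1. rewrite N2 in E2.
    assert (P1 : 0 <= INR M) by apply pos_INR. assert (P2 : 0 <= INR i) by apply pos_INR.
    rewrite !Nat.add_succ_r in *.
    set (r := 2 * INR (S (M + i)) + 1) in *.
    change (fact (S (S (2 * M + i)))) with (S (S (2 * M + i)) * fact (S (2 * M + i)))%nat.
    change (fact (S (S i))) with (S (S i) * fact (S i))%nat.
    change (fact (S (2 * M + i))) with (S (2 * M + i) * fact (2 * M + i))%nat in *.
    change (fact (S i)) with (S i * fact i)%nat in *.
    rewrite !mult_INR in *.
    assert (S2M : INR (S (S (2 * M + i))) = 2 * INR M + INR i + 2)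
      by (rewrite !S_INR, plus_INR, mult_INR; simpl; ring).
    assert (S1M : INR (S (2 * M + i)) = 2 * INR M + INR i + 1)
      by (rewrite !S_INR, plus_INR, mult_INR; simpl; ring).
    rewrite S2M. rewrite S1M in *. rewrite (S_INR (S i)). rewrite (S_INR i) in *.
    set (f2 := INR (fact (2 * M + i))) in *. set (fi := INR (fact i)) in *.
    replace ((2 * INR M + INR i + 2) * ((2 * INR M + INR i + 1) * f2) * rodrigues (S (S (M + i))) (S (S i)) x)
      with ((2 * INR M + INR i + 1) * f2 * ((2 * INR M + INR i + 2) * rodrigues (S (S (M + i))) (S (S i)) x)) by ring.
    rewrite E1.
    replace ((INR i + 1 + 1) * ((INR i + 1) * fi) * (F * rodrigues (S (S (M + i))) (S (S (2 * M + i))) x))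
      with ((INR i + 1) * fi * F * ((INR i + 2) * rodrigues (S (S (M + i))) (S (S (2 * M + i))) x)) by ring.
    rewrite E2.
    replace ((2 * INR M + INR i + 1) * f2 * (r * x * rodrigues (S (M + i)) (S i) x - (INR i + 1) * rodrigues (M + i) i x))
     with (r * x * ((2 * INR M + INR i + 1) * f2 * rodrigues (S (M + i)) (S i) x)
           - (2 * INR M + INR i + 1) * (INR i + 1) * (f2 * rodrigues (M + i) i x)) by ring.
    rewrite H2, H1. ring. }
  intros j. apply H.
Qed.

(* The theta-profile of the spherical harmonics of degree k and order +-M, up to a
   constant; it vanishes identically for k < M. *)
Definition profile (M k : nat) (th : R) : R := sin th ^ M * rodrigues k (k + M) (cos th).
(** Here and in [profile''] a truncated predecessor in an exponent always comes with an integer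
    factor that is 0 when the truncation occurs. *)
Definition profile' (M k : nat) (th : R) : R :=
  INR M * sin th ^ pred M * cos th * rodrigues k (k + M) (cos th)
  - sin th ^ S M * rodrigues k (S (k + M)) (cos th).
Definition profile'' (M k : nat) (th : R) : R :=
  INR M * INR (pred M) * sin th ^ pred (pred M) * cos th ^ 2 * rodrigues k (k + M) (cos th)
  - INR M * sin th ^ M * rodrigues k (k + M) (cos th)
  - (2 * INR M + 1) * sin th ^ M * cos th * rodrigues k (S (k + M)) (cos th)
  + sin th ^ S (S M) * rodrigues k (S (S (k + M))) (cos th).

(** * Derivatives of the profiles and the associated Legendre equation *)

Lemma rodrigues_cos_derive k n th : is_derive (fun t => rodrigues k n (cos t)) th (- sin th * rodrigues k (S n) (cos th)).
Proof.
  apply (is_derive_comp (rodrigues k n) cos); [apply rodrigues_derive|]. auto_derive; trivial; ring.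
Qed.

Lemma sinpow_derive n th : is_derive (fun t => sin t ^ n) th (INR n * sin th ^ pred n * cos th).
Proof. auto_derive; trivial; ring. Qed.

Lemma profile_derive M k th : is_derive (profile M k) th (profile' M k th).
Proof.
  unfold profile'. replace (_ - _) with (INR M * sin th ^ pred M * cos th * rodrigues k (k + M) (cos th)
    + sin th ^ M * (- sin th * rodrigues k (S (k + M)) (cos th))) by (simpl; ring).
  apply (is_derive_mult (fun t => sin t ^ M) (fun t => rodrigues k (k + M) (cos t)));
    [apply sinpow_derive|apply rodrigues_cos_derive|exact Rmult_comm].
Qed.

Lemma profile'_derive M k th : is_derive (profile' M k) th (profile'' M k th).
Proof.
  apply is_derive_ext with (fun t => INR M * ((sin t ^ pred M * cos t) * rodrigues k (k + M) (cos t))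
     - sin t ^ S M * rodrigues k (S (k + M)) (cos t)).
  { intros t. unfold profile'. match goal with |- @eq _ ?a ?b => change (@eq R a b) end. ring. }
  assert (E : INR M * sin th ^ M = INR M * (sin th ^ pred M * sin th)) by (destruct M; simpl; ring).
  unfold profile''.
  replace (_ + _) with
   (INR M * (((INR (pred M) * sin th ^ pred (pred M) * cos th) * cos th + sin th ^ pred M * (- sin th))
      * rodrigues k (k + M) (cos th)
      + (sin th ^ pred M * cos th) * (- sin th * rodrigues k (S (k + M)) (cos th)))
    - (INR (S M) * sin th ^ M * cos th * rodrigues k (S (k + M)) (cos th)
       + sin th ^ S M * (- sin th * rodrigues k (S (S (k + M))) (cos th)))).
  - apply (is_derive_minus (fun t => INR M * ((sin t ^ pred M * cos t) * rodrigues k (k + M) (cos t)))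
      (fun t => sin t ^ S M * rodrigues k (S (k + M)) (cos t))).
    + apply is_derive_scal.
      apply (is_derive_mult (fun t => sin t ^ pred M * cos t) (fun t => rodrigues k (k + M) (cos t)));
        [|apply rodrigues_cos_derive|exact Rmult_comm].
      apply (is_derive_mult (fun t => sin t ^ pred M) cos);
        [apply sinpow_derive|auto_derive; trivial; ring|exact Rmult_comm].
    + apply (is_derive_mult (fun t => sin t ^ S M) (fun t => rodrigues k (S (k + M)) (cos t)));
        [apply (sinpow_derive (S M))|apply rodrigues_cos_derive|exact Rmult_comm].
  - rewrite S_INR.
    set (q := rodrigues k (k + M) (cos th)). set (q1 := rodrigues k (S (k + M)) (cos th)).
    set (q2 := rodrigues k (S (S (k + M))) (cos th)).
    transitivity (INR M * INR (pred M) * sin th ^ pred (pred M) * cos th ^ 2 * q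
      - (INR M * (sin th ^ pred M * sin th)) * (q + cos th * q1)
      - (INR M + 1) * sin th ^ M * cos th * q1 + sin th ^ S (S M) * q2).
    + simpl; ring.
    + rewrite <- E. simpl; ring.
Qed.

Lemma profile''_continuous M k (th : R) : continuous (profile'' M k) th.
Proof.
  assert (Cm : forall f g : R -> R, continuous f th -> continuous g th ->
    continuous (fun t => f t * g t) th) by (intros; now apply (continuous_mult (K := R_AbsRing))).
  assert (Cq : forall n, continuous (fun t => rodrigues k n (cos t)) th).
  { intros n. apply (ex_derive_continuous (fun t => rodrigues k n (cos t))). eexists. apply rodrigues_cos_derive. }
  assert (Cs : forall n, continuous (fun t => sin t ^ n) th).
  { intros n. apply (ex_derive_continuous (fun t => sin t ^ n)). eexists. apply sinpow_derive. }
  assert (Cc : forall n, continuous (fun t => cos t ^ n) th).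
  { intros n. apply (ex_derive_continuous (fun t => cos t ^ n)). auto_derive; trivial. }
  assert (C1 : continuous cos th) by (apply (ex_derive_continuous cos); auto_derive; trivial).
  assert (Ck : forall c : R, continuous (fun _ : R => c) th) by (intros; apply continuous_const).
  unfold profile''.
  apply (continuous_plus (fun t => INR M * INR (pred M) * sin t ^ pred (pred M) * cos t ^ 2 * rodrigues k (k + M) (cos t)
      - INR M * sin t ^ M * rodrigues k (k + M) (cos t)
      - (2 * INR M + 1) * sin t ^ M * cos t * rodrigues k (S (k + M)) (cos t))
    (fun t => sin t ^ S (S M) * rodrigues k (S (S (k + M))) (cos t))); [|now apply Cm].
  apply (continuous_minus (fun t => INR M * INR (pred M) * sin t ^ pred (pred M) * cos t ^ 2 * rodrigues k (k + M) (cos t)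
      - INR M * sin t ^ M * rodrigues k (k + M) (cos t))
    (fun t => (2 * INR M + 1) * sin t ^ M * cos t * rodrigues k (S (k + M)) (cos t))).
  - apply (continuous_minus (fun t => INR M * INR (pred M) * sin t ^ pred (pred M) * cos t ^ 2 * rodrigues k (k + M) (cos t))
      (fun t => INR M * sin t ^ M * rodrigues k (k + M) (cos t))).
    + apply Cm; [|trivial]. apply Cm; [|trivial]. apply Cm; trivial.
    + apply Cm; [|trivial]. apply Cm; trivial.
  - apply Cm; [|trivial]. apply Cm; [|trivial]. apply Cm; trivial.
Qed.

Lemma abs_nat_sqr m : IZR m ^ 2 = INR (Z.abs_nat m) ^ 2.
Proof. rewrite INR_IZR_INZ, Zabs2Nat.id_abs, abs_IZR, pow2_abs. reflexivity. Qed.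

(** [rodrigues_ode] at n = k + M and x = cos theta gives the associated Legendre equation; the
    factor sin^M yields the term m^2 / sin and, for m nonzero, the vanishing at the poles. *)
Lemma profile_eigen_profile m k : eigen_profile m (profile (Z.abs_nat m) k) (profile' (Z.abs_nat m) k) (profile'' (Z.abs_nat m) k)
  (fun th => INR k * (INR k + 1) * profile (Z.abs_nat m) k th).
Proof.
  set (M := Z.abs_nat m).
  assert (Hpole : forall x, sin x = 0 -> IZR m * profile M k x = 0).
  { intros x Hx. unfold profile. rewrite Hx. destruct (Z.eq_dec m 0) as [->|Hm]; [ring|].
    assert (HM : M <> 0%nat) by (unfold M; lia). destruct M as [|M']; [easy|]. simpl. ring. }
  constructor.
  - apply profile_derive.
  - apply profile'_derive.
  - apply profile''_continuous.
  - intros th. apply (ex_derive_continuous (fun th => INR k * (INR k + 1) * profile M k th)).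
    apply ex_derive_scal. eexists. apply profile_derive.
  - intros th Hth. assert (S0 := sin_neq0 th Hth). rewrite abs_nat_sqr. fold M.
    assert (O := rodrigues_ode k (k + M) (cos th)). rewrite plus_INR in O.
    (* Lowered powers of sin become divisions by sin theta; the integer factors make this valid for
       M = 0 and M = 1 as well. *)
    assert (P1 : INR M * sin th ^ pred M = INR M * sin th ^ M / sin th).
    { destruct M as [|M']; simpl; field; exact S0. }
    assert (P2 : INR M * INR (pred M) * sin th ^ pred (pred M)
                 = INR M * (INR M - 1) * sin th ^ M / sin th ^ 2).
    { destruct M as [|[|M']].
      - simpl; field; exact S0.
      - simpl; field; exact S0.
      - rewrite (S_INR (S M')). simpl pred. simpl pow. field. exact S0. }
    unfold profile, profile', profile''. rewrite P1, P2. simpl (sin th ^ S _).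
    set (q := rodrigues k (k + M) (cos th)) in *. set (q1 := rodrigues k (S (k + M)) (cos th)) in *.
    set (q2 := rodrigues k (S (S (k + M))) (cos th)) in *. set (p := sin th ^ M).
    apply Rmult_eq_reg_r with (sin th); [|exact S0].
    assert (CS : cos th ^ 2 = 1 - sin th ^ 2).
    { replace (cos th ^ 2) with ((cos th)²) by (unfold Rsqr; ring).
      rewrite cos2. unfold Rsqr. ring. }
    rewrite CS in O.
    replace ((1 - sin th ^ 2 - 1) * q2) with (- (sin th ^ 2 * q2)) in O by ring.
    assert (O' : sin th ^ 2 * q2 = 2 * (INR M + 1) * (cos th * q1)
       - (INR k + INR M + 1) * (INR k - INR M) * q) by lra.
    transitivity (INR M * p * cos th ^ 2 * q - cos th * sin th ^ 2 * p * q1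
      + INR M * (INR M - 1) * p * cos th ^ 2 * q - INR M * p * q * sin th ^ 2
      - (2 * INR M + 1) * p * cos th * q1 * sin th ^ 2
      + p * sin th ^ 2 * (sin th ^ 2 * q2)
      + sin th ^ 2 * (INR k * (INR k + 1)) * p * q).
    + field. exact S0.
    + rewrite O', CS. field. exact S0.
  - apply Hpole, sin_0.
  - apply Hpole, sin_PI.
Qed.

Lemma profile_mulcos M k th : (2 * INR (S k) + 1) * (cos th * profile M (S k) th)
  = (INR (S k) - INR M + 1) * profile M (S (S k)) th + (INR (S k) + INR M) * profile M k th.
Proof.
  assert (E := rodrigues_rec k (k + M) (cos th)). unfold profile. simpl (_ + _)%nat.
  rewrite (S_INR (k + M)), plus_INR in E. rewrite (S_INR k) in *.
  replace (2 * (INR k + 1) - (INR k + INR M + 1) + 1) with (INR k + 1 - INR M + 1) in E by ring.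
  replace ((INR k + 1 - INR M + 1) * (sin th ^ M * rodrigues (S (S k)) (S (S (k + M))) (cos th)))
    with (sin th ^ M * ((INR k + 1 - INR M + 1) * rodrigues (S (S k)) (S (S (k + M))) (cos th))) by ring.
  rewrite E. ring.
Qed.

Lemma sgn_sqr m : m <> 0%Z -> IZR (Z.sgn m) ^ 2 = 1.
Proof. intros H. destruct m; simpl; [lia|ring|ring]. Qed.

Definition eigenvalue (k : nat) : R := INR k * (INR k + 1).

Lemma eigenvalue_neq0 k : (1 <= k)%nat -> eigenvalue k <> 0.
Proof.
  intros H. unfold eigenvalue. assert (0 < INR k) by (apply lt_0_INR; lia).
  apply Rmult_integral_contrapositive_currified; lra.
Qed.

Lemma two_INR_neq0 k : 2 * INR k + 1 <> 0.
Proof. generalize (pos_INR k). lra. Qed.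

(** Lower bounds on degrees keep [pred (pred k)] a true subtraction and exclude degree 0, where Lam
    has eigenvalue 0 and no inverse. *)
Definition degrees_ge (n : nat) (s : list (R * nat)) : Prop := List.Forall (fun p => (n <= snd p)%nat) s.

Lemma degrees_ge_weaken n n' t : (n' <= n)%nat -> degrees_ge n t -> degrees_ge n' t.
Proof. intros L H. eapply Forall_impl; [|exact H]. simpl. intros; lia. Qed.

Lemma degrees_ge_app n s t : degrees_ge n s -> degrees_ge n t -> degrees_ge n (s ++ t).
Proof. intros H K. now apply Forall_app. Qed.

Lemma degrees_ge_map n f s : degrees_ge n s -> degrees_ge n (map (fun p : R * nat => (f p, snd p)) s).
Proof. intros H. apply Forall_map. exact H. Qed.

(* Finite combinations of the profiles, as lists of (coefficient, degree). *)
Section Combinations.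
Variable m : Z.
Let M := Z.abs_nat m.

Fixpoint lin_comb (F : nat -> R -> R) (s : list (R * nat)) (th : R) : R :=
  match s with nil => 0 | (c, k) :: s => c * F k th + lin_comb F s th end.

Definition comb := lin_comb (profile M).
Definition comb' := lin_comb (profile' M).
Definition comb'' := lin_comb (profile'' M).

Definition comb_scal (c : R) (s : list (R * nat)) := map (fun p => (c * fst p, snd p)) s.
Definition comb_laplace (s : list (R * nat)) := map (fun p => (eigenvalue (snd p) * fst p, snd p)) s.
Definition comb_inv_laplace (s : list (R * nat)) := map (fun p => (/ eigenvalue (snd p) * fst p, snd p)) s.

(** The matrix of cos theta in the unnormalised profiles. It is not symmetric, but the diagonal
    coefficient wanted in the end involves only the products [up_coeff k * down_coeff (S k)], which
    no rescaling of the profiles changes. *)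
Definition up_coeff (k : nat) : R := (INR k - INR M + 1) / (2 * INR k + 1).
Definition down_coeff (k : nat) : R := (INR k + INR M) / (2 * INR k + 1).

Variable r : R.

(* Multiplication by w = r (5 cos^2 - 1). *)
Definition zonal_mul (s : list (R * nat)) : list (R * nat) :=
  flat_map (fun p => match p with (c, k) =>
    [(r * (5 * (up_coeff k * up_coeff (S k))) * c, S (S k));
     (r * (5 * (up_coeff k * down_coeff (S k) + down_coeff k * up_coeff (pred k)) - 1) * c, k);
     (r * (5 * (down_coeff k * down_coeff (pred k))) * c, pred (pred k))] end) s.

Lemma degrees_ge_zonal_mul n s : degrees_ge (S (S n)) s -> degrees_ge n (zonal_mul s).
Proof.
  induction 1 as [|[c k] s Hk Hs IH]; [constructor|]. simpl in Hk.
  change (zonal_mul ((c, k) :: s)) with ([(r * (5 * (up_coeff k * up_coeff (S k))) * c, S (S k));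
     (r * (5 * (up_coeff k * down_coeff (S k) + down_coeff k * up_coeff (pred k)) - 1) * c, k);
     (r * (5 * (down_coeff k * down_coeff (pred k))) * c, pred (pred k))] ++ zonal_mul s).
  apply degrees_ge_app; [|exact IH]. repeat constructor; simpl; lia.
Qed.

Lemma lin_comb_app F s t th : lin_comb F (s ++ t) th = lin_comb F s th + lin_comb F t th.
Proof. induction s as [|[c k] s IH]; simpl; [ring|]. rewrite IH. ring. Qed.

Lemma lin_comb_scal F c s th : lin_comb F (comb_scal c s) th = c * lin_comb F s th.
Proof. induction s as [|[d k] s IH]; simpl; [ring|]. rewrite IH. ring. Qed.

Lemma cos_mul_profile k th : (1 <= k)%nat -> cos th * profile M k th = up_coeff k * profile M (S k) th + down_coeff k * profile M (pred k) th.
Proof.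
  destruct k as [|k]; [lia|]. intros _. assert (E := profile_mulcos M k th).
  assert (N := two_INR_neq0 (S k)). unfold up_coeff, down_coeff. simpl pred.
  apply Rmult_eq_reg_l with (2 * INR (S k) + 1); [|exact N]. rewrite E. field. exact N.
Qed.

(** The recurrence for cos applied twice; degree at least 2 makes its second use at [pred k]
    legitimate. *)
Lemma comb_zonal_mul s th : degrees_ge 2 s -> comb (zonal_mul s) th = zonal_speed r th * comb s th.
Proof.
  induction 1 as [|[c k] s Hk Hs IH]; [unfold comb; simpl; ring|]. simpl in Hk.
  change (zonal_mul ((c, k) :: s)) with ([(r * (5 * (up_coeff k * up_coeff (S k))) * c, S (S k));
     (r * (5 * (up_coeff k * down_coeff (S k) + down_coeff k * up_coeff (pred k)) - 1) * c, k);
     (r * (5 * (down_coeff k * down_coeff (pred k))) * c, pred (pred k))] ++ zonal_mul s).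
  unfold comb in *. rewrite lin_comb_app, IH.
  assert (E1 := cos_mul_profile k th ltac:(lia)). assert (E2 := cos_mul_profile (S k) th ltac:(lia)).
  assert (E3 := cos_mul_profile (pred k) th ltac:(lia)).
  replace (S (pred k)) with k in E3 by lia. change (pred (S k)) with k in E2.
  simpl. unfold zonal_speed.
  assert (E : cos th ^ 2 * profile M k th
    = up_coeff k * (up_coeff (S k) * profile M (S (S k)) th + down_coeff (S k) * profile M k th)
      + down_coeff k * (up_coeff (pred k) * profile M k th + down_coeff (pred k) * profile M (pred (pred k)) th)).
  { rewrite <- E2, <- E3. transitivity (cos th * (cos th * profile M k th)); [ring|rewrite E1; ring]. }
  transitivity (r * c * (5 * (cos th ^ 2 * profile M k th) - profile M k th)
    + r * (5 * cos th ^ 2 - 1) * lin_comb (profile M) s th); [rewrite E; ring|ring].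
Qed.

Lemma comb_laplace_inv s th : degrees_ge 1 s -> comb (comb_laplace (comb_inv_laplace s)) th = comb s th.
Proof.
  induction 1 as [|[c k] s Hk Hs IH]; [reflexivity|]. simpl in Hk.
  unfold comb in *. simpl. rewrite IH. field. now apply eigenvalue_neq0.
Qed.

Lemma comb_laplace_scal c s th : comb (comb_laplace (comb_scal c s)) th = c * comb (comb_laplace s) th.
Proof. unfold comb. induction s as [|[d k] s IH]; simpl; [ring|]. rewrite IH. ring. Qed.

Lemma comb_derive s th : is_derive (comb s) th (comb' s th).
Proof.
  unfold comb, comb'. induction s as [|[c k] s IH]; simpl.
  - apply (is_derive_const (V := R_NormedModule)).
  - apply (is_derive_plus (fun t => c * profile M k t) (lin_comb (profile M) s)); [|exact IH].
    apply is_derive_scal, profile_derive.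
Qed.

Lemma comb_eigen_profile s : eigen_profile m (comb s) (comb' s) (comb'' s) (comb (comb_laplace s)).
Proof.
  unfold comb, comb', comb''. induction s as [|[c k] s [D1 D2 C2 Cb E P0 PP]].
  - constructor; simpl; intros; try ring; try apply continuous_const;
    try apply (is_derive_const (V := R_NormedModule)). unfold Rdiv. ring.
  - destruct (profile_eigen_profile m k) as [D1' D2' C2' Cb' E' P0' PP'].
    fold M in D1', D2', C2', Cb', E', P0', PP'.
    constructor; simpl.
    + intros th. apply (is_derive_plus (fun t => c * profile M k t) (lin_comb (profile M) s)); [|apply D1].
      now apply is_derive_scal.
    + intros th. apply (is_derive_plus (fun t => c * profile' M k t) (lin_comb (profile' M) s)); [|apply D2].
      now apply is_derive_scal.
    + intros th. apply (continuous_plus (fun t => c * profile'' M k t) (lin_comb (profile'' M) s)); [|apply C2].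
      apply (continuous_mult (K := R_AbsRing) (fun _ => c) (profile'' M k)); [apply continuous_const|apply C2'].
    + intros th. apply (continuous_plus (fun t => eigenvalue k * c * profile M k t) (lin_comb (profile M) (comb_laplace s))); [|apply Cb].
      apply (ex_derive_continuous (fun t => eigenvalue k * c * profile M k t)). apply ex_derive_scal.
      eexists. apply D1'.
    + intros th Hth. specialize (E th Hth). specialize (E' th Hth).
      transitivity (c * (IZR m ^ 2 * profile M k th / sin th) + IZR m ^ 2 * lin_comb (profile M) s th / sin th);
        [|simpl; unfold Rdiv; ring].
      rewrite <- E, <- E'. unfold eigenvalue. ring.
    + replace (IZR m * _) with (c * (IZR m * profile M k 0) + IZR m * lin_comb (profile M) s 0) by ring.
      rewrite P0, P0'. ring.
    + replace (IZR m * _) with (c * (IZR m * profile M k PI) + IZR m * lin_comb (profile M) s PI) by ring.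
      rewrite PP, PP'. ring.
Qed.

Lemma comb'_zonal_mul s th : degrees_ge 2 s -> comb' (zonal_mul s) th = zonal_speed' r th * comb s th + zonal_speed r th * comb' s th.
Proof.
  intros H. apply (derive_eq (comb (zonal_mul s)) (fun t => zonal_speed r t * comb s t) _ _ th).
  - intros y. now apply comb_zonal_mul.
  - apply comb_derive.
  - apply (is_derive_mult (zonal_speed r) (comb s)); [apply zonal_speed_derive|apply comb_derive|exact Rmult_comm].
Qed.

(* Real and imaginary parts of (x + i sg y)^M. *)
Fixpoint azimuth_pol (M : nat) (sg : R) : pol * pol :=
  match M with
  | O => (PC 1, PC 0)
  | S M => let (p, q) := azimuth_pol M sg in
     (PA (PM (PX 0) p) (PM (PC (- sg)) (PM (PX 1) q)),
      PA (PM (PX 0) q) (PM (PC sg) (PM (PX 1) p)))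
  end.

(** De Moivre's formula; the alternative [n = 0] serves m = 0, where the sign supplied is 0. *)
Lemma azimuth_pol_eval n sg th ph : sg ^ 2 = 1 \/ n = 0%nat ->
  pol_eval (fst (azimuth_pol n sg)) (sph th ph) = sin th ^ n * cos (INR n * sg * ph) /\
  pol_eval (snd (azimuth_pol n sg)) (sph th ph) = sin th ^ n * sin (INR n * sg * ph).
Proof.
  intros H. induction n as [|n IH].
  - simpl. rewrite !Rmult_0_l, cos_0, sin_0. lra.
  - destruct H as [H|H]; [|lia]. destruct (IH (or_introl H)) as [I1 I2]. clear IH.
    assert (Hs : cos (sg * ph) = cos ph /\ sin (sg * ph) = sg * sin ph).
    { assert (D : sg = 1 \/ sg = -1).
      { assert (F : (sg - 1) * (sg + 1) = 0) by (simpl in H; lra).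
        apply Rmult_integral in F. lra. }
      destruct D as [-> | ->]; [now rewrite !Rmult_1_l|].
      replace (-1 * ph) with (- ph) by ring. rewrite cos_neg, sin_neg. lra. }
    destruct Hs as [Hc Hs]. rewrite S_INR.
    replace ((INR n + 1) * sg * ph) with (INR n * sg * ph + sg * ph) by ring.
    rewrite cos_plus, sin_plus, Hc, Hs.
    simpl azimuth_pol. destruct (azimuth_pol n sg) as [p q]. simpl fst in *. simpl snd in *.
    unfold sph in *. simpl pol_eval. rewrite I1, I2. simpl. split; ring.
Qed.

Fixpoint comb_pol (s : list (R * nat)) : pol :=
  match s with nil => PC 0 | (c, k) :: s => PA (PM (PC c) (rodrigues_pol k (k + M))) (comb_pol s) end.

Lemma comb_pol_eval s th ph : sin th ^ M * pol_eval (comb_pol s) (sph th ph) = comb s th.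
Proof.
  unfold comb. induction s as [|[c k] s IH]; simpl; [ring|]. rewrite <- IH.
  unfold sph at 1. rewrite zonly_pol_eval by apply rodrigues_pol_zonly. unfold profile, rodrigues. ring.
Qed.

(** The common factor sin^M of the profiles is absorbed by e^(i m phi) into (x + i sgn(m) y)^M,
    leaving a polynomial in z. Every combination thereby becomes an admissible candidate for B. *)
Lemma comb_sdiff_on_chart kap s : sdiff_on_chart (mode_field m kap (comb s) (comb' s)).
Proof.
  set (p := fst (azimuth_pol M (IZR (Z.sgn m)))). set (q := snd (azimuth_pol M (IZR (Z.sgn m)))).
  set (F := fun v => Cmult kap (Cmult (RtoC (pol_eval (comb_pol s) v)) (pol_eval p v, pol_eval q v)) : C).
  assert (HF : forall th ph, F (sph th ph) = Cmult kap (Cmult (RtoC (comb s th)) (expi m ph))).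
  { intros th ph. unfold F.
    destruct (azimuth_pol_eval M (IZR (Z.sgn m)) th ph) as [I1 I2].
    { destruct (Z.eq_dec m 0) as [Hm|Hm]; [right; unfold M; lia|left; now apply sgn_sqr]. }
    fold p in I1. fold q in I2. rewrite I1, I2, <- (comb_pol_eval s th ph).
    replace (INR M * IZR (Z.sgn m)) with (IZR m).
    - unfold expi. C_components; ring.
    - rewrite INR_IZR_INZ, <- mult_IZR. f_equal. unfold M. lia. }
  exists (sgrad (fun th ph => F (sph th ph))). split.
  - exists F. split; [|reflexivity]. split.
    + apply smooth3R_ext with (fun v => fst kap * pol_eval (PM (comb_pol s) p) v + (- snd kap) * pol_eval (PM (comb_pol s) q) v).
      * apply smooth3R_lin; apply pol_eval_smooth.
      * intros v. unfold F. simpl. ring.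
    + apply smooth3R_ext with (fun v => fst kap * pol_eval (PM (comb_pol s) q) v + snd kap * pol_eval (PM (comb_pol s) p) v).
      * apply smooth3R_lin; apply pol_eval_smooth.
      * intros v. unfold F. simpl. ring.
  - intros th ph Hr. rewrite <- (sgrad_mode_field m kap (comb s) (comb' s) (comb_derive s)).
    apply sgrad_ext; trivial.
Qed.

Lemma eigen_profile_ext a a1 a2 b b' : (forall th, b th = b' th) -> eigen_profile m a a1 a2 b -> eigen_profile m a a1 a2 b'.
Proof.
  intros E [D1 D2 C2 Cb Eq P0 PP]. constructor; trivial.
  - intros th. apply continuous_ext with b; trivial.
  - intros th Hth. rewrite <- E. now apply Eq.
Qed.

(* Up to the factor i m / 2: nabla_u for eps = 1, and nabla of u along the field for eps = -1. *)
Definition nabla_comb (eps : R) (s : list (R * nat)) : list (R * nat) :=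
  comb_scal eps (zonal_mul s) ++ comb_scal (-12) (comb_inv_laplace (zonal_mul s)) ++ comb_inv_laplace (zonal_mul (comb_laplace s)).

Lemma degrees_ge_laplace n s : degrees_ge n s -> degrees_ge n (comb_laplace s).
Proof. apply (degrees_ge_map n (fun p => eigenvalue (snd p) * fst p)). Qed.

Lemma degrees_ge_nabla_comb n eps s : degrees_ge (S (S n)) s -> degrees_ge n (nabla_comb eps s).
Proof.
  intros H. apply degrees_ge_app; [|apply degrees_ge_app].
  - apply (degrees_ge_map n (fun p => eps * fst p)). now apply degrees_ge_zonal_mul.
  - apply (degrees_ge_map n (fun p => -12 * fst p)), (degrees_ge_map n (fun p => / eigenvalue (snd p) * fst p)).
    now apply degrees_ge_zonal_mul.
  - apply (degrees_ge_map n (fun p => / eigenvalue (snd p) * fst p)). now apply degrees_ge_zonal_mul, degrees_ge_laplace.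
Qed.

Section NablaLists.
Variables (kap : C) (s : list (R * nat)) (X Y : vf).
Hypotheses (EX : chart_eq X (zonal_field r)) (EY : chart_eq Y (mode_field m kap (comb s) (comb' s))) (Hs : degrees_ge 3 s).

Let g := comb_scal 12 (comb_inv_laplace (zonal_mul s)).
Let g' := comb_inv_laplace (zonal_mul (comb_laplace s)).

Lemma g_eigen_profile : eigen_profile m (comb g) (comb' g) (comb'' g) (fun th => 12 * zonal_speed r th * comb s th).
Proof.
  apply eigen_profile_ext with (comb (comb_laplace g)); [|apply comb_eigen_profile]. intros th. unfold g.
  rewrite comb_laplace_scal, comb_laplace_inv, comb_zonal_mul.
  - ring.
  - now apply degrees_ge_weaken with 3%nat; [lia|].
  - now apply degrees_ge_zonal_mul.
Qed.

Lemma g'_eigen_profile : eigen_profile m (comb g') (comb' g') (comb'' g') (fun th => zonal_speed r th * comb (comb_laplace s) th).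
Proof.
  apply eigen_profile_ext with (comb (comb_laplace g')); [|apply comb_eigen_profile]. intros th. unfold g'.
  rewrite comb_laplace_inv, comb_zonal_mul.
  - ring.
  - apply degrees_ge_laplace. now apply degrees_ge_weaken with 3%nat; [lia|].
  - now apply degrees_ge_zonal_mul, degrees_ge_laplace.
Qed.

Lemma nabla_zonal_comb : chart_eq (nabla X Y) (mode_field m (half_im m kap) (comb (nabla_comb 1 s)) (comb' (nabla_comb 1 s))).
Proof.
  assert (H2 : degrees_ge 2 s) by (now apply degrees_ge_weaken with 3%nat; [lia|]).
  eapply chart_eq_trans.
  - apply (nabla_zonal_mode r m kap (comb s) (comb' s) (comb'' s) (comb (comb_laplace s)) _ _ _ _ _ _ X Y EX EY
      (comb_eigen_profile s) g_eigen_profile g'_eigen_profile (comb_sdiff_on_chart _ _) (comb_sdiff_on_chart _ _)).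
  - apply mode_field_ext; trivial; intros th; unfold g, g', nabla_comb; unfold comb, comb';
    rewrite !lin_comb_app, !lin_comb_scal; fold comb; fold comb'.
    + rewrite (comb_zonal_mul s th H2). fold comb. ring.
    + rewrite (comb'_zonal_mul s th H2). fold comb'. ring.
Qed.

Lemma nabla_comb_zonal : chart_eq (nabla Y X) (mode_field m (half_im m kap) (comb (nabla_comb (-1) s)) (comb' (nabla_comb (-1) s))).
Proof.
  assert (H2 : degrees_ge 2 s) by (now apply degrees_ge_weaken with 3%nat; [lia|]).
  eapply chart_eq_trans.
  - apply (nabla_mode_zonal r m kap (comb s) (comb' s) (comb'' s) (comb (comb_laplace s)) _ _ _ _ _ _ X Y EX EY
      (comb_eigen_profile s) g_eigen_profile g'_eigen_profile (comb_sdiff_on_chart _ _) (comb_sdiff_on_chart _ _)).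
  - apply mode_field_ext; trivial; intros th; unfold g, g', nabla_comb; unfold comb, comb';
    rewrite !lin_comb_app, !lin_comb_scal; fold comb; fold comb'.
    + rewrite (comb_zonal_mul s th H2). fold comb. ring.
    + rewrite (comb'_zonal_mul s th H2). fold comb'. ring.
Qed.

End NablaLists.

(** - nabla_u nabla_e u carries -(i m / 2)^2 = m^2 / 4, and nabla_[u,e] u carries i m times i m / 2,
    that is - m^2 / 2; the remaining term of R(u, e)u contains nabla_u u = 0. *)
Definition curv_comb (s : list (R * nat)) : list (R * nat) :=
  comb_scal (INR M ^ 2 / 4) (nabla_comb 1 (nabla_comb (-1) s)) ++ comb_scal (- (INR M ^ 2 / 2)) (nabla_comb (-1) (zonal_mul s)).

(** Each connection formula asks for degree at least 3 and lowers the degree by at most 2; two of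
    them are chained, hence the bound 5. *)
Lemma Rcurv_comb kap s X Y : chart_eq X (zonal_field r) -> chart_eq Y (mode_field m kap (comb s) (comb' s)) -> degrees_ge 5 s ->
  chart_eq (Rcurv X Y X) (mode_field m kap (comb (curv_comb s)) (comb' (curv_comb s))).
Proof.
  intros EX EY Hs th ph Hr.
  assert (H3 : degrees_ge 3 s) by (now apply degrees_ge_weaken with 5%nat; [lia|]).
  assert (N1 := nabla_comb_zonal kap s X Y EX EY H3).
  assert (profile_norm2 := nabla_zonal_comb _ _ X _ EX N1 (degrees_ge_nabla_comb 3 _ _ Hs)).
  assert (EB : chart_eq (bracket X Y) (mode_field m (Cmult kap (im m)) (comb (zonal_mul s)) (comb' (zonal_mul s)))).
  { assert (H2 : degrees_ge 2 s) by (now apply degrees_ge_weaken with 5%nat; [lia|]).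
    eapply chart_eq_trans; [apply (bracket_zonal_mode r m kap (comb s) (comb' s) X Y EX EY)|].
    apply mode_field_ext; trivial; intros t; [now rewrite comb_zonal_mul|now rewrite comb'_zonal_mul]. }
  assert (N3 := nabla_comb_zonal _ _ X _ EX EB (degrees_ge_zonal_mul 3 _ Hs)).
  assert (N4 := nabla_zero_r Y (nabla X X) (nabla_zonal_zonal r X EX)).
  unfold Rcurv, vopp, vadd, vscal. rewrite (profile_norm2 th ph Hr), (N3 th ph Hr), (N4 th ph Hr).
  assert (S0 := sin_neq0 th (proj1 Hr)).
  unfold curv_comb, mode_field, half_im, im, vzero, comb, comb'. rewrite !lin_comb_app, !lin_comb_scal.
  unfold M. rewrite <- abs_nat_sqr. fold M.
  set (e := expi m ph). simpl fst. simpl snd. f_equal; C_components; field; exact S0.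
Qed.

(** The phases cancel after conjugation, so the phi-integral contributes 2 pi and [green] with K = a
    does the rest. *)
Lemma herm_mode_field kap kap' a a1 a2 b g g1 g2 bg X Y : chart_eq X (mode_field m kap a a1) -> chart_eq Y (mode_field m kap' g g1) ->
  eigen_profile m a a1 a2 b -> eigen_profile m g g1 g2 bg ->
  herm X Y = Cmult (Cmult kap (Cconj kap')) (RtoC (2 * PI * RInt (fun th => sin th * (bg th * a th)) 0 PI)).
Proof.
  intros EX EY Pa Pg. unfold herm. rewrite (pairb_chart_eq _ _ _ _ EX (vconj_chart_eq _ _ EY)).
  assert (Ca1 : forall th, continuousC (fun t => RtoC (a1 t)) th).
  { intros th. apply continuousC_RtoC, (ex_derive_continuous a1). eexists. apply (eigen_profile_d2 _ _ _ _ _ Pa). }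
  assert (I := green m g g1 g2 bg (fun t => RtoC (a t)) (fun t => RtoC (a1 t)) _ Pg
    (fun th => is_Cderive_RtoC a th _ (eigen_profile_d1 _ _ _ _ _ Pa th)) Ca1 (fun th _ => eq_refl)).
  apply (pairb_val _ _ (fun th => Cmult (Cmult (RtoC (2 * PI)) (Cmult kap (Cconj kap')))
    (Cplus (Cmult (RtoC (IZR m ^ 2 * g th / sin th)) (RtoC (a th)))
           (Cmult (RtoC (sin th * g1 th)) (RtoC (a1 th)))))).
  - intros th Hth. assert (S0 := sin_neq0 th Hth).
    eapply is_CInt_eq; [eapply is_CInt_ext; [exact PI2_ge0| |
      exact (is_CInt_const (Cmult (Cmult kap (Cconj kap')) (Cplus (Cmult (RtoC (IZR m ^ 2 * g th / sin th)) (RtoC (a th)))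
           (Cmult (RtoC (sin th * g1 th)) (RtoC (a1 th))))) 0 (2 * PI))]|].
    + intros ph _. unfold pair_density, mode_field, vconj.
      assert (E1 : Cmult (expi m ph) (Cconj (expi m ph)) = RtoC 1).
      { unfold expi. C_components; [|ring].
        generalize (sin2_cos2 (IZR m * ph)). unfold Rsqr. lra. }
      transitivity (Cmult (Cmult (Cmult kap (Cconj kap')) (Cmult (expi m ph) (Cconj (expi m ph))))
        (Cplus (Cmult (RtoC (IZR m ^ 2 * g th / sin th)) (RtoC (a th)))
           (Cmult (RtoC (sin th * g1 th)) (RtoC (a1 th))))).
      * rewrite E1, Cmult_1_r. reflexivity.
      * unfold im. generalize (expi m ph). intros e. C_components; field; exact S0.
    + rewrite Rminus_0_r. ring.
  - eapply is_CInt_eq; [exact (is_CInt_scal _ _ _ _ _ I)|].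
    unfold CInt. simpl.
    rewrite (RInt_ext _ (fun th => sin th * (bg th * a th))) by (intros; simpl; ring).
    rewrite (RInt_ext (fun t => _ + _) (fun th => 0)) by (intros; simpl; ring).
    rewrite RInt_const. unfold scal; simpl; unfold mult; simpl.
    C_components; ring.
Qed.

End Combinations.

(** * The curvature as a matrix coefficient *)

(** A degree may occur several times in a list, hence a sum over occurrences. *)
Fixpoint coeff (l : nat) (s : list (R * nat)) : R :=
  match s with nil => 0 | (c, k) :: s => (if Nat.eq_dec k l then c else 0) + coeff l s end.

Lemma coeff_app l s t : coeff l (s ++ t) = coeff l s + coeff l t.
Proof. induction s as [|[c k] s IH]; simpl; [ring|]. rewrite IH. ring. Qed.

Lemma coeff_comb_scal l c s : coeff l (comb_scal c s) = c * coeff l s.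
Proof. induction s as [|[d k] s IH]; simpl; [ring|]. rewrite IH. destruct Nat.eq_dec; ring. Qed.

Lemma coeff_comb_laplace l s : coeff l (comb_laplace s) = eigenvalue l * coeff l s.
Proof.
  induction s as [|[d k] s IH]; simpl; [ring|]. rewrite IH. destruct Nat.eq_dec as [->|]; ring.
Qed.

Lemma coeff_comb_inv_laplace l s : coeff l (comb_inv_laplace s) = coeff l s / eigenvalue l.
Proof.
  unfold Rdiv. induction s as [|[d k] s IH]; simpl; [ring|]. rewrite IH.
  destruct Nat.eq_dec as [->|]; ring.
Qed.

Lemma coeff_zonal_mul m r j s : degrees_ge 2 s ->
  coeff (S (S j)) (zonal_mul m r s)
  = r * (5 * (up_coeff m j * up_coeff m (S j))) * coeff j s
    + r * (5 * (up_coeff m (S (S j)) * down_coeff m (S (S (S j))) + down_coeff m (S (S j)) * up_coeff m (S j)) - 1) * coeff (S (S j)) s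
    + r * (5 * (down_coeff m (S (S (S (S j)))) * down_coeff m (S (S (S j))))) * coeff (S (S (S (S j)))) s.
Proof.
  induction 1 as [|[c k] s Hk Hs IH]; [simpl; ring|]. simpl in Hk.
  change (zonal_mul m r ((c, k) :: s)) with ((r * (5 * (up_coeff m k * up_coeff m (S k))) * c, S (S k))
    :: (r * (5 * (up_coeff m k * down_coeff m (S k) + down_coeff m k * up_coeff m (pred k)) - 1) * c, k)
    :: (r * (5 * (down_coeff m k * down_coeff m (pred k))) * c, pred (pred k)) :: zonal_mul m r s).
  cbn [coeff]. rewrite IH.
  destruct (Nat.eq_dec (S (S k)) (S (S j))) as [E1|E1];
  destruct (Nat.eq_dec k (S (S j))) as [E2|E2];
  destruct (Nat.eq_dec (pred (pred k)) (S (S j))) as [E3|E3];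
  destruct (Nat.eq_dec k j) as [F1|F1];
  destruct (Nat.eq_dec k (S (S (S (S j))))) as [F3|F3]; try (exfalso; lia);
  try subst k; simpl pred; ring.
Qed.

Lemma coeff_nabla_comb m r eps l s : coeff l (nabla_comb m r eps s)
  = (eps - 12 / eigenvalue l) * coeff l (zonal_mul m r s) + coeff l (zonal_mul m r (comb_laplace s)) / eigenvalue l.
Proof.
  unfold nabla_comb. rewrite !coeff_app, !coeff_comb_scal, !coeff_comb_inv_laplace. unfold Rdiv. ring.
Qed.

(* a and b are the eigenvalues of the degree l and of the intermediate degree. *)
Definition path_weight (a b : R) : R := (-1 + (a - 12) / b) * (1 + (b - 12) / a) - 2 * (-1 + (b - 12) / a).

Lemma coeff_single l k : k <> l -> coeff k [(1, l)] = 0.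
Proof. intros H. simpl. destruct Nat.eq_dec; [congruence|ring]. Qed.

Lemma coeff_single_eq l : coeff l [(1, l)] = 1.
Proof. simpl. destruct Nat.eq_dec; [ring|congruence]. Qed.

(* The degree l component of R(u, e)u for e of degree l = j + 4: the three terms are the
   paths l -> l + 2 -> l, l -> l -> l and l -> l - 2 -> l. *)
Lemma coeff_curv_comb m r j : let l := S (S (S (S j))) in (2 <= j)%nat ->
  coeff l (curv_comb m r [(1, l)]) = (INR (Z.abs_nat m) ^ 2 / 4) * r ^ 2 *
   (25 * (up_coeff m l * up_coeff m (S l) * down_coeff m (S (S l)) * down_coeff m (S l)) * path_weight (eigenvalue l) (eigenvalue (S (S l)))
    + (5 * (up_coeff m l * down_coeff m (S l) + down_coeff m l * up_coeff m (pred l)) - 1) ^ 2 * path_weight (eigenvalue l) (eigenvalue l)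
    + 25 * (down_coeff m l * down_coeff m (pred l) * up_coeff m (pred (pred l)) * up_coeff m (pred l)) * path_weight (eigenvalue l) (eigenvalue (pred (pred l)))).
Proof.
  intros l Hj. assert (H6 : degrees_ge 6 [(1, l)]) by (constructor; [simpl; unfold l; lia|constructor]).
  assert (H2 : degrees_ge 2 [(1, l)]) by (apply degrees_ge_weaken with 6%nat; [lia|exact H6]).
  assert (H4 : degrees_ge 4 (nabla_comb m r (-1) [(1, l)])) by now apply degrees_ge_nabla_comb.
  assert (H4' : degrees_ge 2 (nabla_comb m r (-1) [(1, l)])) by (apply degrees_ge_weaken with 4%nat; [lia|exact H4]).
  assert (GW : degrees_ge 2 (zonal_mul m r [(1, l)])) by (apply degrees_ge_weaken with 4%nat; [lia|now apply degrees_ge_zonal_mul]).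
  destruct j as [|[|j]]; try lia. clear Hj.
  assert (L0 := eigenvalue_neq0 (S (S (S (S (S (S j)))))) ltac:(lia)).
  assert (L1 := eigenvalue_neq0 (S (S (S (S j)))) ltac:(lia)).
  assert (L2 := eigenvalue_neq0 (S (S (S (S (S (S (S (S j)))))))) ltac:(lia)).
  (* With a, b as in [path_weight]: the factor -1 + (a - 12) / b is nabla_e u on the way out, 1 + (b
     - 12) / a is nabla_u on the way back, and the subtracted term with factor 2 is nabla_[u,e]
     u. *)
  unfold curv_comb. rewrite coeff_app, !coeff_comb_scal, !coeff_nabla_comb. unfold l in *.
  repeat (rewrite coeff_zonal_mul by (repeat apply degrees_ge_laplace; assumption); rewrite ?coeff_comb_laplace, ?coeff_nabla_comb).
  rewrite !coeff_single_eq. rewrite !coeff_single by lia. simpl pred.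
  unfold path_weight. unfold Rdiv. field. repeat split; assumption.
Qed.

(** * Orthogonality and nonvanishing of the profiles *)

Lemma selfadjoint m a a1 a2 b g g1 g2 bg : eigen_profile m a a1 a2 b -> eigen_profile m g g1 g2 bg ->
  RInt (fun th => sin th * (bg th * a th)) 0 PI = RInt (fun th => sin th * (b th * g th)) 0 PI.
Proof.
  intros Pa Pg.
  assert (C : forall f f1 f2 bf, eigen_profile m f f1 f2 bf -> forall th, continuousC (fun t => RtoC (f1 t)) th).
  { intros f f1 f2 bf P th. apply continuousC_RtoC, (ex_derive_continuous f1). eexists.
    apply (eigen_profile_d2 _ _ _ _ _ P). }
  (* The density of the Dirichlet form, symmetric in a and g; [green] evaluates its integral in two
     ways. *)
  set (K := fun th => Cplus (Cmult (RtoC (IZR m ^ 2 * g th / sin th)) (RtoC (a th)))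
                            (Cmult (RtoC (sin th * g1 th)) (RtoC (a1 th)))).
  assert (I := green m g g1 g2 bg (fun t => RtoC (a t)) (fun t => RtoC (a1 t)) K Pg
    (fun th => is_Cderive_RtoC a th _ (eigen_profile_d1 _ _ _ _ _ Pa th)) (C _ _ _ _ Pa) (fun th _ => eq_refl)).
  assert (J := green m a a1 a2 b (fun t => RtoC (g t)) (fun t => RtoC (g1 t)) K Pa
    (fun th => is_Cderive_RtoC g th _ (eigen_profile_d1 _ _ _ _ _ Pg th)) (C _ _ _ _ Pg)
    (fun th _ => ltac:(unfold K; C_components; unfold Rdiv; ring))).
  apply is_CInt_unique in I. apply is_CInt_unique in J. rewrite J in I.
  apply (f_equal fst) in I. simpl in I.
  rewrite (RInt_ext (fun th => sin th * (bg th * a th)) (fun t => sin t * bg t * a t - 0 * 0))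
    by (intros; simpl; ring).
  rewrite <- I. apply RInt_ext. intros; simpl; ring.
Qed.

Lemma profile_cont M k (th : R) : continuous (profile M k) th.
Proof. apply (ex_derive_continuous (profile M k)). eexists. apply profile_derive. Qed.

(** Left unevaluated: it is a common factor of numerator and denominator of [sec], so nonvanishing
    suffices. *)
Definition profile_norm2 (M l : nat) : R := RInt (fun th => sin th * (profile M l th * profile M l th)) 0 PI.

Lemma profile_mult_cont M k l (th : R) : continuous (fun th => sin th * (profile M l th * profile M k th)) th.
Proof.
  apply (continuous_mult (K := R_AbsRing) sin (fun th => profile M l th * profile M k th)).
  - apply (ex_derive_continuous sin). auto_derive; trivial.
  - apply (continuous_mult (K := R_AbsRing) (profile M l) (profile M k)); apply profile_cont.
Qed.

Lemma eigenvalue_inj k l : eigenvalue k = eigenvalue l -> k = l.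
Proof.
  unfold eigenvalue. intros H. apply INR_eq. assert (Hk := pos_INR k). assert (Hl := pos_INR l).
  assert (E : (INR k - INR l) * (INR k + INR l + 1) = 0) by lra.
  apply Rmult_integral in E. lra.
Qed.

(** Eigenfunctions of a symmetric operator for distinct eigenvalues. *)
Lemma profile_orth m k l : k <> l ->
  RInt (fun th => sin th * (profile (Z.abs_nat m) l th * profile (Z.abs_nat m) k th)) 0 PI = 0.
Proof.
  intros H. set (M := Z.abs_nat m).
  assert (E := selfadjoint m _ _ _ _ _ _ _ _ (profile_eigen_profile m k) (profile_eigen_profile m l)). simpl in E. fold M in E.
  fold (eigenvalue l) in E. fold (eigenvalue k) in E.
  assert (ex : ex_RInt (fun th => sin th * (profile M l th * profile M k th)) 0 PI).
  { apply (ex_RInt_continuous (V := R_CompleteNormedModule)). intros; apply profile_mult_cont. }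
  assert (Sl := RInt_scal (V := R_CompleteNormedModule) _ 0 PI (eigenvalue l) ex).
  assert (Sk := RInt_scal (V := R_CompleteNormedModule) _ 0 PI (eigenvalue k) ex).
  rewrite (RInt_ext _ (fun th => eigenvalue l * (sin th * (profile M l th * profile M k th)))) in E
    by (intros; simpl; ring).
  rewrite (RInt_ext (fun th => sin th * (eigenvalue k * profile M k th * profile M l th))
    (fun th => eigenvalue k * (sin th * (profile M l th * profile M k th)))) in E
    by (intros; simpl; ring).
  unfold scal in Sl, Sk; simpl in Sl, Sk; unfold mult in Sl, Sk; simpl in Sl, Sk.
  rewrite Sl, Sk in E.
  assert (E' : (eigenvalue l - eigenvalue k) * RInt (fun th => sin th * (profile M l th * profile M k th)) 0 PI = 0) by lra.
  apply Rmult_integral in E'. destruct E' as [E'|E']; [|exact E'].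
  exfalso. apply H. symmetry. apply eigenvalue_inj. lra.
Qed.

Lemma RInt_profile_comb m l s :
  RInt (fun th => sin th * (eigenvalue l * profile (Z.abs_nat m) l th * comb m s th)) 0 PI
  = eigenvalue l * (coeff l s * profile_norm2 (Z.abs_nat m) l).
Proof.
  set (M := Z.abs_nat m).
  assert (I : is_RInt (fun th => sin th * (profile M l th * comb m s th)) 0 PI (coeff l s * profile_norm2 M l)).
  { induction s as [|[c k] s IH].
    - simpl. apply is_RInt_ext with (fun _ => 0); [intros; unfold comb; simpl; ring|].
      rewrite Rmult_0_l. assert (C := is_RInt_const (V := R_NormedModule) 0 PI 0).
      unfold scal in C; simpl in C; unfold mult in C; simpl in C. now rewrite Rmult_0_r in C.
    - assert (J : is_RInt (fun th => sin th * (profile M l th * profile M k th)) 0 PI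
         ((if Nat.eq_dec k l then 1 else 0) * profile_norm2 M l)).
      { assert (ex : ex_RInt (fun th => sin th * (profile M l th * profile M k th)) 0 PI).
        { apply (ex_RInt_continuous (V := R_CompleteNormedModule)). intros; apply profile_mult_cont. }
        apply (RInt_correct (V := R_CompleteNormedModule)) in ex.
        destruct Nat.eq_dec as [->|n].
        - rewrite Rmult_1_l. exact ex.
        - rewrite Rmult_0_l. assert (Z := profile_orth m k l n). fold M in Z. rewrite Z in ex. exact ex. }
      assert (P := is_RInt_plus _ _ _ _ _ _ (is_RInt_scal _ _ _ c _ J) IH).
      replace (coeff l ((c, k) :: s) * profile_norm2 M l)
        with (plus (scal c ((if Nat.eq_dec k l then 1 else 0) * profile_norm2 M l)) (coeff l s * profile_norm2 M l)).
      + eapply is_RInt_ext; [|exact P]. intros th _.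
        unfold plus, scal; simpl; unfold mult; simpl. unfold comb; simpl. fold M. ring.
      + unfold plus, scal; simpl; unfold mult; simpl. destruct Nat.eq_dec; ring. }
  assert (J := is_RInt_scal _ _ _ (eigenvalue l) _ I).
  apply is_RInt_unique. eapply is_RInt_ext; [|exact J]. intros th _.
  unfold scal; simpl; unfold mult; simpl. ring.
Qed.

(** A zero integral forces the derivative of index l + M to vanish on (-1, 1), hence all later ones,
    among them that of index 2 l, a nonzero constant. *)
Lemma profile_norm2_neq0 M l : (M <= l)%nat -> profile_norm2 M l <> 0.
Proof.
  intros HM H.
  assert (Z : forall th, 0 < th < PI -> sin th * (profile M l th * profile M l th) = 0).
  { apply RInt_zero_nonneg; [intros; apply profile_mult_cont| |exact H].
    intros th Hth. apply Rmult_le_pos; [apply Rlt_le, sin_gt_0; apply Hth|].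
    apply (Rle_0_sqr (profile M l th)). }
  assert (Z0 : forall x, -1 < x < 1 -> rodrigues l (l + M) x = 0).
  { intros x Hx. assert (Hb := acos_bound_lt x Hx). assert (S0 := sin_neq0 _ Hb).
    specialize (Z _ Hb). apply Rmult_integral in Z. destruct Z as [Z|Z]; [contradiction|].
    assert (Z' : profile M l (acos x) = 0) by (apply Rmult_integral in Z; tauto).
    unfold profile in Z'. rewrite cos_acos in Z' by lra.
    apply Rmult_integral in Z'. destruct Z' as [Z'|Z']; [|exact Z'].
    now apply pow_nonzero with (n := M) in S0. }
  assert (Zn : forall n x, -1 < x < 1 -> rodrigues l (l + M + n) x = 0).
  { induction n as [|n IH]; intros x Hx; [rewrite Nat.add_0_r; now apply Z0|].
    rewrite Nat.add_succ_r. rewrite <- (is_derive_unique _ _ _ (rodrigues_derive l (l + M + n) x)).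
    rewrite (Derive_ext_loc _ (fun _ => 0)); [apply Derive_const|].
    eapply filter_imp; [|exact (locally_Ioo _ _ _ Hx)]. intros t Ht. now apply IH. }
  specialize (Zn (l - M)%nat 0 ltac:(lra)). replace (l + M + (l - M))%nat with (2 * l)%nat in Zn by lia.
  destruct (rodrigues_top l 0) as [T _]. rewrite T in Zn.
  assert (F1 := INR_fact_neq_0 (2 * l)). assert (F2 := fact_pow_neq0 l).
  apply Rmult_integral in Zn. destruct Zn as [Zn|Zn]; [contradiction|].
  now apply Rinv_neq_0_compat in F2.
Qed.

(** * The fields e^m_l as Fourier modes *)

Lemma Derive_n_rodrigues l n x : Derive_n (fun x => (x ^ 2 - 1) ^ l) n x = 2 ^ l * INR (fact l) * rodrigues l n x.
Proof.
  revert x. induction n as [|n IH]; intros x.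
  - change (Derive_n (fun x => (x ^ 2 - 1) ^ l) 0 x) with ((x ^ 2 - 1) ^ l). rewrite rodrigues_0.
    assert (F := fact_pow_neq0 l). set (d := 2 ^ l * INR (fact l)) in *. field. exact F.
  - simpl Derive_n. rewrite (Derive_ext _ _ _ IH).
    apply is_derive_unique, is_derive_scal, rodrigues_derive.
Qed.

(** For m < 0 the power of sin is negative; [rodrigues_reflect] supplies (x^2 - 1)^M, which at x =
    cos theta is (-1)^M sin^(2 M) and restores sin^M. *)
Lemma Plm_profile l m : (Z.abs m <= Z.of_nat l)%Z ->
  exists c, c <> 0 /\ forall th, 0 < th < PI -> Plm l m (cos th) = c * profile (Z.abs_nat m) l th.
Proof.
  intros Hm.
  assert (Hs : forall th, 0 < th < PI -> sqrt (1 - cos th ^ 2) = sin th).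
  { intros th Hth. replace (1 - cos th ^ 2) with ((sin th)²).
    - apply sqrt_Rsqr. apply Rlt_le, sin_gt_0; apply Hth.
    - rewrite sin2. unfold Rsqr. ring. }
  assert (Hf := fact_pow_neq0 l).
  set (M := Z.abs_nat m). destruct (Z_le_gt_dec 0 m) as [H0|H0].
  - exists 1. split; [lra|]. intros th Hth. unfold Plm. rewrite Hs, Derive_n_rodrigues by assumption.
    replace (Z.to_nat (Z.of_nat l + m)) with (l + M)%nat by (unfold M; lia).
    replace m with (Z.of_nat M) at 1 by (unfold M; lia). rewrite <- pow_powerRZ.
    unfold profile. field. split; [apply INR_fact_neq_0|apply pow_nonzero; lra].
  - set (j := (l - M)%nat).
    assert (El : l = (M + j)%nat) by (unfold j, M; lia).
    exists (INR (fact j) / INR (fact (2 * M + j)) * (-1) ^ M). split.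
    + apply Rmult_integral_contrapositive_currified; [|apply pow_nonzero; lra].
      apply Rmult_integral_contrapositive_currified; [|apply Rinv_neq_0_compat]; apply INR_fact_neq_0.
    + intros th Hth. assert (S0 := sin_neq0 th Hth).
      unfold Plm. rewrite Hs, Derive_n_rodrigues by assumption.
      replace (Z.to_nat (Z.of_nat l + m)) with j by (unfold j, M; lia).
      replace m with (- Z.of_nat M)%Z at 1 by (unfold M; lia).
      rewrite powerRZ_neg' , <- pow_powerRZ.
      assert (R0 := rodrigues_reflect M j (cos th)). rewrite <- El in R0.
      assert (F2 := INR_fact_neq_0 (2 * M + j)).
      assert (R1 : rodrigues l j (cos th) = INR (fact j) / INR (fact (2 * M + j)) *
        ((cos th ^ 2 - 1) ^ M * rodrigues l (2 * M + j) (cos th))).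
      { apply Rmult_eq_reg_l with (INR (fact (2 * M + j))); [|exact F2]. rewrite R0. field. exact F2. }
      rewrite R1. unfold profile. replace (l + M)%nat with (2 * M + j)%nat by lia.
      replace (cos th ^ 2 - 1) with (-1 * (sin th * sin th)).
      * rewrite !Rpow_mult_distr. field.
        repeat split; try apply pow_nonzero; trivial; try lra; apply INR_fact_neq_0.
      * generalize (sin2_cos2 th). unfold Rsqr. simpl. lra.
Qed.

(** The scalar stays unspecified because sectional curvature is invariant under rescaling. *)
Lemma e_lm_mode_field l m : (1 <= l)%nat -> (Z.abs m <= Z.of_nat l)%Z ->
  exists c, c <> 0 /\ chart_eq (e_lm l m) (mode_field m (RtoC c) (profile (Z.abs_nat m) l) (profile' (Z.abs_nat m) l)).
Proof.
  intros Hl Hm. destruct (Plm_profile l m Hm) as [c [Hc Ec]].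
  assert (Pl : 0 < INR l) by (apply lt_0_INR; lia).
  assert (Ps : 0 < sqrt (INR l * (INR l + 1))) by (apply sqrt_lt_R0, Rmult_lt_0_compat; lra).
  set (n := sqrt (INR (fact (Z.to_nat (Z.of_nat l - m))) / INR (fact (Z.to_nat (Z.of_nat l + m))) *
                     ((2 * INR l + 1) / (4 * PI)))).
  assert (Pn : 0 < n).
  { apply sqrt_lt_R0, Rmult_lt_0_compat; apply Rdiv_lt_0_compat; try apply INR_fact_lt_0; try lra.
    generalize PI_RGT_0; lra. }
  exists (n * c / sqrt (INR l * (INR l + 1))). split.
  - apply Rmult_integral_contrapositive_currified; [|apply Rinv_neq_0_compat; lra].
    apply Rmult_integral_contrapositive_currified; lra.
  - intros th ph Hr. rewrite <- sgrad_mode_field by (intros; apply profile_derive).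
    unfold e_lm. apply sgrad_ext; [|exact Hr]. clear th ph Hr. intros th ph [Hth _].
    unfold Ylm. fold n. rewrite Ec by exact Hth. fold (expi m ph). set (e := expi m ph).
    rewrite !RtoC_mult. unfold Rdiv. rewrite RtoC_mult, RtoC_inv by lra. rewrite RtoC_mult.
    field. intros H. apply RtoC_inj in H. lra.
Qed.

Lemma rodrigues_0_1 x : rodrigues 0 1 x = 0.
Proof. apply (rodrigues_top 0). Qed.

Lemma rodrigues_3_4 x : rodrigues 3 4 x = (15 * x ^ 2 - 3) / 2.
Proof.
  rewrite (rodrigues_up 2 3), (rodrigues_up 1 2). cbn [pred]. rewrite (rodrigues_up 1 1), (rodrigues_up 0 1). cbn [pred].
  rewrite (rodrigues_1 0), rodrigues_0_1, !rodrigues_0. simpl. field.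
Qed.

Lemma rodrigues_3_3 x : rodrigues 3 3 x = (5 * x ^ 3 - 3 * x) / 2.
Proof.
  rewrite (rodrigues_up 2 2), (rodrigues_up 1 1). cbn [pred]. rewrite (rodrigues_1 1), (rodrigues_1 0), !rodrigues_0. simpl. field.
Qed.

Lemma mode_field_profile_0_3 c : chart_eq (mode_field 0 (RtoC c) (profile 0 3) (profile' 0 3)) (zonal_field (3 * c / 2)).
Proof.
  intros th ph [Hth _]. assert (S0 := sin_neq0 th Hth). unfold mode_field, zonal_field. rewrite expi_0.
  unfold im, profile', zonal_speed. simpl (3 + 0)%nat. rewrite rodrigues_3_4. f_equal; C_components; field; exact S0.
Qed.

Lemma RInt_profile_0_3 : RInt (fun th => sin th * (eigenvalue 3 * profile 0 3 th * profile 0 3 th)) 0 PI = 24 / 7.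
Proof.
  apply is_RInt_unique.
  (* Minus a primitive of 12 P_3^2; the substitution x = cos theta reverses the sign. *)
  set (F := fun x => - 3 * (25 / 7 * x ^ 7 - 6 * x ^ 5 + 3 * x ^ 3)).
  replace (24 / 7) with (minus (F (cos PI)) (F (cos 0))).
  - apply (is_RInt_derive (fun th => F (cos th))).
    + intros th _. unfold F. auto_derive; [trivial|]. unfold profile, eigenvalue. simpl (3 + 0)%nat.
      rewrite rodrigues_3_3. simpl. field.
    + intros th _. apply (ex_derive_continuous (fun th => sin th * (eigenvalue 3 * profile 0 3 th * profile 0 3 th))).
      assert (E : ex_derive (profile 0 3) th) by (eexists; apply profile_derive). auto_derive. tauto.
  - unfold F. rewrite cos_PI, cos_0. unfold minus, plus, opp; simpl. field.
Qed.

(** The mean of e^(-i m phi) is zero for m nonzero, which [fourier_dph] for the constant function 1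
    shows without computing the integral. *)
Lemma herm_zonal_mode r m kap a a1 X Y : m <> 0%Z -> chart_eq X (zonal_field r) -> chart_eq Y (mode_field m kap a a1) ->
  herm X Y = RtoC 0.
Proof.
  intros Hm EX EY. unfold herm. rewrite (pairb_chart_eq _ _ _ _ EX (vconj_chart_eq _ _ EY)).
  assert (S1 : chart_funC (fun _ _ => RtoC 1)) by (split; simpl; chart_fun_tac).
  assert (S0 : chart_funC (fun _ _ => RtoC 0)) by (split; simpl; chart_fun_tac).
  assert (D := fourier_dph (- m) (fun _ _ => RtoC 1) (fun _ _ => RtoC 0) S1 S0 (fun _ _ => is_Cderive_const _ _) 0).
  assert (Z : fourier (- m) (fun _ _ => RtoC 0) 0 = RtoC 0).
  { unfold fourier. apply is_CInt_unique. eapply is_CInt_eq; [eapply is_CInt_ext; [exact PI2_ge0| |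
      exact (is_CInt_const (RtoC 0) 0 (2 * PI))]|]; [intros; simpl; ring|ring]. }
  rewrite Z in D.
  assert (F : fourier (- m) (fun _ _ => RtoC 1) 0 = RtoC 0).
  { assert (N : IZR m <> 0) by now apply not_0_IZR.
    unfold im in D. rewrite opp_IZR in D.
    assert (D1 := f_equal fst D). assert (D2 := f_equal snd D). simpl in D1, D2.
    C_components; apply Rmult_eq_reg_l with (IZR m); trivial; lra. }
  apply (pairb_val _ _ (fun _ => RtoC 0)).
  - intros th Hth. assert (Sn := sin_neq0 th Hth).
    assert (I := is_CInt_scal (Cmult (RtoC (sin th ^ 3 * zonal_speed r th * (- a1 th / sin th))) (Cconj kap))
       _ _ _ _ (fourier_is_CInt (- m) (fun _ _ => RtoC 1) 0 S1)). rewrite F in I.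
    eapply is_CInt_eq; [eapply is_CInt_ext; [exact PI2_ge0| |exact I]|ring].
    intros ph _. unfold pair_density, zonal_field, mode_field, vconj.
    assert (E : expi (- m) ph = Cconj (expi m ph)).
    { unfold expi, Cconj. simpl. rewrite opp_IZR, Ropp_mult_distr_l_reverse, cos_neg, sin_neg.
      reflexivity. }
    cbv beta. rewrite E. generalize (expi m ph). intros e. C_components; field; exact Sn.
  - eapply is_CInt_eq; [apply is_CInt_const|ring].
Qed.

Lemma comb_single m l th : comb m [(1, l)] th = profile (Z.abs_nat m) l th.
Proof. unfold comb. simpl. ring. Qed.

Lemma comb'_single m l th : comb' m [(1, l)] th = profile' (Z.abs_nat m) l th.
Proof. unfold comb'. simpl. ring. Qed.

(** Orthogonality extracts the degree l coefficient from the numerator, and the norm of e^m_l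
    cancels. What remains below is the squared norm of u, 64 pi r^2 / 21, from 24 / 7 and r = 3 c /
    2. *)
Lemma sec_coeff l m : (6 <= l)%nat -> (Z.abs m <= Z.of_nat l)%Z ->
  exists r, r <> 0 /\
   sec (e_lm 3 0) (e_lm l m) = RtoC (coeff l (curv_comb m r [(1, l)]) / (64 * PI / 21 * r ^ 2)).
Proof.
  intros Hl Hm.
  destruct (e_lm_mode_field 3 0 ltac:(lia) ltac:(simpl; lia)) as [c [Hc Eu]].
  destruct (e_lm_mode_field l m ltac:(lia) Hm) as [d [Hd Ev]].
  set (u := e_lm 3 0) in *. set (v := e_lm l m) in *. set (M := Z.abs_nat m) in *.
  change (Z.abs_nat 0) with 0%nat in Eu.
  assert (EU := chart_eq_trans _ _ _ Eu (mode_field_profile_0_3 c)). set (r := 3 * c / 2) in *.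
  exists r. split; [unfold r; lra|].
  assert (Ev' : chart_eq v (mode_field m (RtoC d) (comb m [(1, l)]) (comb' m [(1, l)]))).
  { eapply chart_eq_trans; [exact Ev|]. apply mode_field_ext; trivial; intros th;
    [now rewrite comb_single|now rewrite comb'_single]. }
  assert (ER := Rcurv_comb m r (RtoC d) [(1, l)] u v EU Ev'
     ltac:(constructor; [simpl; lia|constructor])).
  assert (Hnum := herm_mode_field m _ _ _ _ _ _ _ _ _ _ _ _ ER Ev (comb_eigen_profile m _) (profile_eigen_profile m l)).
  assert (Hvv := herm_mode_field m _ _ _ _ _ _ _ _ _ _ _ _ Ev' Ev (comb_eigen_profile m _) (profile_eigen_profile m l)).
  assert (Huu := herm_mode_field 0 _ _ _ _ _ _ _ _ _ _ _ _ Eu Eu (profile_eigen_profile 0 3) (profile_eigen_profile 0 3)).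
  simpl in Huu. fold (eigenvalue 3) in Huu. change (Z.abs_nat 0) with 0%nat in Huu.
  rewrite (RInt_ext _ (fun th => sin th * (eigenvalue 3 * profile 0 3 th * profile 0 3 th))) in Huu.
  2: { intros th _. unfold eigenvalue. simpl. reflexivity. }
  rewrite RInt_profile_0_3 in Huu.
  change (INR l * (INR l + 1)) with (eigenvalue l) in Hnum, Hvv. cbv beta in Hnum, Hvv.
  rewrite (RInt_profile_comb m l) in Hnum. rewrite (RInt_profile_comb m l), coeff_single_eq in Hvv. fold M in Hnum, Hvv.
  assert (Huv : herm u v = RtoC 0).
  (* For m = 0 the phases do not separate the fields; orthogonality then comes from the degrees 3
     and l. *)
  { destruct (Z.eq_dec m 0) as [E|E]; [|exact (herm_zonal_mode r m _ _ _ _ _ E EU Ev)].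
    subst m. change M with 0%nat in *.
    assert (Eu' : chart_eq u (mode_field 0 (RtoC c) (comb 0 [(1, 3%nat)]) (comb' 0 [(1, 3%nat)]))).
    { eapply chart_eq_trans; [exact Eu|]. apply mode_field_ext; trivial; intros th;
      [now rewrite comb_single|now rewrite comb'_single]. }
    rewrite (herm_mode_field 0 _ _ _ _ _ _ _ _ _ _ _ _ Eu' Ev (comb_eigen_profile 0 _) (profile_eigen_profile 0 l)).
    change (INR l * (INR l + 1)) with (eigenvalue l). cbv beta. rewrite (RInt_profile_comb 0 l), coeff_single by lia. C_components; ring. }
  unfold sec. rewrite Hnum, Huu, Hvv, Huv, Cmod_0.
  assert (N0 : profile_norm2 M l <> 0) by (apply profile_norm2_neq0; unfold M; lia).
  assert (L0 : eigenvalue l <> 0) by (apply eigenvalue_neq0; lia).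
  assert (P0 : PI <> 0) by apply PI_neq0.
  set (k := coeff l (curv_comb m r [(1, l)])).
  assert (Cc : forall x, Cconj (RtoC x) = RtoC x) by (intros; C_components; ring).
  rewrite !Cc, <- !RtoC_mult, <- RtoC_minus.
  rewrite <- RtoC_div. 
  - f_equal. unfold r. field. repeat split; assumption.
  - replace (_ - _) with (c * c * (d * d) * (PI * PI) * eigenvalue l * profile_norm2 M l * (96 / 7)) by field.
    assert (K : 96 / 7 <> 0) by lra. revert K P0 L0 N0. generalize (96 / 7) PI (eigenvalue l) (profile_norm2 M l).
    intros q p y z K P0 L0 N0.
    repeat apply Rmult_integral_contrapositive_currified; assumption.
Qed.

(** * The limit *)

(* In the variables t = 1/l and Y = (m/l)^2, the product of the two coefficients between
   the degrees l + a - 1 and l + a in the recurrence for cos is rec_coeff t Y a. *)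
Definition rec_den (t a : R) : R := (2 * (1 + a * t) - t) * (2 * (1 + a * t) + t).
Definition rec_coeff (t Y a : R) : R := ((1 + a * t) ^ 2 - Y) / rec_den t a.
(** The path sum with the powers of t divided out, so that it makes sense at t = 0. With e_a for
    [rec_coeff t Y a], the outer paths are joined through e_1 e_2 - e_0 e_(-1) = e_1 (e_2 - e_0) +
    e_0 (e_1 - e_(-1)), and each difference is divisible by t. The two outer weights nearly cancel:
    their sum, divided by t^2, is the term with -120 t^2. *)
Definition curv_fun (t Y : R) : R :=
  Y / 4 * (25 * (((t ^ 2 / 4 - Y) * (-8) * (2 + 2 * t) / (rec_den t 2 * rec_den t 0) * rec_coeff t Y 1
                  + rec_coeff t Y 0 * ((t ^ 2 / 4 - Y) * (-16) / (rec_den t 1 * rec_den t (-1))))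
                 * ((-16 - 88 * t - 72 * t ^ 2 + 180 * t ^ 3)
                    / ((1 + t) * ((1 + 2 * t) * (1 + 3 * t))))
                 + rec_coeff t Y 0 * rec_coeff t Y (-1) *
                   (-120 * t ^ 2 * (1 + t - 12 * t ^ 2)
                    / ((1 + t) * ((1 + 2 * t) * (1 + 3 * t)) * ((1 - 2 * t) * (1 - t)))))
           + 144 * t ^ 2 * (5 * (rec_coeff t Y 1 + rec_coeff t Y 0) - 1) ^ 2 / (1 + t) ^ 2).

Lemma rec_den_neq0 t a : 0 < 2 * (1 + a * t) - t -> 0 <= t -> rec_den t a <> 0.
Proof. intros H K. apply Rmult_integral_contrapositive_currified; lra. Qed.

(** For fixed t and Y, [rec_coeff] depends on a only through a t, so differences contain the factor
    t exhibited here. *)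
Lemma rec_coeff_diff_2_0 t Y : rec_den t 2 <> 0 -> rec_den t 0 <> 0 ->
  rec_coeff t Y 2 - rec_coeff t Y 0 = t * ((t ^ 2 / 4 - Y) * (-8) * (2 + 2 * t) / (rec_den t 2 * rec_den t 0)).
Proof.
  intros H K. unfold rec_coeff.
  apply Rmult_eq_reg_r with (rec_den t 2 * rec_den t 0); [|now apply Rmult_integral_contrapositive_currified].
  transitivity (((1 + 2 * t) ^ 2 - Y) * rec_den t 0 - ((1 + 0 * t) ^ 2 - Y) * rec_den t 2);
    [field; now split|].
  transitivity (t * ((t ^ 2 / 4 - Y) * (-8) * (2 + 2 * t))); [unfold rec_den; field|field; now split].
Qed.

Lemma rec_coeff_diff_1_m1 t Y : rec_den t 1 <> 0 -> rec_den t (-1) <> 0 ->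
  rec_coeff t Y 1 - rec_coeff t Y (-1) = t * ((t ^ 2 / 4 - Y) * (-16) / (rec_den t 1 * rec_den t (-1))).
Proof.
  intros H K. unfold rec_coeff.
  apply Rmult_eq_reg_r with (rec_den t 1 * rec_den t (-1)); [|now apply Rmult_integral_contrapositive_currified].
  transitivity (((1 + 1 * t) ^ 2 - Y) * rec_den t (-1) - ((1 + -1 * t) ^ 2 - Y) * rec_den t 1);
    [field; now split|].
  transitivity (t * ((t ^ 2 / 4 - Y) * (-16))); [unfold rec_den; field|field; now split].
Qed.

Lemma curv_fun_eq t Y e1 e2 e0 em Fp F0 Fm : 0 < t <= / 6 ->
  e1 = rec_coeff t Y 1 -> e2 = rec_coeff t Y 2 -> e0 = rec_coeff t Y 0 -> em = rec_coeff t Y (-1) ->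
  Fp = t * ((-16 - 88 * t - 72 * t ^ 2 + 180 * t ^ 3) / ((1 + t) * ((1 + 2 * t) * (1 + 3 * t)))) ->
  Fm = t * ((16 - 40 * t - 56 * t ^ 2 + 180 * t ^ 3) / ((1 + t) * ((1 - 2 * t) * (1 - t)))) ->
  F0 = 144 * t ^ 4 / (1 + t) ^ 2 ->
  Y / (4 * t ^ 2) * (25 * (e1 * e2) * Fp + (5 * (e1 + e0) - 1) ^ 2 * F0 + 25 * (e0 * em) * Fm)
  = curv_fun t Y.
Proof.
  intros Ht -> -> -> -> -> -> ->.
  assert (D0 : rec_den t 0 <> 0) by (apply rec_den_neq0; lra). assert (D1 : rec_den t 1 <> 0) by (apply rec_den_neq0; lra).
  assert (D2 : rec_den t 2 <> 0) by (apply rec_den_neq0; lra). assert (D3 : rec_den t (-1) <> 0) by (apply rec_den_neq0; lra).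
  assert (E20 := rec_coeff_diff_2_0 t Y D2 D0). assert (E1m := rec_coeff_diff_1_m1 t Y D1 D3). unfold curv_fun.
  set (a := (t ^ 2 / 4 - Y) * (-8) * (2 + 2 * t) / (rec_den t 2 * rec_den t 0)) in *.
  set (b := (t ^ 2 / 4 - Y) * (-16) / (rec_den t 1 * rec_den t (-1))) in *.
  replace (rec_coeff t Y 2) with (rec_coeff t Y 0 + t * a) by lra.
  replace (rec_coeff t Y 1) with (rec_coeff t Y (-1) + t * b) by lra.
  (* Once e_1 and e_2 are expressed by the differences, the identity holds for arbitrary values of
     the four quantities, which keeps [field] tractable. *)
  generalize (rec_coeff t Y 0) (rec_coeff t Y (-1)) a b. intros E0 Em a' b'. field. lra.
Qed.

(** The product is ((k + 1)^2 - m^2) / ((2 k + 1) (2 k + 3)), the square of the off-diagonal entry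
    of cos in an orthonormal basis; numerator and denominator are divided by l^2. *)
Lemma up_down_rec_coeff m k l a : (6 <= l)%nat -> INR k = INR l + a - 1 -> -1 <= a ->
  up_coeff m k * down_coeff m (S k) = rec_coeff (/ INR l) (INR (Z.abs_nat m) ^ 2 / INR l ^ 2) a.
Proof.
  intros Hl Hk Ha. assert (Hx : 6 <= INR l) by (apply (le_INR 6) in Hl; simpl in Hl; lra).
  unfold up_coeff, down_coeff. rewrite S_INR, Hk. set (x := INR l) in *. set (mu := INR (Z.abs_nat m)).
  unfold rec_coeff, rec_den. field. repeat split; lra.
Qed.

Lemma coeff_curv_fun m r l : (6 <= l)%nat ->
  coeff l (curv_comb m r [(1, l)]) = r ^ 2 * curv_fun (/ INR l) (INR (Z.abs_nat m) ^ 2 / INR l ^ 2).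
Proof.
  intros Hl. assert (Hx : 6 <= INR l) by (apply (le_INR 6) in Hl; simpl in Hl; lra).
  assert (E := coeff_curv_comb m r (l - 4)). replace (S (S (S (S (l - 4))))) with l in E by lia.
  cbv zeta in E. rewrite E by lia. clear E.
  assert (Ht : 0 < / INR l <= / 6).
  { split; [apply Rinv_0_lt_compat; lra|apply Rinv_le_contravar; lra]. }
  rewrite <- (curv_fun_eq (/ INR l) (INR (Z.abs_nat m) ^ 2 / INR l ^ 2)
    (up_coeff m l * down_coeff m (S l)) (up_coeff m (S l) * down_coeff m (S (S l))) (up_coeff m (pred l) * down_coeff m l)
    (up_coeff m (pred (pred l)) * down_coeff m (pred l)) (path_weight (eigenvalue l) (eigenvalue (S (S l))))
    (path_weight (eigenvalue l) (eigenvalue l)) (path_weight (eigenvalue l) (eigenvalue (pred (pred l)))) Ht).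
  - set (f := INR (Z.abs_nat m)). field. lra.
  - apply up_down_rec_coeff; trivial; lra.
  - apply up_down_rec_coeff; trivial; [rewrite S_INR|]; lra.
  - replace l with (S (pred l)) at 2 by lia.
    apply up_down_rec_coeff; trivial; [rewrite <- Nat.sub_1_r, minus_INR by lia; simpl|]; lra.
  - replace (pred l) with (S (pred (pred l))) at 2 by lia.
    apply up_down_rec_coeff; trivial; [|lra]. replace (pred (pred l)) with (l - 2)%nat by lia.
    rewrite minus_INR by lia. simpl. lra.
  - unfold path_weight, eigenvalue. rewrite !S_INR. set (x := INR l) in *. field. repeat split; try lra; nra.
  - replace (pred (pred l)) with (l - 2)%nat by lia. unfold path_weight, eigenvalue.
    rewrite minus_INR by lia. simpl (INR 2). set (x := INR l) in *. field. repeat split; try lra; nra.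
  - unfold path_weight, eigenvalue. set (x := INR l) in *. field. repeat split; try lra; nra.
Qed.

Ltac lim_seq_tac Cst Hp Hi tac :=
  repeat lazymatch goal with
  | |- is_lim_seq (fun _ => ?c) _ => apply Cst
  | |- is_lim_seq (fun n => @?u n + @?v n) _ => apply (is_lim_seq_plus' u v)
  | |- is_lim_seq (fun n => @?u n - @?v n) _ => apply (is_lim_seq_minus' u v)
  | |- is_lim_seq (fun n => @?u n * @?v n) _ => apply (is_lim_seq_mult' u v)
  | |- is_lim_seq (fun n => @?u n ^ ?k) _ => apply (Hp u)
  | |- is_lim_seq (fun n => / @?u n) _ => apply (Hi u)
  | |- is_lim_seq _ _ => first [assumption | tac]
  end.

Lemma curv_fun_lim (t Y : nat -> R) (q : R) : is_lim_seq t 0 -> is_lim_seq Y q ->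
  is_lim_seq (fun n => curv_fun (t n) (Y n)) (- 50 * q ^ 2 * (1 - q)).
Proof.
  intros Ht HY.
  assert (Cst : forall c : R, is_lim_seq (fun _ => c) c) by (intros; apply is_lim_seq_const).
  assert (Hp : forall (u : nat -> R) (l : R) k, is_lim_seq u l -> is_lim_seq (fun n => u n ^ k) (l ^ k)).
  { intros u l k Hu. induction k as [|k IH]; simpl; [apply Cst|]. now apply is_lim_seq_mult'. }
  assert (Hi : forall u l, is_lim_seq u (Finite l) -> l <> 0 -> is_lim_seq (fun n => / u n) (Finite (/ l))).
  { intros u l Hu Hl. apply (is_lim_seq_inv u l Hu). intros E. apply Hl. now injection E. }
  assert (HDe : forall a : R, is_lim_seq (fun n => rec_den (t n) a) (rec_den 0 a)).
  { intros a. unfold rec_den. lim_seq_tac Cst Hp Hi fail. }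
  assert (D0 : forall a, rec_den 0 a = 4) by (intros a; unfold rec_den; ring).
  assert (HE : forall a : R, is_lim_seq (fun n => rec_coeff (t n) (Y n) a) (rec_coeff 0 q a)).
  { intros a. unfold rec_coeff, Rdiv. lim_seq_tac Cst Hp Hi ltac:(apply HDe). rewrite D0. lra. }
  (* Here q is the limit of (m / l)^2. At t = 0 only the difference quotients survive: both equal q,
     each [rec_coeff] is (1 - q) / 4, and the weight is -16. *)
  replace (- 50 * q ^ 2 * (1 - q)) with (curv_fun 0 q) by (unfold curv_fun, rec_coeff, rec_den; field).
  unfold curv_fun, Rdiv. lim_seq_tac Cst Hp Hi ltac:(first [apply HDe|apply HE]); rewrite ?D0; lra.
Qed.

Theorem theorem5 (m : nat -> Z) (q : R) :
  (forall l : nat, (3 <= l)%nat -> (Z.abs (m l) <= Z.of_nat l)%Z) ->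
  -1 <= q <= 1 ->
  is_lim_seq (fun l : nat => IZR (m l) / INR l) q ->
  filterlim (fun l : nat => sec (e_lm 3 0) (e_lm l (m l))) eventually
    (locally (RtoC (- (525 / (32 * PI)) * q ^ 4 * (1 - q ^ 2)))).
Proof.
  intros Hm _ Hq.
  assert (L : is_lim_seq (fun l => 21 / (64 * PI) * curv_fun (/ INR l) (INR (Z.abs_nat (m l)) ^ 2 / INR l ^ 2))
     (- (525 / (32 * PI)) * q ^ 4 * (1 - q ^ 2))).
  { replace (- (525 / (32 * PI)) * q ^ 4 * (1 - q ^ 2))
      with (21 / (64 * PI) * (- 50 * (q ^ 2) ^ 2 * (1 - q ^ 2))) by (field; apply PI_neq0).
    apply is_lim_seq_mult'; [apply is_lim_seq_const|]. apply curv_fun_lim.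
    - apply (is_lim_seq_inv INR p_infty is_lim_seq_INR). discriminate.
    - assert (H2 := is_lim_seq_mult' _ _ _ _ Hq Hq).
      replace (q ^ 2) with (q * q) by ring.
      apply is_lim_seq_ext_loc with (2 := H2). exists 1%nat. intros l Hl.
      rewrite <- abs_nat_sqr. field. apply not_0_INR. lia. }
  apply filterlim_ext_loc with
    (fun l => RtoC (21 / (64 * PI) * curv_fun (/ INR l) (INR (Z.abs_nat (m l)) ^ 2 / INR l ^ 2))).
  - exists 6%nat. intros l Hl. destruct (sec_coeff l (m l) Hl (Hm l ltac:(lia))) as [r [Hr E]].
    rewrite E, coeff_curv_fun by assumption. f_equal. field. split; [exact Hr|apply PI_neq0].
  (* All values are real: a ball in C is entered through the first component, while the second stays
     at the centre. *)
  - intros P [eps HP]. apply (L (fun y => P (RtoC y))). exists eps. intros y Hy.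
    apply HP. split; [exact Hy|apply ball_center].
Qed.
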